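(* For $s\in\mathbb{C}$ with $\operatorname{Re} s>0$, the following hold: $$\psi(s)=\frac{1}{2\pi i}\int_L\left(\frac{e^z}{z}+\frac{e^{sz}}{1-e^z}\right)\operatorname{Log} z\,dz,$$ $$\psi(s)=\frac{\Gamma(s)}{2\pi i}\int_L z^{-s}e^z\operatorname{Log} z\,dz,$$ $$\gamma=-\psi(1)=\frac{-1}{2\pi i}\int_L\frac{e^z\operatorname{Log} z}{z}\,dz,$$ $$\psi(s)+\gamma=\frac{1}{2\pi i}\int_L\frac{e^{sz}}{1-e^z}\operatorname{Log} z\,dz.$$
   Context: $\psi=\Gamma'/\Gamma$ is the digamma function and $\gamma$ is Euler's constant. $L=L_-\cup L_\epsilon\cup L_+$ is the Hankel contour, with small $\epsilon$ ($0<\epsilon<2\pi$): $L_-$ is the lower side ($\arg z=-\pi$) of the ray $(-\infty,-\epsilon)$ traced left to right; $L_\epsilon=\{\epsilon e^{i\theta}:-\pi\le\theta\le\pi\}$ is traced counterclockwise; $L_+$ is the upper side ($\arg z=\pi$) of the ray traced right to left. $\operatorname{Log} z=\ln|z|+i\arg z$ with $\arg z=-\pi$ on $L_-$, $\arg z=\theta$ on $L_\epsilon$, $\arg z=\pi$ on $L_+$, and $z^{w}=e^{w\operatorname{Log} z}$. *)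

(* Defs.v *)
From Stdlib Require Export Reals.
From Coquelicot Require Export Coquelicot.
(* Stdlib reals with Coquelicot's complex numbers. *)

Open Scope R_scope.
Open Scope C_scope.

Definition Cexp (z : C) : C :=
  RtoC (exp (Re z)) * (RtoC (cos (Im z)) + Ci * RtoC (sin (Im z))).

(* Euler's integral: the Gamma function on the half-plane [0 < Re s], the only
   region where it is used; elsewhere the value is meaningless. *)
Definition CGamma (s : C) : C :=
  @RInt_gen C_R_CompleteNormedModule
    (fun t : R => Cexp ((s - 1) * RtoC (ln t)) * RtoC (exp (- t)))
    (at_right 0) (Rbar_locally p_infty).

Definition digamma (s : C) : C := C_derive CGamma s / CGamma s.

Definition euler_gamma : R :=
  real (Lim_seq (fun n : nat =>
    (sum_n_m (fun k : nat => / INR k) 1 n - ln (INR n))%R)).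

Definition Log_arg (theta : R) (z : C) : C :=
  RtoC (ln (Cmod z)) + Ci * RtoC theta.

(* The two sides of the cut carry different values of the logarithm, so an
   integrand is a function [F z w] of the point [z] and of the value [w] of
   [Log z] there. *)

Definition is_int_lower (eps : R) (F : C -> C -> C) (l : C) : Prop :=
  @is_RInt_gen C_R_NormedModule
    (fun x : R => F (RtoC x) (Log_arg (- PI) (RtoC x)))
    (Rbar_locally m_infty) (at_point (- eps)%R) l.

Definition circle_pt (eps theta : R) : C :=
  RtoC eps * Cexp (Ci * RtoC theta).

(* [Ci * circle_pt eps theta] is the derivative of the parametrization. *)
Definition is_int_circle (eps : R) (F : C -> C -> C) (l : C) : Prop :=
  @is_RInt C_R_NormedModule
    (fun theta : R =>
       F (circle_pt eps theta) (Log_arg theta (circle_pt eps theta))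
         * (Ci * circle_pt eps theta))
    (- PI)%R PI l.

Definition is_int_upper (eps : R) (F : C -> C -> C) (l : C) : Prop :=
  @is_RInt_gen C_R_NormedModule
    (fun x : R => F (RtoC x) (Log_arg PI (RtoC x)))
    (at_point (- eps)%R) (Rbar_locally m_infty) l.

(* Each of the three pieces is required to converge. *)
Definition is_hankel_int (eps : R) (F : C -> C -> C) (l : C) : Prop :=
  exists l1 l2 l3 : C,
    is_int_lower eps F l1 /\ is_int_circle eps F l2 /\ is_int_upper eps F l3 /\
    l = l1 + l2 + l3.

(* Main.v *)
Require Import Defs.
From Stdlib Require Import Lra Lia Factorial.

(* With [w = Log z] the Hankel contour becomes the boundary of the half strip
   [u < Re w, |Im w| < PI], where [u = ln eps]; there the integrands are holomorphic
   functions of [w], and moving [u] does not change the integral.  Likewise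
   [Gamma s] is the integral of [e^(s x - e^x)] over the real line.

   Let [H s] and [K s] be the Hankel integrals of [z^(-s) e^z] and [z^(-s) e^z Log z].
   Integration by parts gives [H s = s H(s+1)] and [K s = s K(s+1) - H(s+1)], which match
   [Gamma(s+1) = s Gamma s] and its derivative, so that [Gamma s * H s] and
   [Gamma s * K s - 2 PI i digamma s] are 1-periodic in [s].  They are evaluated along
   [s + n]: after centring at [z = n], the weights [e^(n x - e^x)] of Gamma concentrate at
   [x = ln n] (second moments), and those of the Hankel integral over the circle [|z| = n]
   at the angle 0.  Hence [Gamma s * H s = 2 PI i] and [Gamma s * K s = 2 PI i digamma s].
   The same estimate gives [digamma(s+n) - ln n -> 0], hence [digamma 1 = - gamma].

   For [L s], the Hankel integral of [e^(s z) Log z / (1 - e^z)], shrinking the circle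
   to 0 gives [L s = L(s+1) - 2 PI i / s], [L(s+n) - L(1+n) -> 0] and [L 1 = 0], so
   that [L s = 2 PI i (digamma s - digamma 1)]. *)

(** * The complex exponential and complex derivatives *)

(** Both periodic products are anchored at the integers, where everything is exact: Gamma at [n] is
    [(n-1)!], and [(n-1)!] times the Hankel integral is [2 PI i]. Along [s + n] it remains to
    control a factor vanishing at the centre, such as [e^(s v) - 1] or [v e^(s v)], relative to
    [(n-1)!]; no asymptotic constant has to be known. For Gamma the moments are ratios of
    factorials. On the circle the absolute weight only gives [e^(n - n ln n)], and [(n-1)!] times
    this is no better than order [n^(-1/2)], so a one-sided Stirling bound has to be proved.

    [K] is minus the derivative of [H] in [s], but it is never treated as one: it has its own
    recurrence and its own limit. Since [Gamma s * H s] is a nonzero constant, the argument also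
    shows that Gamma has no zeros, so that dividing by it in [digamma] is legitimate.

    The integrand of [L] has poles at the nonzero multiples of [2 PI i], so its contour moves only
    within [u < ln (2 PI)]: this is the source of the upper bound on [eps]. The first formula adds
    the fourth to the negative of the third. *)

Lemma Cexp_plus (z w : C) : Cexp (z + w) = Cexp z * Cexp w.
Proof.
  unfold Cexp, Re, Im; simpl.
  rewrite exp_plus, cos_plus, sin_plus.
  apply injective_projections; simpl; ring.
Qed.

Lemma Cexp_RtoC (x : R) : Cexp (RtoC x) = RtoC (exp x).
Proof.
  unfold Cexp, Re, Im; simpl; rewrite cos_0, sin_0.
  apply injective_projections; simpl; ring.
Qed.

Lemma Cexp_0 : Cexp 0 = 1.
Proof. rewrite Cexp_RtoC, exp_0; reflexivity. Qed.

Lemma Cmod_Cexp (z : C) : Cmod (Cexp z) = exp (Re z).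
Proof.
  unfold Cexp; rewrite Cmod_mult, Cmod_R, Rabs_pos_eq by (left; apply exp_pos).
  replace (Cmod _) with 1%R; [ring|].
  unfold Cmod; simpl.
  replace (_ + _)%R with 1%R; [now rewrite sqrt_1|].
  generalize (sin2_cos2 (Im z)); unfold Rsqr, Im; simpl; intros H; ring_simplify; lra.
Qed.

Lemma Cexp_neq_0 (z : C) : Cexp z <> 0.
Proof.
  apply Cmod_gt_0; rewrite Cmod_Cexp; apply exp_pos.
Qed.

Lemma Cexp_opp (z : C) : Cexp (- z) = / Cexp z.
Proof.
  assert (H : Cexp (- z) * Cexp z = 1).
  { rewrite <- Cexp_plus; replace (- z + z) with (RtoC 0) by ring; apply Cexp_0. }
  apply (f_equal (fun u => u * / Cexp z)) in H.
  rewrite <- Cmult_assoc, Cinv_r, Cmult_1_r, Cmult_1_l in H; auto using Cexp_neq_0.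
Qed.

Lemma Cexp_add_iPI (x : R) : Cexp (RtoC x + Ci * RtoC PI) = RtoC (- exp x).
Proof.
  unfold Cexp, Re, Im; simpl.
  replace (x + _)%R with x by ring.
  replace (0 + (0 * 0 + 1 * PI))%R with PI by ring.
  rewrite cos_PI, sin_PI; apply injective_projections; simpl; ring.
Qed.

Lemma Cexp_sub_iPI (x : R) : Cexp (RtoC x + Ci * RtoC (- PI)) = RtoC (- exp x).
Proof.
  unfold Cexp, Re, Im; simpl.
  replace (x + _)%R with x by ring.
  replace (0 + (0 * 0 + 1 * - PI))%R with (- PI)%R by ring.
  rewrite cos_neg, sin_neg, cos_PI, sin_PI; apply injective_projections; simpl; ring.
Qed.

(** Two structures on [C] are in play: a normed module over the reals for paths and integrals, and a
    module over itself, in [CC_derive], for holomorphy. *)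
Definition CR_derive (f : R -> C) (x : R) (l : C) : Prop :=
  @is_derive R_AbsRing C_R_NormedModule f x l.

Definition CR_int (f : R -> C) (a b : R) (l : C) : Prop :=
  @is_RInt C_R_NormedModule f a b l.

Definition CR_int_gen (f : R -> C) (Fa Fb : (R -> Prop) -> Prop) (l : C) : Prop :=
  @is_RInt_gen C_R_NormedModule f Fa Fb l.

Definition CR_cont (f : R -> C) (x : R) : Prop :=
  @continuous R_UniformSpace C_R_NormedModule f x.

Definition CC_derive (f : C -> C) (z l : C) : Prop :=
  @is_derive C_AbsRing (AbsRing_NormedModule C_AbsRing) f z l.

Lemma CR_derive_intro (f : R -> C) (x : R) (l : C) :
  (forall eps : posreal, exists d : posreal, forall h : R, (Rabs h < d)%R ->
     (Cmod (f (x + h)%R - f x - RtoC h * l) <= eps * Rabs h)%R) ->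
  CR_derive f x l.
Proof.
  intros H; split; [apply is_linear_scal_l|].
  intros y Hy; apply (@is_filter_lim_locally_unique R_AbsRing R_NormedModule) in Hy; subst y.
  intros eps; destruct (H eps) as [d Hd]; exists d; intros y Hy.
  change (Rabs (y - x) < d)%R in Hy.
  rewrite <- Cmod_norm.
  specialize (Hd (y - x)%R Hy).
  rewrite (Rplus_minus x y) in Hd.
  rewrite scal_R_Cmult; exact Hd.
Qed.

Lemma Cplus_minus (z w : C) : z + (w - z) = w.
Proof. ring. Qed.

Lemma CC_derive_iff (f : C -> C) (z l : C) :
  CC_derive f z l <->
  (forall eps : posreal, exists d : posreal, forall h : C, (Cmod h < d)%R ->
     Cmod (f (z + h) - f z - h * l) <= eps * Cmod h).
Proof.
  split.
  - intros [_ H] eps.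
    destruct (H z (fun P HP => HP) eps) as [d Hd]; exists d; intros h Hh.
    assert (E : (z + h) - z = h) by ring.
    specialize (Hd (z + h)).
    change ((Cmod ((z + h) - z)%C < d)%R -> (Cmod (f (z + h) - f z - ((z + h) - z) * l)%C
      <= eps * Cmod ((z + h) - z)%C)%R) in Hd.
    rewrite E in Hd; auto.
  - intros H; split; [apply is_linear_scal_l|].
    intros y Hy; apply (@is_filter_lim_locally_unique C_AbsRing (AbsRing_NormedModule C_AbsRing)) in Hy; subst y.
    intros eps; destruct (H eps) as [d Hd]; exists d; intros y Hy.
    change (Cmod (y - z) < d)%R in Hy.
    specialize (Hd (y - z) Hy).
    replace (z + (y - z)) with y in Hd by (symmetry; exact (Cplus_minus z y)).
    exact Hd.
Qed.

(** Chain rule along the path [p + x q]. With [q = 1] and [q = Ci] it gives the derivatives along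
    the rays and along the circle in logarithmic coordinates. *)
Lemma CC_derive_line (f : C -> C) (p q l : C) (x : R) :
  CC_derive f (p + RtoC x * q) l ->
  CR_derive (fun t => f (p + RtoC t * q)) x (q * l).
Proof.
  intros H; apply CR_derive_intro; intros eps.
  assert (Hq : (0 < Cmod q + 1)%R) by (generalize (Cmod_ge_0 q); lra).
  assert (He : (0 < eps / (Cmod q + 1))%R) by (apply Rdiv_lt_0_compat; [apply eps|auto]).
  destruct (proj1 (CC_derive_iff _ _ _) H (mkposreal _ He)) as [d Hd]; simpl in Hd.
  assert (Hd' : (0 < d / (Cmod q + 1))%R) by (apply Rdiv_lt_0_compat; [apply d|auto]).
  exists (mkposreal _ Hd'); intros h Hh; simpl in Hh.
  assert (Hm : (Cmod (RtoC h * q) <= Rabs h * (Cmod q + 1))%R).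
  { rewrite Cmod_mult, Cmod_R; apply Rmult_le_compat_l; [apply Rabs_pos|lra]. }
  assert (Hm2 : (Cmod (RtoC h * q) < d)%R).
  { eapply Rle_lt_trans; [exact Hm|].
    apply (Rmult_lt_compat_r (Cmod q + 1)) in Hh; auto.
    unfold Rdiv in Hh; rewrite Rmult_assoc, Rinv_l in Hh; lra. }
  specialize (Hd _ Hm2).
  replace (p + RtoC (x + h) * q) with (p + RtoC x * q + RtoC h * q)
    by (rewrite RtoC_plus; ring).
  replace (RtoC h * (q * l)) with (RtoC h * q * l) by ring.
  eapply Rle_trans; [exact Hd|].
  apply (Rmult_le_compat_l (eps / (Cmod q + 1))) in Hm; [|lra].
  eapply Rle_trans; [exact Hm|]; right; field; lra.
Qed.

Lemma CC_derive_val (f : C -> C) (z l l' : C) :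
  CC_derive f z l -> l = l' -> CC_derive f z l'.
Proof. intros H <-; exact H. Qed.

Lemma CC_derive_const (a z : C) : CC_derive (fun _ => a) z 0.
Proof. exact (@is_derive_const C_AbsRing (AbsRing_NormedModule C_AbsRing) a z). Qed.

Lemma CC_derive_id (z : C) : CC_derive (fun w => w) z 1.
Proof. exact (@is_derive_id C_AbsRing z). Qed.

Lemma CC_derive_plus (f g : C -> C) (z a b : C) :
  CC_derive f z a -> CC_derive g z b -> CC_derive (fun w => f w + g w) z (a + b).
Proof. exact (@is_derive_plus C_AbsRing (AbsRing_NormedModule C_AbsRing) f g z a b). Qed.

Lemma CC_derive_opp (f : C -> C) (z a : C) :
  CC_derive f z a -> CC_derive (fun w => - f w) z (- a).
Proof. exact (@is_derive_opp C_AbsRing (AbsRing_NormedModule C_AbsRing) f z a). Qed.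

Lemma CC_derive_minus (f g : C -> C) (z a b : C) :
  CC_derive f z a -> CC_derive g z b -> CC_derive (fun w => f w - g w) z (a - b).
Proof. exact (@is_derive_minus C_AbsRing (AbsRing_NormedModule C_AbsRing) f g z a b). Qed.

Lemma CC_derive_mult (f g : C -> C) (z a b : C) :
  CC_derive f z a -> CC_derive g z b ->
  CC_derive (fun w => f w * g w) z (a * g z + f z * b).
Proof. intros Hf Hg; exact (@is_derive_mult C_AbsRing f g z a b Hf Hg Cmult_comm). Qed.

Lemma CC_derive_comp (f g : C -> C) (z a b : C) :
  CC_derive f (g z) a -> CC_derive g z b -> CC_derive (fun w => f (g w)) z (b * a).
Proof. exact (@is_derive_comp C_AbsRing (AbsRing_NormedModule C_AbsRing) f g z a b). Qed.

Lemma CR_derive_cont (f : R -> C) (x : R) (l : C) : CR_derive f x l -> CR_cont f x.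
Proof.
  intros H; apply (@ex_derive_continuous R_AbsRing C_R_NormedModule f x).
  exists l; exact H.
Qed.

Lemma CR_int_derive (f df : R -> C) (a b : R) :
  (forall x, CR_derive f x (df x)) -> (forall x, CR_cont df x) ->
  CR_int df a b (f b - f a).
Proof.
  intros H1 H2.
  exact (@is_RInt_derive C_R_CompleteNormedModule f df a b (fun x _ => H1 x) (fun x _ => H2 x)).
Qed.

Lemma Cmod_int_le (f : R -> C) (g : R -> R) (a b : R) (l : C) (m : R) : (a <= b)%R ->
  (forall x, a <= x <= b -> Cmod (f x) <= g x)%R ->
  CR_int f a b l -> is_RInt g a b m -> (Cmod l <= m)%R.
Proof.
  intros Hab H Hf Hg; rewrite Cmod_norm.
  apply (@norm_RInt_le C_R_NormedModule f g a b l m Hab); auto.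
  intros x Hx; rewrite <- Cmod_norm; auto.
Qed.

(* The derivative of [Cexp] is obtained from the case of the lines [t * z]: there it is
   a computation in coordinates, and integrating it gives the remainder estimates. *)
Lemma CR_derive_exp_line (z : C) (x : R) :
  CR_derive (fun t => Cexp (RtoC t * z)) x (z * Cexp (RtoC x * z)).
Proof.
  destruct z as [u v].
  assert (Hp : forall (f1 f2 : R -> R) l1 l2, is_derive f1 x l1 -> is_derive f2 x l2 ->
     CR_derive (fun t => (f1 t, f2 t)) x (l1, l2)).
  { intros f1 f2 l1 l2 H1 H2; apply CR_derive_intro; intros eps.
    assert (He : (0 < eps / 2)%R) by (destruct eps; simpl; lra).
    destruct (proj2 H1 x (fun P HP => HP) (mkposreal _ He)) as [d1 Hd1].
    destruct (proj2 H2 x (fun P HP => HP) (mkposreal _ He)) as [d2 Hd2].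
    exists (mkposreal _ (Rmin_stable_in_posreal d1 d2)); intros h Hh; simpl in Hh.
    specialize (Hd1 (x + h)%R); specialize (Hd2 (x + h)%R).
    change (Rabs (x + h - x) < d1 ->
      Rabs (f1 (x + h) - f1 x - (x + h - x) * l1) <= eps / 2 * Rabs (x + h - x))%R in Hd1.
    change (Rabs (x + h - x) < d2 ->
      Rabs (f2 (x + h) - f2 x - (x + h - x) * l2) <= eps / 2 * Rabs (x + h - x))%R in Hd2.
    replace (x + h - x)%R with h in * by ring.
    specialize (Hd1 (Rlt_le_trans _ _ _ Hh (Rmin_l _ _))).
    specialize (Hd2 (Rlt_le_trans _ _ _ Hh (Rmin_r _ _))).
    match goal with |- (Cmod ?t <= _)%R =>
      replace t with (RtoC (f1 (x + h) - f1 x - h * l1)%R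
                      + Ci * RtoC (f2 (x + h) - f2 x - h * l2)%R) end.
    2: apply injective_projections; simpl; ring.
    eapply Rle_trans; [apply Cmod_triangle|].
    rewrite Cmod_mult, Cmod_Ci, !Cmod_R; lra. }
  assert (E : forall t, Cexp (RtoC t * (u, v)) = (exp (t * u) * cos (t * v), exp (t * u) * sin (t * v))%R).
  { intros t; unfold Cexp; simpl.
    replace (t * u - 0 * v)%R with (t * u)%R by ring.
    replace (t * v + 0 * u)%R with (t * v)%R by ring.
    apply injective_projections; simpl; ring. }
  eapply (@is_derive_ext R_AbsRing C_R_NormedModule); [intros t; symmetry; apply E|].
  rewrite E.
  replace ((u, v) * _) with
    (u * (exp (x * u) * cos (x * v)) - v * (exp (x * u) * sin (x * v)),
     u * (exp (x * u) * sin (x * v)) + v * (exp (x * u) * cos (x * v)))%R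
    by (apply injective_projections; simpl; ring).
  apply Hp; auto_derive; auto; ring.
Qed.

Lemma is_RInt_scal_1 (c : R) : is_RInt (fun _ => c) 0 1 c.
Proof.
  generalize (is_RInt_const (V := R_NormedModule) 0 1 c).
  change (scal (1 - 0)%R c) with ((1 - 0) * c)%R.
  now replace ((1 - 0) * c)%R with c by ring.
Qed.

Lemma exp_le (x y : R) : x <= y -> exp x <= exp y.
Proof.
  intros [H| ->]; [left; now apply exp_increasing|right; reflexivity].
Qed.

Lemma exp_convex_le (t u : R) : (0 <= t <= 1)%R -> (exp (t * u) <= Rmax 1 (exp u))%R.
Proof.
  intros Ht; destruct (Rle_dec 0 u) as [Hu|Hu].
  - eapply Rle_trans; [|apply Rmax_r]; apply exp_le; nra.
  - eapply Rle_trans; [|apply Rmax_l]; rewrite <- exp_0; apply exp_le; nra.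
Qed.

Lemma CR_derive_Cscal (c : C) (f : R -> C) (x : R) (l : C) :
  CR_derive f x l -> CR_derive (fun t => c * f t) x (c * l).
Proof.
  intros H; apply CR_derive_intro; intros eps.
  assert (Hc := Cmod_ge_0 c).
  assert (He : (0 < eps / (Cmod c + 1))%R) by (apply Rdiv_lt_0_compat; [apply eps|lra]).
  destruct (proj2 H x (fun P HP => HP) (mkposreal _ He)) as [d Hd]; exists d; intros h Hh.
  specialize (Hd (x + h)%R).
  change (Rabs (x + h - x) < d -> @norm R_AbsRing C_R_NormedModule
    (minus (minus (f (x + h)) (f x)) (scal (x + h - x)%R l))
    <= eps / (Cmod c + 1) * Rabs (x + h - x))%R in Hd.
  replace (x + h - x)%R with h in Hd by ring.
  specialize (Hd Hh); rewrite <- Cmod_norm, scal_R_Cmult in Hd.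
  replace (c * f (x + h)%R - c * f x - RtoC h * (c * l))
    with (c * (f (x + h)%R - f x - RtoC h * l)) by ring.
  rewrite Cmod_mult.
  eapply Rle_trans; [apply Rmult_le_compat_l; [apply Cmod_ge_0|exact Hd]|].
  apply Rle_trans with ((Cmod c + 1) * (eps / (Cmod c + 1) * Rabs h))%R.
  - apply Rmult_le_compat_r; [|lra].
    apply Rmult_le_pos; [lra|apply Rabs_pos].
  - right; field; lra.
Qed.

(** [Cexp z - 1] is the integral of [z e^(t z)] over the unit interval. Keeping [Re z] in the bound,
    instead of [Cmod z], lets [Cmod_exp_sub_exp] lose no constant. *)
Lemma Cmod_exp_sub_1 (z : C) : (Cmod (Cexp z - 1) <= Cmod z * Rmax 1 (exp (Re z)))%R.
Proof.
  assert (H := CR_int_derive (fun t => Cexp (RtoC t * z)) (fun t => z * Cexp (RtoC t * z)) 0 1).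
  cbv beta in H; replace (RtoC 1 * z) with z in H by ring; replace (RtoC 0 * z) with (RtoC 0) in H by ring.
  rewrite Cexp_0 in H.
  eapply (Cmod_int_le _ (fun _ => Cmod z * Rmax 1 (exp (Re z)))%R 0 1); [lra| | |apply is_RInt_scal_1].
  2: apply H.
  - intros x Hx; cbv beta; rewrite Cmod_mult, Cmod_Cexp, re_scal_l.
    apply Rmult_le_compat_l; [apply Cmod_ge_0|apply exp_convex_le; lra].
  - intros x; apply CR_derive_exp_line.
  - intros x; apply (CR_derive_cont _ _ (z * (z * Cexp (RtoC x * z)))).
    apply CR_derive_Cscal, CR_derive_exp_line.
Qed.

Lemma Cmod_exp_sub_1_small (z : C) : Cmod (Cexp z - 1) <= Cmod z * exp (Cmod z).
Proof.
  eapply Rle_trans; [apply Cmod_exp_sub_1|].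
  apply Rmult_le_compat_l; [apply Cmod_ge_0|].
  assert (H := re_le_Cmod z); assert (H' := Rle_abs (Re z)); assert (H0 := Cmod_ge_0 z).
  apply Rmax_lub; [rewrite <- exp_0|]; apply exp_le; lra.
Qed.

(** In the closed left half-plane the derivative of the exponential has modulus at most 1. This
    gives linear bounds for differences of decaying exponentials. *)
Lemma Cmod_exp_sub_exp (a b : C) : Re a <= 0 -> Re b <= 0 ->
  Cmod (Cexp a - Cexp b) <= Cmod (a - b).
Proof.
  intros Ha Hb.
  replace (Cexp a) with (Cexp b * Cexp (a - b))
    by (rewrite <- Cexp_plus; f_equal; ring).
  replace (Cexp b * Cexp (a - b) - Cexp b) with (Cexp b * (Cexp (a - b) - 1)) by ring.
  rewrite Cmod_mult, Cmod_Cexp.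
  eapply Rle_trans; [apply Rmult_le_compat_l; [left; apply exp_pos|apply Cmod_exp_sub_1]|].
  replace (exp (Re b) * (Cmod (a - b) * Rmax 1 (exp (Re (a - b)))))%R
    with (Cmod (a - b) * (exp (Re b) * Rmax 1 (exp (Re (a - b)))))%R by ring.
  rewrite <- (Rmult_1_r (Cmod (a - b))) at 2.
  apply Rmult_le_compat_l; [apply Cmod_ge_0|].
  unfold Rmax; destruct Rle_dec.
  - rewrite <- exp_plus, <- exp_0; apply exp_le.
    unfold Re in *; simpl; lra.
  - rewrite Rmult_1_r, <- exp_0; now apply exp_le.
Qed.

(** Integral of [z (e^(t z) - 1)] over the unit interval, with the first-order bound inside. The
    second-order remainders below, including the one for the derivative of Gamma, come from here. *)
Lemma Cmod_exp_sub_1_sub (z : C) :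
  Cmod (Cexp z - 1 - z) <= Cmod z * Cmod z * exp (Cmod z).
Proof.
  assert (Hm := Cmod_ge_0 z).
  assert (Hd : forall x, CR_derive (fun t => Cexp (RtoC t * z) - RtoC t * z) x
                          (z * (Cexp (RtoC x * z) - 1))).
  { intros x.
    replace (z * (Cexp (RtoC x * z) - 1)) with (z * Cexp (RtoC x * z) - z * 1) by ring.
    apply (@is_derive_minus R_AbsRing C_R_NormedModule).
    - apply CR_derive_exp_line.
    - apply CR_derive_intro; intros eps; exists eps; intros h _.
      rewrite RtoC_plus.
      replace (_ - _ - _) with (RtoC 0) by ring.
      rewrite Cmod_0; apply Rmult_le_pos; [left; apply eps|apply Rabs_pos]. }
  assert (H := CR_int_derive _ _ 0 1 Hd).
  cbv beta in H; replace (RtoC 1 * z) with z in H by ring; replace (RtoC 0 * z) with (RtoC 0) in H by ring.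
  rewrite Cexp_0 in H.
  replace (Cexp z - z - (1 - 0)) with (Cexp z - 1 - z) in H by ring.
  eapply (Cmod_int_le _ (fun _ => Cmod z * Cmod z * exp (Cmod z))%R 0 1);
    [lra| |apply H|apply is_RInt_scal_1].
  - intros x Hx; cbv beta; rewrite Cmod_mult, Rmult_assoc.
    apply Rmult_le_compat_l; [auto|].
    eapply Rle_trans; [apply Cmod_exp_sub_1_small|].
    rewrite Cmod_mult, Cmod_R, Rabs_pos_eq by lra.
    apply Rmult_le_compat; try nra; [left; apply exp_pos|apply exp_le; nra].
  - intros x.
    apply (CR_derive_cont _ _ (z * (z * Cexp (RtoC x * z) - 0))).
    apply CR_derive_Cscal, (@is_derive_minus R_AbsRing C_R_NormedModule).
    + apply CR_derive_exp_line.
    + apply (@is_derive_const R_AbsRing C_R_NormedModule).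
Qed.

Lemma CC_derive_exp (z : C) : CC_derive Cexp z (Cexp z).
Proof.
  apply CC_derive_iff; intros eps.
  assert (Hd : 0 < Rmin 1 (eps / (exp (Re z) * exp 1))).
  { apply Rmin_glb_lt; [lra|].
    apply Rdiv_lt_0_compat; [apply eps|apply Rmult_lt_0_compat; apply exp_pos]. }
  exists (mkposreal _ Hd); simpl; intros h Hh.
  assert (H1 := Rlt_le_trans _ _ _ Hh (Rmin_l _ _)).
  assert (H2 := Rlt_le_trans _ _ _ Hh (Rmin_r _ _)).
  rewrite Cexp_plus.
  replace (Cexp z * Cexp h - Cexp z - h * Cexp z) with (Cexp z * (Cexp h - 1 - h)) by ring.
  rewrite Cmod_mult, Cmod_Cexp.
  assert (Hp := exp_pos (Re z)); assert (Hq := exp_pos 1); assert (Hr := Cmod_ge_0 h).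
  eapply Rle_trans; [apply Rmult_le_compat_l; [lra|apply Cmod_exp_sub_1_sub]|].
  assert (H3 : exp (Cmod h) <= exp 1) by (apply exp_le; lra).
  assert (H4 : Cmod h * (exp (Re z) * exp 1) <= eps).
  { apply (Rmult_lt_compat_r (exp (Re z) * exp 1)) in H2; [|nra].
    unfold Rdiv in H2; rewrite Rmult_assoc, Rinv_l in H2; nra. }
  apply Rle_trans with (Cmod h * (exp (Re z) * exp 1) * Cmod h)%R; [|nra].
  apply Rle_trans with (Cmod h * Cmod h * exp (Re z) * exp (Cmod h))%R; [right; ring|].
  apply Rle_trans with (Cmod h * Cmod h * exp (Re z) * exp 1)%R; [|right; ring].
  apply Rmult_le_compat_l; [|auto].
  repeat apply Rmult_le_pos; lra.
Qed.

Lemma CC_derive_exp_comp (f : C -> C) (z l : C) :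
  CC_derive f z l -> CC_derive (fun w => Cexp (f w)) z (l * Cexp (f z)).
Proof. apply CC_derive_comp, CC_derive_exp. Qed.

Lemma CC_derive_inv_id (z : C) : z <> 0 -> CC_derive Cinv z (- / (z * z)).
Proof.
  intros Hz; apply CC_derive_iff; intros eps.
  assert (Hm := proj1 (Cmod_gt_0 z) Hz).
  set (m := Cmod z) in *.
  assert (Hd : 0 < Rmin (m / 2) (eps * (m * m * m / 2))).
  { apply Rmin_glb_lt; [lra|].
    apply Rmult_lt_0_compat; [apply eps|]; apply Rdiv_lt_0_compat; [|lra].
    repeat apply Rmult_lt_0_compat; lra. }
  exists (mkposreal _ Hd); simpl; intros h Hh.
  assert (H1 := Rlt_le_trans _ _ _ Hh (Rmin_l _ _)).
  assert (H2 := Rlt_le_trans _ _ _ Hh (Rmin_r _ _)).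
  assert (Hzh : m / 2 < Cmod (z + h)).
  { assert (H := Cmod_triangle (z + h) (- h)).
    replace (z + h + - h) with z in H by ring.
    rewrite Cmod_opp in H; fold m in H; lra. }
  assert (Hn : z + h <> 0) by (apply Cmod_gt_0; lra).
  (* The remainder is exactly [h^2 / (z^2 (z + h))], and [Cmod h < m / 2] keeps the last factor away
     from 0. *)
  replace (/ (z + h) - / z - h * - / (z * z)) with (h * h / (z * z * (z + h)))
    by (field; auto).
  rewrite Cmod_div, !Cmod_mult by (repeat apply Cmult_neq_0; auto).
  fold m; assert (Hr := Cmod_ge_0 h).
  apply Rle_div_l; [apply Rlt_gt; repeat apply Rmult_lt_0_compat; lra|].
  apply Rle_trans with (Cmod h * (eps * (m * m * m / 2)))%R; [nra|].
  assert (He := cond_pos eps).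
  assert (H3 : m * m * (m / 2) <= m * m * Cmod (z + h)) by (apply Rmult_le_compat_l; nra).
  apply Rle_trans with (eps * Cmod h * (m * m * (m / 2)))%R; [right; field|].
  apply Rmult_le_compat_l; [apply Rmult_le_pos; lra|auto].
Qed.

Lemma CC_derive_inv (f : C -> C) (z l : C) : f z <> 0 ->
  CC_derive f z l -> CC_derive (fun w => / f w) z (l * - / (f z * f z)).
Proof. intros Hz; apply CC_derive_comp, CC_derive_inv_id, Hz. Qed.

(** * Improper integrals *)

Lemma is_RInt_gen_filterlim {V : NormedModule R_AbsRing} (Fa Fb : (R -> Prop) -> Prop)
  {FFa : Filter Fa} {FFb : Filter Fb} (f : R -> V) (J : R -> R -> V) (l : V) :
  filter_prod Fa Fb (fun ab => is_RInt f (fst ab) (snd ab) (J (fst ab) (snd ab))) ->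
  filterlim (fun ab => J (fst ab) (snd ab)) (filter_prod Fa Fb) (locally l) ->
  is_RInt_gen f Fa Fb l.
Proof.
  intros H HJ P HP.
  assert (H2 : filter_prod Fa Fb (fun ab => P (J (fst ab) (snd ab)))) by exact (HJ P HP).
  generalize (filter_and _ _ H H2); unfold filtermapi.
  apply filter_imp; intros [a b] [H3 H4]; exists (J a b); auto.
Qed.

Lemma is_RInt_gen_antiderivative {V : CompleteNormedModule R_AbsRing}
  (Fa Fb : (R -> Prop) -> Prop) {FFa : Filter Fa} {FFb : Filter Fb}
  (F f : R -> V) (la lb : V) :
  (forall x, is_derive F x (f x)) -> (forall x, continuous f x) ->
  filterlim F Fa (locally la) -> filterlim F Fb (locally lb) ->
  is_RInt_gen f Fa Fb (minus lb la).
Proof.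
  intros Hd Hc Ha Hb.
  apply (is_RInt_gen_filterlim Fa Fb f (fun a b => minus (F b) (F a))).
  - apply filter_forall; intros [a b]; apply is_RInt_derive; auto.
  - apply (filterlim_comp_2 (G := locally lb) (H := locally (opp la)) (fun ab => F (snd ab))
      (fun ab => opp (F (fst ab))) plus).
    + eapply filterlim_comp; [apply filterlim_snd|exact Hb].
    + eapply filterlim_comp; [eapply filterlim_comp; [apply filterlim_fst|exact Ha]|].
      exact (@filterlim_opp R_AbsRing V la).
    + exact (@filterlim_plus R_AbsRing V lb (opp la)).
Qed.

Lemma is_RInt_gen_ext_all {V : NormedModule R_AbsRing} (Fa Fb : (R -> Prop) -> Prop)
  {FFa : Filter Fa} {FFb : Filter Fb} (f g : R -> V) (l : V) :
  (forall x, f x = g x) -> is_RInt_gen f Fa Fb l -> is_RInt_gen g Fa Fb l.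
Proof.
  intros H; apply is_RInt_gen_ext, filter_forall; auto.
Qed.

(** Describes the interval on which an integrand is controlled: a half-line, a ray or all of [R], so
    that one statement serves every pair of end filters. *)
Definition convex_pred (D : R -> Prop) : Prop :=
  forall x y z : R, D x -> D z -> x <= y <= z -> D y.

Lemma convex_pred_Rmin (D : R -> Prop) (a b x : R) : convex_pred D -> D a -> D b ->
  Rmin a b <= x <= Rmax a b -> D x.
Proof.
  intros HD Ha Hb Hx; unfold Rmin, Rmax in Hx; destruct Rle_dec.
  - now apply (HD a x b).
  - now apply (HD b x a).
Qed.

(** Substitution on each finite interval, then transport of both end filters by [g]. The predicate
    [D] confines the variable to a half-line on which the logarithm is differentiable. *)
Lemma is_RInt_gen_subst {V : CompleteNormedModule R_AbsRing} (D : R -> Prop)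
  (Fa Fb Ga Gb : (R -> Prop) -> Prop) {FFa : Filter Fa} {FFb : Filter Fb}
  {FGa : Filter Ga} {FGb : Filter Gb}
  (f h : R -> V) (g dg : R -> R) (l : V) :
  convex_pred D ->
  (forall x, continuous f x) ->
  (forall x, D x -> is_derive g x (dg x) /\ continuous dg x) ->
  (forall x, D x -> h x = scal (dg x) (f (g x))) ->
  Fa D -> Fb D -> filterlim g Fa Ga -> filterlim g Fb Gb ->
  is_RInt_gen f Ga Gb l -> is_RInt_gen h Fa Fb l.
Proof.
  intros HD Hf Hg Hh HFa HFb Ha Hb H P HP.
  assert (HDD : filter_prod Fa Fb (fun ab => D (fst ab) /\ D (snd ab))).
  { apply (Filter_prod _ _ _ D D); auto. }
  assert (HP2 : filter_prod Fa Fb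
     (fun ab => exists y, is_RInt f (g (fst ab)) (g (snd ab)) y /\ P y)).
  { specialize (H P HP); destruct H as [Q1 Q2 HQ1 HQ2 HQ].
    apply (Filter_prod _ _ _ (fun x => Q1 (g x)) (fun x => Q2 (g x))).
    - exact (Ha Q1 HQ1).
    - exact (Hb Q2 HQ2).
    - intros a b H1 H2; exact (HQ _ _ H1 H2). }
  generalize (filter_and _ _ HDD HP2); unfold filtermapi; apply filter_imp.
  intros [a b] [[Da Db] [y [Hy Py]]]; simpl in *; exists y; split; auto.
  apply is_RInt_unique in Hy; rewrite <- Hy.
  apply is_RInt_ext with (fun y => scal (dg y) (f (g y))).
  - intros x Hx; symmetry; apply Hh; apply (convex_pred_Rmin D a b); auto; lra.
  - apply is_RInt_comp; [intros; apply Hf|].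
    intros x Hx; apply Hg; apply (convex_pred_Rmin D a b); auto.
Qed.

(** Cauchy's criterion: two integrals of [f] differ by two end pieces, and each is dominated by the
    integral of [g] over the same piece. *)
Lemma is_RInt_gen_dominated {V : CompleteNormedModule R_AbsRing} (D : R -> Prop)
  (Fa Fb : (R -> Prop) -> Prop) {FFa : ProperFilter Fa} {FFb : ProperFilter Fb}
  (f : R -> V) (g : R -> R) (m : R) :
  convex_pred D ->
  (forall x, continuous f x) -> (forall x, continuous g x) ->
  (forall x, D x -> norm (f x) <= g x) -> Fa D -> Fb D ->
  is_RInt_gen g Fa Fb m -> exists l : V, is_RInt_gen f Fa Fb l.
Proof.
  intros HD Hf Hg Hle HFa HFb H.
  assert (Exf : forall a b, is_RInt f a b (RInt f a b)).
  { intros a b; apply (@RInt_correct V), ex_RInt_continuous; auto. }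
  assert (Exg : forall a b, is_RInt g a b (RInt g a b)).
  { intros a b; apply (@RInt_correct R_CompleteNormedModule), ex_RInt_continuous; auto. }
  assert (Bd : forall a b, D a -> D b -> norm (RInt f a b) <= Rabs (RInt g a b)).
  { assert (Bd : forall a b, a <= b -> D a -> D b -> norm (RInt f a b) <= Rabs (RInt g a b)).
    { intros a b Hab Da Db.
      eapply Rle_trans; [|apply Rle_abs].
      eapply (norm_RInt_le f g a b); eauto. }
    intros a b Da Db; destruct (Rle_dec a b) as [Hab|Hab]; [auto|].
    rewrite <- (opp_RInt_swap f b a), <- (opp_RInt_swap g b a);
      try (apply ex_RInt_continuous; auto).
    rewrite (norm_opp (RInt f b a) : norm (opp (RInt f b a)) = norm (RInt f b a)); change (opp (RInt g b a)) with (- RInt g b a)%R.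
    rewrite Rabs_Ropp; apply Bd; auto; lra. }
  destruct (proj1 (filterlim_locally_cauchy (F := filter_prod Fa Fb)
    (fun ab : R * R => RInt f (fst ab) (snd ab)))) as [l Hl].
  2: { exists l; apply (is_RInt_gen_filterlim Fa Fb f (RInt f)); auto.
       apply filter_forall; intros; apply Exf. }
  intros eps.
  (* A quarter, because each of the two end pieces is a difference of two integrals of [g], both
     within [eps / 4] of [m]. *)
  assert (He : 0 < eps / 4) by (destruct eps; simpl; lra).
  destruct (H (ball m (mkposreal _ He)) (locally_ball _ _)) as [Q1 Q2 HQ1 HQ2 HQ].
  exists (fun ab => (Q1 (fst ab) /\ D (fst ab)) /\ (Q2 (snd ab) /\ D (snd ab))); split.
  { apply (Filter_prod _ _ _ (fun a => Q1 a /\ D a) (fun b => Q2 b /\ D b)).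
    - now apply filter_and.
    - now apply filter_and.
    - auto. }
  assert (HQg : forall a b, Q1 a -> Q2 b -> Rabs (RInt g a b - m) < eps / 4).
  { intros a b Ha Hb; destruct (HQ a b Ha Hb) as [y [Hy Py]]; simpl in Hy.
    apply (is_RInt_unique (V := R_CompleteNormedModule)) in Hy; rewrite Hy; exact Py. }
  assert (Chg : forall a b c, RInt g a c = (RInt g a b + RInt g b c)%R).
  { intros a b c; symmetry; apply (RInt_Chasles (V := R_CompleteNormedModule));
    apply ex_RInt_continuous; auto. }
  intros [a b] [a' b'] [[Ha Da] [Hb Db]] [[Ha' Da'] [Hb' Db']]; simpl in *.
  apply (@norm_compat1 R_AbsRing V).
  assert (E : minus (RInt f a' b') (RInt f a b) = plus (RInt f a' a) (RInt f b b')).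
  { rewrite <- (RInt_Chasles f a' a b'), <- (RInt_Chasles f a b b')
      by (apply ex_RInt_continuous; auto).
    generalize (RInt f a' a) (RInt f a b) (RInt f b b'); intros u v w.
    unfold minus; rewrite (plus_comm v w), (plus_assoc u), <- (plus_assoc (plus u w) v).
    rewrite (plus_opp_r v : plus v (opp v) = zero).
    apply plus_zero_r. }
  change (norm (minus (RInt f a' b') (RInt f a b)) < eps); rewrite E.
  eapply Rle_lt_trans; [apply (@norm_triangle R_AbsRing V)|].
  assert (B1 := Bd a' a Da' Da); assert (B2 := Bd b b' Db Db').
  assert (G1 := HQg a b Ha Hb); assert (G2 := HQg a' b Ha' Hb); assert (G3 := HQg a b' Ha Hb').
  assert (C1 := Chg a' a b); assert (C2 := Chg a b b').
  apply Rabs_def2 in G1; apply Rabs_def2 in G2; apply Rabs_def2 in G3.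
  assert (Rabs (RInt g a' a) < eps / 2) by (apply Rabs_def1; lra).
  assert (Rabs (RInt g b b') < eps / 2) by (apply Rabs_def1; lra).
  lra.
Qed.

Lemma Cmod_int_gen_le (D : R -> Prop) (Fa Fb : (R -> Prop) -> Prop)
  {FFa : ProperFilter Fa} {FFb : ProperFilter Fb} (f : R -> C) (g : R -> R) (l : C) (m : R) :
  convex_pred D -> Fa D -> Fb D ->
  filter_prod Fa Fb (fun ab => fst ab <= snd ab) ->
  (forall x, D x -> Cmod (f x) <= g x) ->
  CR_int_gen f Fa Fb l -> is_RInt_gen g Fa Fb m -> Cmod l <= m.
Proof.
  intros HD Ha Hb Hab H Hf Hg; rewrite Cmod_norm.
  apply (@RInt_gen_norm C_R_CompleteNormedModule Fa Fb _ _ f g); auto.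
  apply (Filter_prod _ _ _ D D); auto.
  intros a b Da Db x Hx; simpl in Hx; change (@norm R_AbsRing C_R_NormedModule (f x) <= g x).
  rewrite <- Cmod_norm; apply H, (HD a x b); auto.
Qed.

(** A complex constant is not a scalar of the real module, so the product is integrated coordinate
    by coordinate. *)
Lemma CR_int_Cscal (c : C) (f : R -> C) (a b : R) (l : C) :
  CR_int f a b l -> CR_int (fun x => c * f x) a b (c * l).
Proof.
  intros H.
  assert (H1 := is_RInt_fct_extend_fst (U := R_NormedModule) (V := R_NormedModule) f a b l H).
  assert (H2 := is_RInt_fct_extend_snd (U := R_NormedModule) (V := R_NormedModule) f a b l H).
  apply (is_RInt_fct_extend_pair (U := R_NormedModule) (V := R_NormedModule)); simpl.
  - apply (is_RInt_minus (V := R_NormedModule)).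
    + exact (is_RInt_scal (V := R_NormedModule) _ a b (fst c) _ H1).
    + exact (is_RInt_scal (V := R_NormedModule) _ a b (snd c) _ H2).
  - apply (is_RInt_plus (V := R_NormedModule)).
    + exact (is_RInt_scal (V := R_NormedModule) _ a b (fst c) _ H2).
    + exact (is_RInt_scal (V := R_NormedModule) _ a b (snd c) _ H1).
Qed.

Lemma filterlim_Cmult_l (c l : C) :
  filterlim (fun z : C => c * z) (@locally C_R_NormedModule l) (@locally C_R_NormedModule (c * l)).
Proof.
  apply (filterlim_locally_ball_norm (K := R_AbsRing) (U := C_R_NormedModule)).
  intros eps.
  assert (Hc := Cmod_ge_0 c).
  assert (He : (0 < eps / (Cmod c + 1))%R) by (apply Rdiv_lt_0_compat; [apply eps|lra]).
  assert (Hl := locally_ball_norm (V := C_R_NormedModule) l (mkposreal _ He)).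
  revert Hl; apply filter_imp; intros z Hz.
  unfold ball_norm in *; rewrite <- Cmod_norm in *.
  change (Cmod (z - l) < eps / (Cmod c + 1)) in Hz; change (Cmod (c * z - c * l) < eps).
  replace (c * z - c * l) with (c * (z - l)) by ring; rewrite Cmod_mult.
  apply (Rmult_lt_compat_r (Cmod c + 1)) in Hz; [|lra].
  unfold Rdiv in Hz; rewrite Rmult_assoc, Rinv_l in Hz by lra.
  generalize (Cmod_ge_0 (z - l)); nra.
Qed.

Lemma CR_int_gen_Cscal (Fa Fb : (R -> Prop) -> Prop) {FFa : Filter Fa} {FFb : Filter Fb}
  (c : C) (f : R -> C) (l : C) :
  CR_int_gen f Fa Fb l -> CR_int_gen (fun x => c * f x) Fa Fb (c * l).
Proof.
  intros H P HP.
  generalize (H _ (filterlim_Cmult_l c l P HP)); unfold filtermapi.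
  apply filter_imp; intros [a b] [y [H1 H2]]; exists (c * y); split; auto.
  now apply CR_int_Cscal.
Qed.

Lemma CR_int_gen_plus (Fa Fb : (R -> Prop) -> Prop) {FFa : Filter Fa} {FFb : Filter Fb}
  (f g : R -> C) (l m : C) :
  CR_int_gen f Fa Fb l -> CR_int_gen g Fa Fb m ->
  CR_int_gen (fun x => f x + g x) Fa Fb (l + m).
Proof. exact (@is_RInt_gen_plus C_R_NormedModule Fa Fb _ _ f g l m). Qed.

Lemma CR_int_gen_minus (Fa Fb : (R -> Prop) -> Prop) {FFa : Filter Fa} {FFb : Filter Fb}
  (f g : R -> C) (l m : C) :
  CR_int_gen f Fa Fb l -> CR_int_gen g Fa Fb m ->
  CR_int_gen (fun x => f x - g x) Fa Fb (l - m).
Proof. exact (@is_RInt_gen_minus C_R_NormedModule Fa Fb _ _ f g l m). Qed.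

Lemma CR_int_gen_ext (Fa Fb : (R -> Prop) -> Prop) {FFa : Filter Fa} {FFb : Filter Fb}
  (f g : R -> C) (l : C) :
  (forall x, f x = g x) -> CR_int_gen f Fa Fb l -> CR_int_gen g Fa Fb l.
Proof. exact (@is_RInt_gen_ext_all C_R_NormedModule Fa Fb _ _ f g l). Qed.

Lemma CR_int_gen_unique (Fa Fb : (R -> Prop) -> Prop)
  {FFa : ProperFilter Fa} {FFb : ProperFilter Fb} (f : R -> C) (l m : C) :
  CR_int_gen f Fa Fb l -> CR_int_gen f Fa Fb m -> l = m.
Proof.
  intros H1 H2.
  rewrite <- (@is_RInt_gen_unique C_R_CompleteNormedModule Fa Fb _ _ f l H1).
  exact (@is_RInt_gen_unique C_R_CompleteNormedModule Fa Fb _ _ f m H2).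
Qed.

Lemma CR_int_gen_antiderivative (Fa Fb : (R -> Prop) -> Prop)
  {FFa : Filter Fa} {FFb : Filter Fb} (F f : R -> C) (la lb : C) :
  (forall x, CR_derive F x (f x)) -> (forall x, CR_cont f x) ->
  filterlim F Fa (@locally C_R_NormedModule la) ->
  filterlim F Fb (@locally C_R_NormedModule lb) ->
  CR_int_gen f Fa Fb (lb - la).
Proof. exact (@is_RInt_gen_antiderivative C_R_CompleteNormedModule Fa Fb _ _ F f la lb). Qed.

(** * Integrals over the real line dominated by real Gamma integrals *)

Notation CR_int_R f l := (CR_int_gen f (Rbar_locally m_infty) (Rbar_locally p_infty) l).

Ltac cont_derive := 
  match goal with |- continuous ?f ?x =>
    apply (@ex_derive_continuous R_AbsRing R_NormedModule f x); auto_derive; auto end.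

(** [c x - e^x] is largest at [x = ln c]; this is [e^y >= 1 + y] at [y = x - ln c]. *)
Lemma exp_mul_sub_exp_le (c x : R) : 0 < c -> exp (c * x - exp x) <= exp (c * ln c - c).
Proof.
  intros Hc; apply exp_le.
  assert (H := exp_ineq1_le (x - ln c)).
  assert (E : exp x = (c * exp (x - ln c))%R).
  { rewrite <- (exp_ln c) at 1 by auto; rewrite <- exp_plus; f_equal; ring. }
  rewrite E; nra.
Qed.

Lemma filterlim_exp_mul_m_infty (a : R) : 0 < a ->
  filterlim (fun x => exp (a * x)) (Rbar_locally m_infty) (locally 0).
Proof.
  intros Ha.
  apply (is_lim_comp (fun y => exp y) (fun x => a * x)%R m_infty 0 m_infty).
  - apply is_lim_exp_m.
  - apply (is_lim_ext (fun x => a * x)%R); [auto|].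
    replace m_infty with (Rbar_mult a m_infty) at 2.
    + apply is_lim_scal_l, is_lim_id.
    + simpl; destruct Rle_dec; [|lra]; destruct Rle_lt_or_eq_dec; auto; lra.
  - now exists 0%R.
Qed.

Lemma filterlim_exp_neg_p_infty : filterlim (fun x => exp (- x)) (Rbar_locally p_infty) (locally 0).
Proof.
  apply (is_lim_comp (fun y => exp y) (fun x => - x)%R p_infty 0 m_infty).
  - apply is_lim_exp_m.
  - exact (is_lim_opp (fun x => x) p_infty p_infty (is_lim_id _)).
  - now exists 0%R.
Qed.

Lemma convex_pred_all : convex_pred (fun _ => True).
Proof. now intros x y z. Qed.

Lemma filter_prod_m_p_infty :
  filter_prod (Rbar_locally m_infty) (Rbar_locally p_infty) (fun ab : R * R => fst ab <= snd ab).
Proof.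
  apply (Filter_prod _ _ _ (fun x => x < 0) (fun x => 0 < x)).
  - now exists 0%R.
  - now exists 0%R.
  - simpl; intros; lra.
Qed.

(** Domination by a multiple of the logistic density, whose antiderivative [- 1 / (a (1 + e^(a x)))]
    is explicit and has limits at both ends. *)
Lemma ex_real_gamma_int (a : R) : 0 < a -> exists m : R,
  is_RInt_gen (fun x => exp (a * x - exp x)) (Rbar_locally m_infty) (Rbar_locally p_infty) m.
Proof.
  intros Ha.
  (* With [p = e^(a x)] and [q = e^(- e^x)], [M] bounds [q (1 + p)^2 = q + 2 p q + p^2 q] term by
     term, from the maxima of [a x - e^x] and [2 a x - e^x]. *)
  set (M := (1 + 2 * exp (a * ln a - a) + exp ((2 * a) * ln (2 * a) - 2 * a))%R).
  assert (Hp : forall x, 0 < 1 + exp (a * x)) by (intros x; generalize (exp_pos (a * x)); lra).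
  assert (Hg : is_RInt_gen (fun x => M * (exp (a * x) / (1 + exp (a * x)) ^ 2))%R
            (Rbar_locally m_infty) (Rbar_locally p_infty) (minus 0 (- (M / a)))%R).
  { apply (@is_RInt_gen_antiderivative R_CompleteNormedModule (Rbar_locally m_infty)
      (Rbar_locally p_infty) _ _ (fun x => - (M / a) * / (1 + exp (a * x)))%R).
    - intros x; auto_derive; [generalize (Hp x); lra|].
      field; generalize (Hp x); split; lra.
    - intros x; cont_derive; generalize (Hp x); intros;
      apply Rgt_not_eq; nra.
    - assert (H : is_lim (fun x => - (M / a) * / (1 + exp (a * x)))%R m_infty (- (M / a) * / (1 + 0))%R).
      { apply (is_lim_scal_l (fun x => / (1 + exp (a * x)))%R (- (M / a)) m_infty (/ (1 + 0))%R).
        apply (is_lim_inv (fun x => 1 + exp (a * x))%R m_infty (1 + 0)%R).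
        - apply (is_lim_plus' (fun _ => 1%R) (fun x => exp (a * x))); [apply is_lim_const|].
          now apply filterlim_exp_mul_m_infty.
        - intros E; injection E; lra. }
      replace (- (M / a) * / (1 + 0))%R with (- (M / a))%R in H by (field; lra).
      exact H.
    - assert (H : is_lim (fun x => - (M / a) * / (1 + exp (a * x)))%R p_infty (- (M / a) * 0)%R).
      { apply (is_lim_scal_l (fun x => / (1 + exp (a * x)))%R (- (M / a)) p_infty 0%R).
        apply (is_lim_le_le_loc (fun _ => 0%R) (fun x => / a * / x)%R).
        - exists 0%R; intros x Hx; split.
          + left; apply Rinv_0_lt_compat, Hp.
          + rewrite <- Rinv_mult; apply Rinv_le_contravar; [nra|].
            generalize (exp_ineq1_le (a * x)); lra.
        - apply is_lim_const.
        - replace 0%R with (/ a * 0)%R at 1 by ring.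
          apply (is_lim_scal_l Rinv (/ a) p_infty 0%R).
          apply (is_lim_inv (fun x => x) p_infty p_infty); [apply is_lim_id|discriminate]. }
      rewrite Rmult_0_r in H; exact H. }
  destruct (@is_RInt_gen_dominated R_CompleteNormedModule (fun _ => True) (Rbar_locally m_infty)
      (Rbar_locally p_infty) _ _ (fun x => exp (a * x - exp x))
      (fun x => M * (exp (a * x) / (1 + exp (a * x)) ^ 2))%R (minus 0 (- (M / a)))%R) as [l Hl].
  - apply convex_pred_all.
  - intros x; cont_derive.
  - intros x; cont_derive; generalize (Hp x); intros;
    apply Rgt_not_eq; nra.
  - intros x _; change (Rabs (exp (a * x - exp x)) <= M * (exp (a * x) / (1 + exp (a * x)) ^ 2)).
    rewrite Rabs_pos_eq by (left; apply exp_pos).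
    assert (H1 := Hp x).
    replace (M * (exp (a * x) / (1 + exp (a * x)) ^ 2))%R
      with (M * exp (a * x) / (1 + exp (a * x)) ^ 2)%R by (field; lra).
    apply Rle_div_r; [apply Rlt_gt; nra|].
    unfold Rminus; rewrite exp_plus.
    assert (E1 : exp (- exp x) <= 1).
    { rewrite <- exp_0; apply exp_le; generalize (exp_pos x); lra. }
    assert (E2 := exp_mul_sub_exp_le a x Ha).
    assert (E3 := exp_mul_sub_exp_le (2 * a) x ltac:(lra)).
    unfold Rminus in E2, E3; rewrite exp_plus in E2, E3.
    replace (2 * a * x)%R with (a * x + a * x)%R in E3 by ring; rewrite exp_plus in E3.
    unfold M; unfold Rminus; set (u := exp (a * x)) in *; set (v := exp (- exp x)) in *.
    assert (0 < u) by apply exp_pos.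
    rewrite Rmult_assoc, (Rmult_comm _ u); apply Rmult_le_compat_l; [lra|].
    nra.
  - now exists 0%R.
  - now exists 0%R.
  - exact Hg.
  - now exists l.
Qed.

(** Two exponents, because a factor [|x|] is absorbed by raising and lowering the exponent a little;
    both stay positive for the sake of convergence at minus infinity. *)
Definition gdom (f : R -> C) : Prop := exists M a b : R, 0 < a /\ 0 < b /\
  forall x, Cmod (f x) <= M * (exp (a * x - exp x) + exp (b * x - exp x)).

Lemma ex_gdom_int (f : R -> C) : gdom f -> (forall x, CR_cont f x) -> exists l, CR_int_R f l.
Proof.
  intros [M [a [b [Ha [Hb H]]]]] Hf.
  destruct (ex_real_gamma_int a Ha) as [m1 H1]; destruct (ex_real_gamma_int b Hb) as [m2 H2].
  apply (@is_RInt_gen_dominated C_R_CompleteNormedModule (fun _ => True) _ _ _ _ f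
     (fun x => M * (exp (a * x - exp x) + exp (b * x - exp x)))%R (M * (m1 + m2))%R).
  - apply convex_pred_all.
  - exact Hf.
  - intros x; cont_derive.
  - intros x _.
    change (@norm R_AbsRing C_R_NormedModule (f x) <= M * (exp (a * x - exp x) + exp (b * x - exp x))).
    rewrite <- Cmod_norm; apply H.
  - now exists 0%R.
  - now exists 0%R.
  - apply (is_RInt_gen_scal (V := R_NormedModule) (fun x => exp (a * x - exp x) + exp (b * x - exp x))%R M).
    now apply (is_RInt_gen_plus (V := R_NormedModule)).
Qed.

Lemma filterlim_Cmod_sub (F : (R -> Prop) -> Prop) {FF : Filter F} (f : R -> C) (l : C) (g : R -> R) :
  F (fun x => Cmod (f x - l) <= g x) -> filterlim g F (locally 0) ->
  filterlim f F (@locally C_R_NormedModule l).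
Proof.
  intros H Hg.
  apply (filterlim_locally_ball_norm (K := R_AbsRing) (U := C_R_NormedModule)); intros eps.
  generalize (filter_and _ _ H (proj1 (filterlim_locally g 0) Hg eps)).
  apply filter_imp; intros x [H1 H2].
  change (Rabs (g x - 0) < eps) in H2; unfold ball_norm; rewrite <- Cmod_norm.
  change (Cmod (f x - l) < eps).
  rewrite Rminus_0_r in H2; generalize (Rle_abs (g x)); lra.
Qed.

Lemma gdom_lim (f : R -> C) : gdom f ->
  filterlim f (Rbar_locally m_infty) (@locally C_R_NormedModule (RtoC 0)) /\
  filterlim f (Rbar_locally p_infty) (@locally C_R_NormedModule (RtoC 0)).
Proof.
  intros [M [a [b [Ha [Hb H]]]]].
  assert (HM : 0 <= M).
  { specialize (H 0%R); generalize (Cmod_ge_0 (f 0%R)) (exp_pos (a * 0 - exp 0)) (exp_pos (b * 0 - exp 0)); nra. }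
  split.
  - apply (filterlim_Cmod_sub _ f 0 (fun x => M * (exp (a * x) + exp (b * x)))%R).
    + apply filter_forall; intros x; unfold Cminus; rewrite Copp_0, Cplus_0_r.
      eapply Rle_trans; [apply H|].
      apply Rmult_le_compat_l; [auto|]; apply Rplus_le_compat; apply exp_le;
      generalize (exp_pos x); lra.
    + replace 0%R with (M * (0 + 0))%R by ring.
      apply (is_lim_scal_l (fun x => exp (a * x) + exp (b * x))%R M m_infty (0 + 0)%R).
      apply (is_lim_plus' (fun x => exp (a * x)) (fun x => exp (b * x)) m_infty 0 0);
      now apply filterlim_exp_mul_m_infty.
  (* At plus infinity the exponents [a] and [b] are raised by one, which pays for the factor
     [e^(- x)]. *)
  - set (M1 := exp ((a + 1) * ln (a + 1) - (a + 1))); set (M2 := exp ((b + 1) * ln (b + 1) - (b + 1))).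
    apply (filterlim_Cmod_sub _ f 0 (fun x => (M * (M1 + M2)) * exp (- x))%R).
    + apply filter_forall; intros x; unfold Cminus; rewrite Copp_0, Cplus_0_r.
      eapply Rle_trans; [apply H|].
      rewrite Rmult_assoc; apply Rmult_le_compat_l; [auto|].
      assert (E1 := exp_mul_sub_exp_le (a + 1) x ltac:(lra)).
      assert (E2 := exp_mul_sub_exp_le (b + 1) x ltac:(lra)).
      fold M1 in E1; fold M2 in E2.
      replace (a * x - exp x)%R with ((a + 1) * x - exp x + - x)%R by ring.
      replace (b * x - exp x)%R with ((b + 1) * x - exp x + - x)%R by ring.
      rewrite !(exp_plus _ (- x)); generalize (exp_pos (- x)); nra.
    + replace 0%R with ((M * (M1 + M2)) * 0)%R by ring.
      apply (is_lim_scal_l (fun x => exp (- x)) (M * (M1 + M2)) p_infty 0%R).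
      apply filterlim_exp_neg_p_infty.
Qed.

(** * The Gamma integral *)

Definition gamma_kernel (s w : C) : C := Cexp (s * w - Cexp w).

Lemma gamma_kernel_succ (s w : C) : gamma_kernel (s + 1) w = Cexp w * gamma_kernel s w.
Proof. unfold gamma_kernel; rewrite <- Cexp_plus; f_equal; ring. Qed.

Lemma CC_derive_gamma_kernel (s w : C) :
  CC_derive (gamma_kernel s) w ((s - Cexp w) * gamma_kernel s w).
Proof.
  apply (CC_derive_exp_comp (fun w => s * w - Cexp w)), CC_derive_minus; [|apply CC_derive_exp].
  eapply CC_derive_val; [apply CC_derive_mult; [apply CC_derive_const|apply CC_derive_id]|idtac]; simpl; ring.
Qed.

Lemma CC_derive_real_line (f : C -> C) (x : R) (l : C) :
  CC_derive f (RtoC x) l -> CR_derive (fun t => f (RtoC t)) x l.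
Proof.
  intros H.
  replace (RtoC x) with (0 + RtoC x * 1) in H by ring.
  apply CC_derive_line in H; rewrite Cmult_1_l in H.
  revert H; apply (@is_derive_ext R_AbsRing C_R_NormedModule).
  intros t; f_equal; ring.
Qed.

Lemma CR_cont_real_line (f f' : C -> C) (x : R) :
  (forall w, CC_derive f w (f' w)) -> CR_cont (fun t => f (RtoC t)) x.
Proof. intros H; eapply CR_derive_cont, CC_derive_real_line, H. Qed.

Lemma Cmod_gamma_kernel (s : C) (x : R) : Cmod (gamma_kernel s (RtoC x)) = exp (Re s * x - exp x).
Proof.
  unfold gamma_kernel; rewrite Cmod_Cexp, Cexp_RtoC; f_equal.
  unfold Re; simpl; ring.
Qed.

Lemma gdom_gamma_kernel (s : C) : 0 < Re s -> gdom (fun x => gamma_kernel s (RtoC x)).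
Proof.
  intros Hs; exists 1%R, (Re s), (Re s); repeat split; auto; intros x.
  rewrite Cmod_gamma_kernel; generalize (exp_pos (Re s * x - exp x)); lra.
Qed.

Lemma Rabs_le_exp (eta x : R) : 0 < eta -> Rabs x <= / eta * (exp (eta * x) + exp (- eta * x)).
Proof.
  intros He.
  apply Rmult_le_reg_l with eta; auto.
  rewrite <- Rmult_assoc, Rinv_r, Rmult_1_l by lra.
  assert (H1 := exp_ineq1_le (eta * x)); assert (H2 := exp_ineq1_le (- eta * x)).
  assert (H3 := exp_pos (eta * x)); assert (H4 := exp_pos (- eta * x)).
  unfold Rabs; destruct Rcase_abs; nra.
Qed.

Lemma gdom_id_gamma_kernel (s : C) : 0 < Re s ->
  gdom (fun x => RtoC x * gamma_kernel s (RtoC x)).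
Proof.
  (* [|x|] is bounded by exponentials of rate [Re s / 2], so the exponents become [3 Re s / 2] and
     [Re s / 2], both positive. *)
  intros Hs; exists (2 / Re s)%R, (Re s / 2 + Re s)%R, (- (Re s / 2) + Re s)%R.
  repeat split; try lra; intros x.
  rewrite Cmod_mult, Cmod_R, Cmod_gamma_kernel.
  assert (H := Rabs_le_exp (Re s / 2) x ltac:(lra)).
  apply Rmult_le_compat_r with (r := exp (Re s * x - exp x)) in H; [|left; apply exp_pos].
  eapply Rle_trans; [exact H|right].
  replace ((Re s / 2 + Re s) * x - exp x)%R with (Re s / 2 * x + (Re s * x - exp x))%R by ring.
  replace ((- (Re s / 2) + Re s) * x - exp x)%R with (- (Re s / 2) * x + (Re s * x - exp x))%R by ring.
  rewrite !(exp_plus _ (Re s * x - exp x)); field; lra.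
Qed.

Lemma CR_cont_gamma_kernel (s : C) (x : R) : CR_cont (fun x => gamma_kernel s (RtoC x)) x.
Proof. apply (CR_cont_real_line _ _ _ (CC_derive_gamma_kernel s)). Qed.

Lemma CC_derive_id_gamma_kernel (s w : C) :
  CC_derive (fun w => w * gamma_kernel s w) w
    (gamma_kernel s w + w * ((s - Cexp w) * gamma_kernel s w)).
Proof.
  eapply CC_derive_val;
    [apply CC_derive_mult; [apply CC_derive_id|apply CC_derive_gamma_kernel]|simpl; ring].
Qed.

Lemma CR_cont_id_gamma_kernel (s : C) (x : R) :
  CR_cont (fun x => RtoC x * gamma_kernel s (RtoC x)) x.
Proof. apply (CR_cont_real_line _ _ _ (CC_derive_id_gamma_kernel s)). Qed.

Lemma CGamma_int (s : C) : 0 < Re s ->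
  CR_int_R (fun x => gamma_kernel s (RtoC x)) (CGamma s).
Proof.
  intros Hs.
  destruct (ex_gdom_int _ (gdom_gamma_kernel s Hs) (CR_cont_gamma_kernel s)) as [l Hl].
  replace (CGamma s) with l; auto.
  symmetry; unfold CGamma; apply (@is_RInt_gen_unique C_R_CompleteNormedModule (at_right 0) (Rbar_locally p_infty) _ _).
  apply (@is_RInt_gen_subst C_R_CompleteNormedModule (fun x => 0 < x) (at_right 0) (Rbar_locally p_infty)
     (Rbar_locally m_infty) (Rbar_locally p_infty) _ _ _ _ (fun x => gamma_kernel s (RtoC x)) _ ln Rinv).
  - intros x y z; lra.
  - intros x; apply CR_cont_gamma_kernel.
  - intros x Hx; split; [now apply is_derive_Reals, derivable_pt_lim_ln|].
    apply continuous_Rinv; lra.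
  - intros t Ht; rewrite scal_R_Cmult; unfold gamma_kernel.
    rewrite Cexp_RtoC, exp_ln by auto.
    replace (s * RtoC (ln t) - RtoC t)
      with ((s - 1) * RtoC (ln t) + RtoC (ln t) + RtoC (- t)) by (rewrite RtoC_opp; ring).
    rewrite !Cexp_plus, !Cexp_RtoC, exp_ln by auto.
    rewrite RtoC_inv by lra.
    match goal with |- ?a = ?b => change (@eq C a b) end.
    transitivity (Cexp ((s - 1) * RtoC (ln t)) * RtoC (exp (- t)) * (RtoC t * / RtoC t));
      [rewrite Cinv_r; [ring|]|ring].
    intros E; injection E; lra.
  - exists (mkposreal 1 Rlt_0_1); auto.
  - now exists 0%R.
  - apply is_lim_ln_0.
  - apply is_lim_ln_p.
  - exact Hl.
Qed.

(** Gamma differentiated under the integral sign, for now only as a formula; [C_derive_CGamma]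
    identifies it with the derivative. *)
Definition dGamma (s : C) : C := @RInt_gen C_R_CompleteNormedModule
  (fun x => RtoC x * gamma_kernel s (RtoC x)) (Rbar_locally m_infty) (Rbar_locally p_infty).

Lemma dGamma_int (s : C) : 0 < Re s ->
  CR_int_R (fun x => RtoC x * gamma_kernel s (RtoC x)) (dGamma s).
Proof.
  intros Hs; apply (@RInt_gen_correct C_R_CompleteNormedModule); try apply _.
  exact (ex_gdom_int _ (gdom_id_gamma_kernel s Hs) (CR_cont_id_gamma_kernel s)).
Qed.

Lemma Re_succ (s : C) : Re (s + 1) = (Re s + 1)%R.
Proof. reflexivity. Qed.

(** Integration by parts in the form used for the two recurrences: the boundary terms vanish at both
    ends. *)
Lemma CR_int_R_gdom_derive (F f : R -> C) (l : C) : gdom F ->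
  (forall x, CR_derive F x (f x)) -> (forall x, CR_cont f x) -> CR_int_R f l -> l = 0.
Proof.
  intros HF Hd Hc Hl; destruct (gdom_lim F HF) as [L1 L2].
  apply (CR_int_gen_unique _ _ _ _ _ Hl).
  replace (RtoC 0) with (RtoC 0 - RtoC 0) by ring.
  now apply (CR_int_gen_antiderivative _ _ F).
Qed.

Lemma CGamma_succ (s : C) : 0 < Re s -> CGamma (s + 1) = s * CGamma s.
Proof.
  intros Hs.
  assert (H := CR_int_gen_minus _ _ _ _ _ _ (CR_int_gen_Cscal _ _ s _ _ (CGamma_int s Hs))
     (CGamma_int (s + 1) ltac:(rewrite Re_succ; lra))).
  apply (CR_int_R_gdom_derive (fun x => gamma_kernel s (RtoC x))) in H.
  - replace (CGamma (s + 1)) with (s * CGamma s - (s * CGamma s - CGamma (s + 1))) by ring.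
    rewrite H; ring.
  - now apply gdom_gamma_kernel.
  - intros x; rewrite gamma_kernel_succ.
    replace (s * gamma_kernel s (RtoC x) - Cexp (RtoC x) * gamma_kernel s (RtoC x))
      with ((s - Cexp (RtoC x)) * gamma_kernel s (RtoC x)) by ring.
    apply CC_derive_real_line, CC_derive_gamma_kernel.
  - intros x; eapply (CR_cont_real_line (fun w => s * gamma_kernel s w - gamma_kernel (s + 1) w)).
    intros w; apply CC_derive_minus; [apply CC_derive_mult; [apply CC_derive_const|]|];
    apply CC_derive_gamma_kernel.
Qed.

Lemma dGamma_succ (s : C) : 0 < Re s -> dGamma (s + 1) = CGamma s + s * dGamma s.
Proof.
  intros Hs.
  assert (H := CR_int_gen_minus _ _ _ _ _ _
     (CR_int_gen_plus _ _ _ _ _ _ (CGamma_int s Hs) (CR_int_gen_Cscal _ _ s _ _ (dGamma_int s Hs)))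
     (dGamma_int (s + 1) ltac:(rewrite Re_succ; lra))).
  apply (CR_int_R_gdom_derive (fun x => RtoC x * gamma_kernel s (RtoC x))) in H.
  - replace (dGamma (s + 1)) with
      (CGamma s + s * dGamma s - (CGamma s + s * dGamma s - dGamma (s + 1))) by ring.
    rewrite H; ring.
  - now apply gdom_id_gamma_kernel.
  - intros x; rewrite gamma_kernel_succ.
    match goal with |- CR_derive _ _ ?u => replace u with
      (gamma_kernel s (RtoC x) + RtoC x * ((s - Cexp (RtoC x)) * gamma_kernel s (RtoC x))) by ring end.
    apply (CC_derive_real_line (fun w => w * gamma_kernel s w)), CC_derive_id_gamma_kernel.
  - intros x; eapply (CR_cont_real_line
      (fun w => gamma_kernel s w + s * (w * gamma_kernel s w) - w * gamma_kernel (s + 1) w)).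
    intros w; apply CC_derive_minus; [apply CC_derive_plus;
      [apply CC_derive_gamma_kernel|apply CC_derive_mult; [apply CC_derive_const|]]|];
    apply CC_derive_id_gamma_kernel.
Qed.

Lemma CGamma_1 : CGamma 1 = 1.
Proof.
  assert (H1 : 0 < Re 1) by (simpl; lra).
  assert (D : forall w, CC_derive (fun w => - Cexp (- Cexp w)) w (gamma_kernel 1 w)).
  { intros w.
    eapply CC_derive_val; [apply CC_derive_opp, CC_derive_exp_comp, CC_derive_opp, CC_derive_exp|simpl].
    unfold gamma_kernel; rewrite Cmult_1_l; unfold Cminus; rewrite Cexp_plus; ring. }
  transitivity (0 - - (1)); [|ring].
  apply (CR_int_gen_unique _ _ _ _ _ (CGamma_int 1 H1)).
  apply (CR_int_gen_antiderivative _ _ (fun x => - Cexp (- Cexp (RtoC x)))).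
  - intros x; apply (CC_derive_real_line (fun w => - Cexp (- Cexp w))), D.
  - intros x; apply CR_cont_gamma_kernel.
  - apply (filterlim_Cmod_sub _ _ _ (fun x => exp (1 * x))).
    + apply filter_forall; intros x; rewrite Cexp_RtoC, Rmult_1_l.
      replace (- Cexp (- RtoC (exp x)) - - (1)) with (Cexp 0 - Cexp (- RtoC (exp x)))
        by (rewrite Cexp_0; ring).
      eapply Rle_trans; [apply Cmod_exp_sub_exp|].
      * simpl; lra.
      * simpl; generalize (exp_pos x); lra.
      * replace (0 - - RtoC (exp x)) with (RtoC (exp x)) by ring.
        rewrite Cmod_R, Rabs_pos_eq; [lra|left; apply exp_pos].
    + apply filterlim_exp_mul_m_infty; lra.
  - apply (filterlim_Cmod_sub _ _ _ (fun x => exp (- x))).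
    + apply filter_forall; intros x; rewrite Cexp_RtoC, <- RtoC_opp, Cexp_RtoC.
      replace (- RtoC (exp (- exp x)) - 0) with (- RtoC (exp (- exp x))) by ring.
      rewrite Cmod_opp, Cmod_R, Rabs_pos_eq by (left; apply exp_pos).
      apply exp_le; generalize (exp_ineq1_le x); lra.
    + apply filterlim_exp_neg_p_infty.
Qed.

Notation R_int_R f m := (is_RInt_gen f (Rbar_locally m_infty) (Rbar_locally p_infty) m).

Lemma Cmod_int_R_le (f : R -> C) (g : R -> R) (l : C) (m : R) :
  (forall x, Cmod (f x) <= g x) -> CR_int_R f l -> R_int_R g m -> Cmod l <= m.
Proof.
  intros H; apply (Cmod_int_gen_le (fun _ => True) _ _).
  - apply convex_pred_all.
  - now exists 0%R.
  - now exists 0%R.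
  - apply filter_prod_m_p_infty.
  - auto.
Qed.

(** [C_lim] approaches the point along the horizontal line only, so real increments already
    determine [C_derive]. *)
Lemma C_derive_real_direction (f : C -> C) (s l : C) :
  (forall eps : posreal, exists d : posreal, forall h : R, Rabs h < d ->
     Cmod (f (s + RtoC h) - f s - RtoC h * l) <= eps * Rabs h) ->
  C_derive f s = l.
Proof.
  intros H; unfold C_derive, C_lim.
  assert (Q : forall eps : posreal, exists d : posreal, forall x : R,
    Rabs (x - fst s) < d -> x <> fst s ->
    Cmod ((f (x, snd s) - f s) / ((x, snd s) - s) - l) < eps).
  { intros eps; assert (He : 0 < eps / 2) by (destruct eps; simpl; lra).
    destruct (H (mkposreal _ He)) as [d Hd]; exists d; intros x Hx Hne.
    specialize (Hd (x - fst s)%R Hx).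
    assert (E1 : s + RtoC (x - fst s) = (x, snd s))
      by (apply injective_projections; simpl; ring).
    assert (E2 : (x, snd s) - s = RtoC (x - fst s))
      by (apply injective_projections; simpl; ring).
    rewrite E1 in Hd; rewrite E2; simpl in Hd.
    assert (Hn : RtoC (x - fst s) <> 0) by (intros E; injection E; lra).
    assert (Hp : 0 < Rabs (x - fst s)) by (apply Rabs_pos_lt; lra).
    replace ((f (x, snd s) - f s) / RtoC (x - fst s) - l)
      with ((f (x, snd s) - f s - RtoC (x - fst s) * l) / RtoC (x - fst s)) by (field; auto).
    rewrite Cmod_div, Cmod_R by auto.
    apply Rle_lt_trans with (eps / 2)%R; [|lra].
    apply Rle_div_l; [apply Rlt_gt|]; auto. }
  apply injective_projections; simpl;
  [change (fst l) with (real (fst l))|change (snd l) with (real (snd l))]; f_equal;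
  apply is_lim_unique, is_lim_spec; intros eps; destruct (Q eps) as [d Hd]; exists d;
  intros x Hx Hne; (eapply Rle_lt_trans; [|apply (Hd x Hx Hne)]);
  (eapply Rle_trans; [|apply Rmax_Cmod]);
  [apply Rmax_l|apply Rmax_r].
Qed.

(** Differentiation under the integral sign: the remainder [e^(h x) - 1 - h x] is at most
    [h^2 x^2 e^(|h x|)], and [x^2] is in turn bounded by an exponential in [|x|]. *)
Lemma C_derive_CGamma (s : C) : 0 < Re s -> C_derive CGamma s = dGamma s.
Proof.
  intros Hs; apply C_derive_real_direction; intros eps.
  (* The factor [e^(|h x|)] uses one [eta] and [x^2] uses two, so the exponents move to
     [Re s + 3 eta] and [Re s - 3 eta]; a quarter of [Re s] keeps the latter positive. *)
  set (eta := (Re s / 4)%R).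
  assert (He : 0 < eta) by (unfold eta; lra).
  destruct (ex_real_gamma_int (Re s + 3 * eta)) as [m1 H1]; [lra|].
  destruct (ex_real_gamma_int (Re s - 3 * eta)) as [m2 H2]; [unfold eta; lra|].
  (* Nonnegativity of the real integral is read off from [|Gamma a| <= m] for real [a]. *)
  assert (Hm : forall a m, 0 < a -> R_int_R (fun x => exp (a * x - exp x)) m -> 0 <= m).
  { intros a m Ha Hm; eapply Rle_trans; [apply (Cmod_ge_0 (CGamma (RtoC a)))|].
    apply (fun H => Cmod_int_R_le _ _ _ _ H (CGamma_int (RtoC a) Ha) Hm).
    intros x; right; apply Cmod_gamma_kernel. }
  assert (Hm1 : 0 <= m1) by (apply (Hm (Re s + 3 * eta)%R); [lra|auto]).
  assert (Hm2 : 0 <= m2) by (apply (Hm (Re s - 3 * eta)%R); [unfold eta; lra|auto]).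
  set (K := (/ (eta * eta) * (m1 + m2))%R).
  assert (HK : 0 <= K).
  { apply Rmult_le_pos; [left; apply Rinv_0_lt_compat; nra|lra]. }
  assert (Hd : 0 < Rmin eta (eps / (K + 1))).
  { apply Rmin_glb_lt; auto; apply Rdiv_lt_0_compat; [apply eps|lra]. }
  exists (mkposreal _ Hd); simpl; intros h Hh.
  assert (Hh1 := Rlt_le_trans _ _ _ Hh (Rmin_l _ _)).
  assert (Hh2 := Rlt_le_trans _ _ _ Hh (Rmin_r _ _)).
  assert (Hsh : 0 < Re (s + RtoC h)).
  { simpl; change (fst s) with (Re s); apply Rabs_def2 in Hh1; unfold eta in Hh1; lra. }
  assert (HI := CR_int_gen_minus _ _ _ _ _ _
     (CR_int_gen_minus _ _ _ _ _ _ (CGamma_int _ Hsh) (CGamma_int s Hs))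
     (CR_int_gen_Cscal _ _ (RtoC h) _ _ (dGamma_int s Hs))).
  apply (Cmod_int_R_le _ (fun x => (h * h * / (eta * eta)) *
      (exp ((Re s + 3 * eta) * x - exp x) + exp ((Re s - 3 * eta) * x - exp x)))%R _
      ((h * h * / (eta * eta)) * (m1 + m2))%R) in HI.
  - apply Rle_trans with (h * h * K)%R; [unfold K; lra|].
    assert (E : (h * h = Rabs h * Rabs h)%R) by (rewrite <- Rabs_mult, Rabs_pos_eq; nra).
    rewrite E.
    assert (Rabs h * K <= eps).
    { apply (Rmult_lt_compat_r (K + 1)) in Hh2; [|lra].
      unfold Rdiv in Hh2; rewrite Rmult_assoc, Rinv_l in Hh2 by lra.
      generalize (Rabs_pos h); nra. }
    generalize (Rabs_pos h); nra.
  - intros x.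
    replace (gamma_kernel (s + RtoC h) (RtoC x) - gamma_kernel s (RtoC x)
             - RtoC h * (RtoC x * gamma_kernel s (RtoC x)))
      with (gamma_kernel s (RtoC x) * (Cexp (RtoC (h * x)) - 1 - RtoC (h * x))).
    2: { replace (gamma_kernel (s + RtoC h) (RtoC x))
           with (gamma_kernel s (RtoC x) * Cexp (RtoC (h * x))).
         - rewrite RtoC_mult; ring.
         - unfold gamma_kernel; rewrite <- Cexp_plus, RtoC_mult; f_equal; ring. }
    rewrite Cmod_mult, Cmod_gamma_kernel.
    eapply Rle_trans; [apply Rmult_le_compat_l; [left; apply exp_pos|apply Cmod_exp_sub_1_sub]|].
    rewrite Cmod_R, Rabs_mult.
    assert (Hx : Rabs x <= / eta * exp (eta * Rabs x)).
    { apply Rmult_le_reg_l with eta; auto.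
      rewrite <- Rmult_assoc, Rinv_r, Rmult_1_l by lra.
      generalize (exp_ineq1_le (eta * Rabs x)); lra. }
    assert (Hx0 := Rabs_pos x); assert (Hh0 := Rabs_pos h).
    assert (Hx2 : Rabs x * Rabs x <= / (eta * eta) * exp (2 * eta * Rabs x)).
    { replace (2 * eta * Rabs x)%R with (eta * Rabs x + eta * Rabs x)%R by ring.
      rewrite exp_plus, Rinv_mult.
      replace (/ eta * / eta * (exp (eta * Rabs x) * exp (eta * Rabs x)))%R
       with ((/ eta * exp (eta * Rabs x)) * (/ eta * exp (eta * Rabs x)))%R by ring.
      apply Rmult_le_compat; auto. }
    assert (Hx3 : exp (Rabs h * Rabs x) <= exp (eta * Rabs x)).
    { apply exp_le, Rmult_le_compat_r; lra. }
    assert (Hx4 : exp (2 * eta * Rabs x) * exp (eta * Rabs x)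
              <= exp (3 * eta * x) + exp (- (3 * eta) * x)).
    { rewrite <- exp_plus.
      replace (2 * eta * Rabs x + eta * Rabs x)%R with (3 * eta * Rabs x)%R by ring.
      generalize (exp_pos (3 * eta * x)) (exp_pos (- (3 * eta) * x)).
      unfold Rabs; destruct Rcase_abs.
      - replace (3 * eta * - x)%R with (- (3 * eta) * x)%R by ring; lra.
      - lra. }
    replace (exp ((Re s + 3 * eta) * x - exp x))
      with (exp (Re s * x - exp x) * exp (3 * eta * x))%R
      by (rewrite <- exp_plus; f_equal; ring).
    replace (exp ((Re s - 3 * eta) * x - exp x))
      with (exp (Re s * x - exp x) * exp (- (3 * eta) * x))%R
      by (rewrite <- exp_plus; f_equal; ring).
    rewrite <- Rmult_plus_distr_l.
    replace (h * h * / (eta * eta) *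
      (exp (Re s * x - exp x) * (exp (3 * eta * x) + exp (- (3 * eta) * x))))%R
     with (exp (Re s * x - exp x) * (h * h * (/ (eta * eta) *
       (exp (3 * eta * x) + exp (- (3 * eta) * x)))))%R by ring.
    apply Rmult_le_compat_l; [left; apply exp_pos|].
    replace (h * h)%R with (Rabs h * Rabs h)%R
      by (rewrite <- Rabs_mult, Rabs_pos_eq; [ring|nra]).
    apply Rle_trans with (Rabs h * Rabs h * ((Rabs x * Rabs x) * exp (Rabs h * Rabs x)))%R;
      [right; ring|].
    apply Rmult_le_compat_l; [nra|].
    apply Rle_trans with ((/ (eta * eta) * exp (2 * eta * Rabs x)) * exp (eta * Rabs x))%R.
    + apply Rmult_le_compat; auto; [nra|left; apply exp_pos].
    + rewrite Rmult_assoc; apply Rmult_le_compat_l; auto.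
      left; apply Rinv_0_lt_compat; nra.
  - apply (is_RInt_gen_scal (V := R_NormedModule) (fun x =>
      exp ((Re s + 3 * eta) * x - exp x) + exp ((Re s - 3 * eta) * x - exp x))%R
      (h * h * / (eta * eta))%R).
    now apply (is_RInt_gen_plus (V := R_NormedModule)).
Qed.

Lemma digamma_eq (s : C) : 0 < Re s -> digamma s = dGamma s / CGamma s.
Proof. intros Hs; unfold digamma; now rewrite C_derive_CGamma. Qed.

(** * Asymptotics of Gamma along integer shifts *)

Lemma R_int_R_Re (f : R -> C) (l : C) : CR_int_R f l -> R_int_R (fun x => Re (f x)) (Re l).
Proof.
  intros H P [eps HP].
  generalize (H (fun z => P (fst z)) (ex_intro _ eps (fun z Hz => HP (fst z) (proj1 Hz)))).
  unfold filtermapi; apply filter_imp; intros [a b] [y [H1 H2]]; exists (fst y); split; auto.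
  exact (is_RInt_fct_extend_fst (U := R_NormedModule) (V := R_NormedModule) f a b y H1).
Qed.

Lemma CGamma_INR (p : nat) : CGamma (RtoC (INR (S p))) = RtoC (INR (fact p)).
Proof.
  induction p as [|p IH]; [exact CGamma_1|].
  rewrite S_INR, RtoC_plus, CGamma_succ, IH.
  - rewrite <- RtoC_mult; f_equal; rewrite <- mult_INR; f_equal.
  - rewrite re_RtoC, S_INR; generalize (pos_INR p); lra.
Qed.

(** The factor [e^(k (x - L))] only shifts the exponent, so the moment is [e^(- k L) Gamma (n + k)];
    [k] may be negative as long as [n + k] is a positive integer. *)
Lemma gamma_moment (n k L : R) (p : nat) : INR (S p) = (n + k)%R ->
  R_int_R (fun x => exp (k * (x - L)) * exp (n * x - exp x))%R (exp (- (k * L)) * INR (fact p))%R.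
Proof.
  intros Hp.
  assert (H : 0 < Re (RtoC (INR (S p)))).
  { rewrite re_RtoC, S_INR; generalize (pos_INR p); lra. }
  apply CGamma_int in H; rewrite CGamma_INR in H; apply R_int_R_Re in H.
  apply (is_RInt_gen_scal (V := R_NormedModule) _ (exp (- (k * L)))) in H.
  revert H; refine (is_RInt_gen_ext_all (V := R_NormedModule) _ _ _ _ _ _); intros x.
  change (exp (- (k * L)) * Re (gamma_kernel (RtoC (INR (S p))) (RtoC x)) =
          exp (k * (x - L)) * exp (n * x - exp x))%R.
  unfold gamma_kernel; rewrite Cexp_RtoC, <- RtoC_mult, <- RtoC_minus, Cexp_RtoC, re_RtoC.
  rewrite <- !exp_plus, Hp; f_equal; ring.
Qed.

Lemma exp_INR_mul_ln (K n : nat) : (1 <= n)%nat -> exp (INR K * ln (INR n)) = (INR n ^ K)%R.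
Proof. intros Hn; apply (Rpower_pow K (INR n)), lt_0_INR; lia. Qed.

Lemma is_lim_seq_const_div_INR (c : R) : is_lim_seq (fun n => c / INR n)%R 0.
Proof.
  replace 0%R with (c * 0)%R by ring.
  apply (is_lim_seq_scal_l (fun n => / INR n)%R c 0%R).
  apply (is_lim_seq_inv INR p_infty); [apply is_lim_seq_INR|discriminate].
Qed.

(** For [n >= 1] the quotient is the product of [1 + j / n] over [0 <= j < K]. *)
Lemma lim_rising_factorial (K : nat) :
  is_lim_seq (fun n => INR (fact (n - 1 + K)) / (INR (fact (n - 1)) * INR n ^ K))%R 1.
Proof.
  induction K as [|K IH].
  - apply is_lim_seq_ext with (fun _ => 1%R); [|apply is_lim_seq_const].
    intros n; rewrite Nat.add_0_r; simpl; field; apply INR_fact_neq_0.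
  - apply is_lim_seq_ext_loc with
      (fun n => INR (fact (n - 1 + K)) / (INR (fact (n - 1)) * INR n ^ K) * (1 + INR K / INR n))%R.
    + exists 1%nat; intros n Hn.
      replace (n - 1 + S K)%nat with (S (n - 1 + K)) by lia.
      rewrite fact_simpl, mult_INR; replace (S (n - 1 + K)) with (n + K)%nat by lia.
      rewrite plus_INR; simpl; field; repeat split.
      * apply pow_nonzero, not_0_INR; lia.
      * apply not_0_INR; lia.
      * apply INR_fact_neq_0.
    + replace 1%R with (1 * (1 + 0))%R at 1 by ring.
      apply (is_lim_seq_mult' _ _ 1 (1 + 0)%R); auto.
      apply (is_lim_seq_plus' (fun _ => 1%R)); [apply is_lim_seq_const|].
      apply is_lim_seq_const_div_INR.
Qed.

(** For large [n] this is the reciprocal of the product of [1 - j / n] over [1 <= j <= K]. *)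
Lemma lim_falling_factorial (K : nat) :
  is_lim_seq (fun n => INR (fact (n - 1 - K)) * INR n ^ K / INR (fact (n - 1)))%R 1.
Proof.
  induction K as [|K IH].
  - apply is_lim_seq_ext with (fun _ => 1%R); [|apply is_lim_seq_const].
    intros n; rewrite Nat.sub_0_r; simpl; field; apply INR_fact_neq_0.
  - apply is_lim_seq_ext_loc with
      (fun n => INR (fact (n - 1 - K)) * INR n ^ K / INR (fact (n - 1)) * / (1 - INR (S K) / INR n))%R.
    + exists (K + 2)%nat; intros n Hn.
      replace (n - 1 - K)%nat with (S (n - 1 - S K)) by lia.
      rewrite fact_simpl, mult_INR; replace (S (n - 1 - S K)) with (n - S K)%nat by lia.
      rewrite minus_INR by lia.
      assert (0 < INR n - INR (S K)).
      { rewrite <- minus_INR by lia; apply lt_0_INR; lia. }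
      assert (INR n <> 0%R) by (apply not_0_INR; lia).
      simpl pow; field; repeat split; auto; try lra; apply INR_fact_neq_0.
    + replace 1%R with (1 * / (1 - 0))%R at 1 by field.
      apply (is_lim_seq_mult' _ _ 1 (/ (1 - 0))%R); auto.
      apply (is_lim_seq_inv _ (1 - 0)%R); [|intros E; injection E; lra].
      apply (is_lim_seq_minus' (fun _ => 1%R)); [apply is_lim_seq_const|].
      apply is_lim_seq_const_div_INR.
Qed.

Lemma R_int_R_plus (f g : R -> R) (a b : R) :
  R_int_R f a -> R_int_R g b -> R_int_R (fun x => f x + g x)%R (a + b)%R.
Proof. exact (is_RInt_gen_plus (V := R_NormedModule) f g a b). Qed.

Lemma R_int_R_minus (f g : R -> R) (a b : R) :
  R_int_R f a -> R_int_R g b -> R_int_R (fun x => f x - g x)%R (a - b)%R.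
Proof. exact (is_RInt_gen_minus (V := R_NormedModule) f g a b). Qed.

Lemma R_int_R_scal (c : R) (f : R -> R) (a : R) :
  R_int_R f a -> R_int_R (fun x => c * f x)%R (c * a)%R.
Proof. exact (is_RInt_gen_scal (V := R_NormedModule) f c a). Qed.

(* By AM-GM the left side is at most [lam * v^2 + exp (2 c |v|) / lam]; the right side is a
   bound for it whose moments against [exp (n x - exp x)] are factorials. *)
Lemma weight_le (lam c v : R) (K : nat) : 0 < lam -> 2 * c <= INR K ->
  Rabs v * exp (c * Rabs v) <=
    lam * ((exp (2 * v) - 2 * exp (1 * v) + 1) + (exp (- (2) * v) - 2 * exp (- (1) * v) + 1))
    + / lam * (exp (INR K * v) + exp (- INR K * v)).
Proof.
  intros Hl Hc.
  set (w := exp (c * Rabs v)).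
  assert (Hw : 0 < w) by apply exp_pos.
  assert (H1 : Rabs v * w <= lam * (Rabs v * Rabs v) + / lam * (w * w)).
  { assert (H := Rle_0_sqr (lam * Rabs v - w)); unfold Rsqr in H.
    apply Rmult_le_reg_l with lam; auto.
    replace (lam * (lam * (Rabs v * Rabs v) + / lam * (w * w)))%R
      with (lam * Rabs v * (lam * Rabs v) + w * w)%R by (field; lra).
    assert (0 <= lam * Rabs v * w) by (repeat apply Rmult_le_pos; try lra; apply Rabs_pos).
    nra. }
  assert (H2 : w * w <= exp (INR K * v) + exp (- INR K * v)).
  { unfold w; rewrite <- exp_plus.
    assert (H := exp_le (c * Rabs v + c * Rabs v) (INR K * Rabs v) ltac:(generalize (Rabs_pos v); nra)).
    eapply Rle_trans; [exact H|].
    generalize (exp_pos (INR K * v)) (exp_pos (- INR K * v)).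
    unfold Rabs; destruct Rcase_abs; intros; [|lra].
    replace (INR K * - v)%R with (- INR K * v)%R by ring; lra. }
  (* The two brackets are [(e^v - 1)^2] and [(e^(- v) - 1)^2]; whichever sign [v] has, one of them
     is at least [v^2]. *)
  assert (H3 : Rabs v * Rabs v <=
    (exp (2 * v) - 2 * exp (1 * v) + 1) + (exp (- (2) * v) - 2 * exp (- (1) * v) + 1)).
  { replace (2 * v)%R with (v + v)%R by ring; replace (- (2) * v)%R with (- v + - v)%R by ring.
    replace (1 * v)%R with v by ring; replace (- (1) * v)%R with (- v)%R by ring.
    rewrite !exp_plus.
    assert (P1 := exp_ineq1_le v); assert (P2 := exp_ineq1_le (- v)).
    assert (S1 := Rle_0_sqr (exp v - 1)); assert (S2 := Rle_0_sqr (exp (- v) - 1)).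
    unfold Rsqr in *; unfold Rabs; destruct Rcase_abs; nra. }
  eapply Rle_trans; [exact H1|].
  apply Rplus_le_compat; apply Rmult_le_compat_l; auto; [lra|].
  left; now apply Rinv_0_lt_compat.
Qed.

(** Divided by [(n-1)!], each moment tends to 1, so the second-moment combinations tend to
    [1 - 2 + 1 = 0] and only the [1 / lam] term survives. The threshold does not depend on [F]. *)
Lemma gamma_weight_small (c eps : R) : 0 < eps -> exists N : nat, forall n : nat, (N <= n)%nat ->
  forall (F : R -> C) (l : C), (forall v, Cmod (F v) <= Rabs v * exp (c * Rabs v)) ->
  CR_int_R (fun x => F (x - ln (INR n))%R * gamma_kernel (RtoC (INR n)) (RtoC x)) l ->
  Cmod l <= eps * INR (fact (n - 1)).
Proof.
  intros He.
  destruct (INR_unbounded (2 * c)) as [K HK].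
  assert (HK' : 2 * c <= INR K) by lra.
  (* Chosen so that the limit [2 / lam] of the bound is [eps / 3]. *)
  set (lam := (6 / eps)%R).
  assert (Hl : 0 < lam) by (apply Rdiv_lt_0_compat; lra).
  set (A := fun k n => (INR (fact (n - 1 + k)) / (INR (fact (n - 1)) * INR n ^ k))%R).
  set (B := fun k n => (INR (fact (n - 1 - k)) * INR n ^ k / INR (fact (n - 1)))%R).
  assert (HA : forall k, is_lim_seq (A k) 1) by apply lim_rising_factorial.
  assert (HB : forall k, is_lim_seq (B k) 1) by apply lim_falling_factorial.
  assert (HE : is_lim_seq (fun n => lam * ((A 2%nat n - 2 * A 1%nat n + 1)
      + (B 2%nat n - 2 * B 1%nat n + 1)) + / lam * (A K n + B K n))%R
     (lam * ((1 - 2 * 1 + 1) + (1 - 2 * 1 + 1)) + / lam * (1 + 1))%R).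
  { assert (Hs : forall (f : nat -> R) (a b : R), is_lim_seq f b -> is_lim_seq (fun n => a * f n)%R (a * b)%R).
    { intros f a b; exact (is_lim_seq_scal_l f a b). }
    repeat first [apply HA | apply HB | apply is_lim_seq_const
      | apply is_lim_seq_minus' | apply is_lim_seq_plus' | apply Hs]. }
  replace (lam * ((1 - 2 * 1 + 1) + (1 - 2 * 1 + 1)) + / lam * (1 + 1))%R with (eps / 3)%R in HE
    by (unfold lam; field; lra).
  apply is_lim_seq_spec in HE.
  destruct (HE (mkposreal (eps / 3) ltac:(lra))) as [N HN]; simpl in HN.
  exists (N + K + 4)%nat; intros n Hn F l HF HI.
  specialize (HN n ltac:(lia)); apply Rabs_def2 in HN.
  set (L := ln (INR n)) in *.
  assert (Hn0 : INR (fact (n - 1)) <> 0%R) by apply INR_fact_neq_0.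
  assert (Hnp : INR n <> 0%R) by (apply not_0_INR; lia).
  assert (MA : forall k, R_int_R (fun x => exp (INR k * (x - L)) * exp (INR n * x - exp x))%R
      (A k n * INR (fact (n - 1)))%R).
  { intros k.
    replace (A k n * INR (fact (n - 1)))%R with (exp (- (INR k * L)) * INR (fact (n - 1 + k)))%R.
    - apply gamma_moment.
      replace (S (n - 1 + k)) with (n + k)%nat by lia; apply plus_INR.
    - rewrite exp_Ropp; unfold L; rewrite exp_INR_mul_ln by lia; unfold A.
      field; repeat split; auto; now apply pow_nonzero. }
  assert (MB : forall k, (k < n)%nat ->
      R_int_R (fun x => exp (- INR k * (x - L)) * exp (INR n * x - exp x))%R
      (B k n * INR (fact (n - 1)))%R).
  { intros k Hk.
    replace (B k n * INR (fact (n - 1)))%R with (exp (- (- INR k * L)) * INR (fact (n - 1 - k)))%R.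
    - apply gamma_moment.
      replace (S (n - 1 - k)) with (n - k)%nat by lia; rewrite minus_INR by lia; ring.
    - replace (- (- INR k * L))%R with (INR k * L)%R by ring.
      unfold L; rewrite exp_INR_mul_ln by lia; unfold B; field; auto. }
  assert (M1 : R_int_R (fun x => exp (INR n * x - exp x)) (INR (fact (n - 1)))).
  { generalize (MA 0%nat); unfold A; rewrite Nat.add_0_r; simpl pow.
    replace (INR (fact (n - 1)) / (INR (fact (n - 1)) * 1) * INR (fact (n - 1)))%R
      with (INR (fact (n - 1))) by (field; auto).
    refine (is_RInt_gen_ext_all (V := R_NormedModule) _ _ _ _ _ _); intros x; simpl INR.
    rewrite Rmult_0_l, exp_0; exact (Rmult_1_l _). }
  assert (HM := R_int_R_plus _ _ _ _
    (R_int_R_scal lam _ _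
      (R_int_R_plus _ _ _ _
        (R_int_R_plus _ _ _ _
          (R_int_R_minus _ _ _ _ (MA 2%nat)
             (R_int_R_scal 2 _ _ (MA 1%nat))) M1)
        (R_int_R_plus _ _ _ _
          (R_int_R_minus _ _ _ _ (MB 2%nat ltac:(lia))
             (R_int_R_scal 2 _ _ (MB 1%nat ltac:(lia)))) M1)))
    (R_int_R_scal (/ lam) _ _
      (R_int_R_plus _ _ _ _ (MA K) (MB K ltac:(lia))))).
  assert (HC := fun H => Cmod_int_R_le _ _ _ _ H HI HM); cbv beta in HC.
  eapply Rle_trans; [apply HC|].
  - intros x.
    rewrite Cmod_mult, Cmod_gamma_kernel, re_RtoC.
    eapply Rle_trans; [apply Rmult_le_compat_r; [left; apply exp_pos|]|].
    + eapply Rle_trans; [apply HF|apply (weight_le lam c (x - L) K Hl HK')].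
    + right; replace (INR 2) with 2%R by (simpl; ring); replace (INR 1) with 1%R by reflexivity.
      ring.
  - apply Rle_trans with ((lam * ((A 2%nat n - 2 * A 1%nat n + 1)
      + (B 2%nat n - 2 * B 1%nat n + 1)) + / lam * (A K n + B K n)) * INR (fact (n - 1)))%R.
    + right; ring.
    + apply Rmult_le_compat_r; [apply pos_INR|lra].
Qed.

(** * Limits of complex sequences; growth of Gamma and its derivative at [s + n] *)

Definition Ctends (u : nat -> C) (l : C) : Prop :=
  forall eps : R, 0 < eps -> exists N : nat, forall n : nat, (N <= n)%nat -> Cmod (u n - l) <= eps.

Lemma Ctends_ext (N0 : nat) (u v : nat -> C) (l : C) :
  (forall n, (N0 <= n)%nat -> u n = v n) -> Ctends u l -> Ctends v l.
Proof.
  intros H Hu eps He; destruct (Hu eps He) as [N HN]; exists (N + N0)%nat; intros n Hn.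
  rewrite <- H by lia; apply HN; lia.
Qed.

Lemma Ctends_unique (u : nat -> C) (l m : C) : Ctends u l -> Ctends u m -> l = m.
Proof.
  intros Hl Hm; apply Ceq_minus, Cmod_eq_0.
  apply Rle_antisym; [|apply Cmod_ge_0].
  apply le_epsilon; intros eps He; rewrite Rplus_0_l.
  destruct (Hl (eps / 2)%R ltac:(lra)) as [N1 H1]; destruct (Hm (eps / 2)%R ltac:(lra)) as [N2 H2].
  specialize (H1 (N1 + N2)%nat ltac:(lia)); specialize (H2 (N1 + N2)%nat ltac:(lia)).
  replace (l - m) with (- (u (N1 + N2)%nat - l) + (u (N1 + N2)%nat - m)) by ring.
  eapply Rle_trans; [apply Cmod_triangle|]; rewrite Cmod_opp; lra.
Qed.

Lemma Ctends_minus (u v : nat -> C) (l m : C) :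
  Ctends u l -> Ctends v m -> Ctends (fun n => u n - v n) (l - m).
Proof.
  intros Hl Hm eps He.
  destruct (Hl (eps / 2)%R ltac:(lra)) as [N1 H1]; destruct (Hm (eps / 2)%R ltac:(lra)) as [N2 H2].
  exists (N1 + N2)%nat; intros n Hn.
  specialize (H1 n ltac:(lia)); specialize (H2 n ltac:(lia)).
  replace (u n - v n - (l - m)) with ((u n - l) + - (v n - m)) by ring.
  eapply Rle_trans; [apply Cmod_triangle|]; rewrite Cmod_opp; lra.
Qed.

Lemma Ctends_mult (u v : nat -> C) (l m : C) :
  Ctends u l -> Ctends v m -> Ctends (fun n => u n * v n) (l * m).
Proof.
  intros Hl Hm eps He.
  assert (A := Cmod_ge_0 l); assert (B := Cmod_ge_0 m).
  set (K := (1 + Cmod l + Cmod m)%R).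
  set (d := Rmin 1 (eps / K)).
  assert (Hd : 0 < d) by (apply Rmin_glb_lt; [lra|apply Rdiv_lt_0_compat; unfold K; lra]).
  assert (Hd1 : d <= 1) by apply Rmin_l.
  assert (HdK : d * K <= eps).
  { apply Rle_trans with (eps / K * K)%R.
    - apply Rmult_le_compat_r; [unfold K; lra|apply Rmin_r].
    - right; field; unfold K; lra. }
  destruct (Hl d Hd) as [N1 H1]; destruct (Hm d Hd) as [N2 H2].
  exists (N1 + N2)%nat; intros n Hn.
  specialize (H1 n ltac:(lia)); specialize (H2 n ltac:(lia)).
  replace (u n * v n - l * m)
    with ((u n - l) * (v n - m) + (l * (v n - m) + m * (u n - l))) by ring.
  eapply Rle_trans; [apply Cmod_triangle|].
  eapply Rle_trans; [apply Rplus_le_compat_l, Cmod_triangle|]; rewrite !Cmod_mult.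
  assert (C1 := Cmod_ge_0 (u n - l)); assert (C2 := Cmod_ge_0 (v n - m)).
  unfold K in HdK; nra.
Qed.

(** The power [n^s]. Being an exponential it is nonzero even at [n = 0], so it can be divided by
    without side condition. *)
Definition npow (n : nat) (s : C) : C := Cexp (s * RtoC (ln (INR n))).

Lemma npow_neq_0 (n : nat) (s : C) : npow n s <> 0.
Proof. apply Cexp_neq_0. Qed.

Lemma RtoC_neq_0 (x : R) : x <> 0%R -> RtoC x <> 0.
Proof. intros H E; injection E; auto. Qed.

Lemma fact_C_neq_0 (n : nat) : RtoC (INR (fact n)) <> 0.
Proof. apply RtoC_neq_0, INR_fact_neq_0. Qed.

Lemma gamma_weight_small_scaled (M c eps : R) : 0 <= M -> 0 < eps ->
  exists N : nat, forall n : nat, (N <= n)%nat ->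
  forall (F : R -> C) (l : C), (forall v, Cmod (F v) <= M * (Rabs v * exp (c * Rabs v))) ->
  CR_int_R (fun x => F (x - ln (INR n))%R * gamma_kernel (RtoC (INR n)) (RtoC x)) l ->
  Cmod l <= eps * INR (fact (n - 1)).
Proof.
  intros HM He.
  assert (He' : 0 < eps / (M + 1)) by (apply Rdiv_lt_0_compat; lra).
  destruct (gamma_weight_small c _ He') as [N HN]; exists N; intros n Hn F l HF HI.
  assert (Hi : 0 < / (M + 1)) by (apply Rinv_0_lt_compat; lra).
  apply (CR_int_gen_Cscal _ _ (RtoC (/ (M + 1)))) in HI.
  specialize (HN n Hn (fun v => RtoC (/ (M + 1)) * F v) (RtoC (/ (M + 1)) * l)).
  rewrite Cmod_mult, Cmod_R, Rabs_pos_eq in HN by lra.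
  apply Rmult_le_reg_l with (/ (M + 1))%R; auto.
  replace (/ (M + 1) * (eps * INR (fact (n - 1))))%R
    with (eps / (M + 1) * INR (fact (n - 1)))%R by (field; lra).
  apply HN.
  - intros v; rewrite Cmod_mult, Cmod_R, Rabs_pos_eq by lra.
    apply Rmult_le_reg_l with (M + 1)%R; [lra|].
    rewrite <- Rmult_assoc, Rinv_r, Rmult_1_l by lra.
    eapply Rle_trans; [apply HF|].
    assert (0 <= Rabs v * exp (c * Rabs v)) by
      (apply Rmult_le_pos; [apply Rabs_pos|left; apply exp_pos]).
    nra.
  - revert HI; apply CR_int_gen_ext; try apply _; intros x; ring.
Qed.

Lemma Cmod_exp_line_sub_1 (s : C) (v : R) :
  Cmod (Cexp (s * RtoC v) - 1) <= Cmod s * (Rabs v * exp (Cmod s * Rabs v)).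
Proof.
  eapply Rle_trans; [apply Cmod_exp_sub_1_small|].
  rewrite Cmod_mult, Cmod_R; lra.
Qed.

Lemma Cmod_mul_exp_line (s : C) (v : R) :
  Cmod (RtoC v * Cexp (s * RtoC v)) <= 1 * (Rabs v * exp (Cmod s * Rabs v)).
Proof.
  rewrite Cmod_mult, Cmod_R, Cmod_Cexp, Rmult_1_l.
  apply Rmult_le_compat_l; [apply Rabs_pos|].
  apply exp_le; rewrite <- Cmod_R, <- Cmod_mult.
  eapply Rle_trans; [apply Rle_abs|apply re_le_Cmod].
Qed.

Lemma gamma_kernel_shift (s : C) (n : nat) (x : R) :
  gamma_kernel (s + RtoC (INR n)) (RtoC x) =
  npow n s * (Cexp (s * RtoC (x - ln (INR n))) * gamma_kernel (RtoC (INR n)) (RtoC x)).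
Proof.
  unfold gamma_kernel, npow; rewrite <- !Cexp_plus; f_equal; rewrite RtoC_minus; ring.
Qed.

Lemma Re_plus_INR (s : C) (n : nat) : 0 < Re s -> 0 < Re (s + RtoC (INR n)).
Proof. intros Hs; generalize (pos_INR n); unfold Re in *; simpl; lra. Qed.

(** After division by [n^s], the integrand for [s + n] differs from that for [n] by the factor
    [e^(s v) - 1] with [v = x - ln n], which vanishes at the centre. *)
Lemma CGamma_shift_asymp (s : C) : 0 < Re s ->
  Ctends (fun n => CGamma (s + RtoC (INR n)) / (npow n s * RtoC (INR (fact (n - 1))))) 1.
Proof.
  intros Hs eps He.
  destruct (gamma_weight_small_scaled (Cmod s) (Cmod s) eps (Cmod_ge_0 s) He) as [N HN].
  exists (N + 1)%nat; intros n Hn.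
  assert (Hnp := npow_neq_0 n s); assert (Hf := fact_C_neq_0 (n - 1)).
  assert (Hn0 : 0 < Re (RtoC (INR n))) by (rewrite re_RtoC; apply lt_0_INR; lia).
  assert (HI := CR_int_gen_minus _ _ _ _ _ _
    (CR_int_gen_Cscal _ _ (/ npow n s) _ _ (CGamma_int _ (Re_plus_INR s n Hs)))
    (CGamma_int _ Hn0)).
  assert (Hfact : CGamma (RtoC (INR n)) = RtoC (INR (fact (n - 1)))).
  { rewrite <- CGamma_INR; do 3 f_equal; lia. }
  rewrite Hfact in HI.
  assert (HB : Cmod (/ npow n s * CGamma (s + RtoC (INR n)) - RtoC (INR (fact (n - 1))))
               <= eps * INR (fact (n - 1))).
  { apply (HN n ltac:(lia) (fun v => Cexp (s * RtoC v) - 1)).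
    - intros v; apply Cmod_exp_line_sub_1.
    - revert HI; apply CR_int_gen_ext; try apply _; intros x.
      rewrite gamma_kernel_shift; field; auto. }
  replace (CGamma (s + RtoC (INR n)) / (npow n s * RtoC (INR (fact (n - 1)))) - 1)
    with ((/ npow n s * CGamma (s + RtoC (INR n)) - RtoC (INR (fact (n - 1)))) /
           RtoC (INR (fact (n - 1)))) by (field; auto).
  rewrite Cmod_div, Cmod_R, Rabs_pos_eq by (auto; apply pos_INR).
  apply Rle_div_l; auto; apply lt_0_INR, lt_O_fact.
Qed.

(** Subtracting [ln n] times Gamma turns the weight [x] into [v = x - ln n], so the factor again
    vanishes at the centre. *)
Lemma dGamma_shift_asymp (s : C) : 0 < Re s ->
  Ctends (fun n => (dGamma (s + RtoC (INR n)) - RtoC (ln (INR n)) * CGamma (s + RtoC (INR n)))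
                   / (npow n s * RtoC (INR (fact (n - 1))))) 0.
Proof.
  intros Hs eps He.
  destruct (gamma_weight_small_scaled 1 (Cmod s) eps ltac:(lra) He) as [N HN].
  exists (N + 1)%nat; intros n Hn.
  assert (Hnp := npow_neq_0 n s); assert (Hf := fact_C_neq_0 (n - 1)).
  assert (HI := CR_int_gen_Cscal _ _ (/ npow n s) _ _
    (CR_int_gen_minus _ _ _ _ _ _ (dGamma_int _ (Re_plus_INR s n Hs))
      (CR_int_gen_Cscal _ _ (RtoC (ln (INR n))) _ _ (CGamma_int _ (Re_plus_INR s n Hs))))).
  set (D := dGamma (s + RtoC (INR n)) - RtoC (ln (INR n)) * CGamma (s + RtoC (INR n))) in *.
  assert (HB : Cmod (/ npow n s * D) <= eps * INR (fact (n - 1))).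
  { apply (HN n ltac:(lia) (fun v => RtoC v * Cexp (s * RtoC v))).
    - intros v; apply Cmod_mul_exp_line.
    - revert HI; apply CR_int_gen_ext; try apply _; intros x.
      rewrite gamma_kernel_shift, !RtoC_minus; field; auto. }
  replace (D / (npow n s * RtoC (INR (fact (n - 1)))) - 0)
    with ((/ npow n s * D) / RtoC (INR (fact (n - 1)))) by (field; auto).
  rewrite Cmod_div, Cmod_R, Rabs_pos_eq by (auto; apply pos_INR).
  apply Rle_div_l; auto; apply lt_0_INR, lt_O_fact.
Qed.

(** * The Hankel contour in logarithmic coordinates *)

Lemma CC_derive_hline (f : C -> C) (c : C) (x : R) (l : C) :
  CC_derive f (RtoC x + c) l -> CR_derive (fun t => f (RtoC t + c)) x l.
Proof.
  intros H.
  replace (RtoC x + c) with (c + RtoC x * 1) in H by ring.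
  apply CC_derive_line in H; rewrite Cmult_1_l in H.
  revert H; apply (@is_derive_ext R_AbsRing C_R_NormedModule).
  intros t; f_equal; ring.
Qed.

Lemma CC_derive_vline (f : C -> C) (c : C) (x : R) (l : C) :
  CC_derive f (c + Ci * RtoC x) l -> CR_derive (fun t => f (c + Ci * RtoC t)) x (Ci * l).
Proof.
  intros H; rewrite (Cmult_comm Ci (RtoC x)) in H.
  apply CC_derive_line in H.
  revert H; apply (@is_derive_ext R_AbsRing C_R_NormedModule).
  intros t; f_equal; ring.
Qed.

Lemma CR_derive_Re (f : R -> C) (x : R) (l : C) :
  CR_derive f x l -> is_derive (fun t => Re (f t)) x (Re l).
Proof.
  intros H; split; [apply (is_linear_scal_l (K := R_AbsRing) (V := R_NormedModule))|].
  intros y Hy eps; destruct (proj2 H y Hy eps) as [d Hd]; exists d; intros z Hz.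
  specialize (Hd z Hz); rewrite <- Cmod_norm in Hd.
  eapply Rle_trans; [|exact Hd].
  match goal with |- _ <= Cmod ?u => apply Rle_trans with (Rabs (Re u)); [|apply re_le_Cmod] end.
  right; reflexivity.
Qed.

Lemma CC_derive_continuous (f : C -> C) (z l : C) : CC_derive f z l ->
  forall eps : R, 0 < eps -> exists d : posreal, forall h : C, Cmod h < d -> Cmod (f (z + h) - f z) < eps.
Proof.
  intros H eps He.
  destruct (proj1 (CC_derive_iff f z l) H (mkposreal 1 Rlt_0_1)) as [d Hd]; simpl in Hd.
  assert (Hl := Cmod_ge_0 l).
  assert (Hm : 0 < Rmin d (eps / (Cmod l + 1))).
  { apply Rmin_glb_lt; [apply d|apply Rdiv_lt_0_compat; lra]. }
  exists (mkposreal _ Hm); simpl; intros h Hh.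
  specialize (Hd h (Rlt_le_trans _ _ _ Hh (Rmin_l _ _))).
  assert (Hh2 := Rlt_le_trans _ _ _ Hh (Rmin_r _ _)).
  replace (f (z + h) - f z) with ((f (z + h) - f z - h * l) + h * l) by ring.
  eapply Rle_lt_trans; [apply Cmod_triangle|]; rewrite Cmod_mult.
  apply (Rmult_lt_compat_r (Cmod l + 1)) in Hh2; [|lra].
  unfold Rdiv in Hh2; rewrite Rmult_assoc, Rinv_l in Hh2 by lra.
  lra.
Qed.

Definition log_pt (x theta : R) : C := RtoC x + Ci * RtoC theta.

Lemma Re_log_pt (x theta : R) : Re (log_pt x theta) = x.
Proof. unfold log_pt, Re; simpl; ring. Qed.

(* The Hankel contour in the coordinate [w = Log z] is the boundary of the half strip
   [u < Re w], [-PI < Im w < PI], and [K w dw] stands for [F z (Log z) dz]. *)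
Definition is_contour_int (u : R) (K : C -> C) (l : C) : Prop :=
  exists A B D : C,
    CR_int_gen (fun x => K (log_pt x PI)) (at_point u) (Rbar_locally p_infty) A /\
    CR_int_gen (fun x => K (log_pt x (- PI))) (at_point u) (Rbar_locally p_infty) B /\
    CR_int (fun theta => K (log_pt u theta)) (- PI) PI D /\
    l = A - B + Ci * D.

(** * Cauchy's theorem on the half strip *)

(** Derivatives are carried as explicit functions; a second use, for [K'] and [K''], supplies the
    continuity of [K'] needed to differentiate under the integral sign. *)
Definition holo_left (U : R) (K K' : C -> C) : Prop :=
  forall w, Re w < U -> CC_derive K w (K' w).

(** Infinitesimal form of Cauchy's theorem on a rectangle: the derivative under the integral is
    [Re K'], which by Cauchy-Riemann is the [theta]-derivative of [Im K], so only the end values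
    remain. In the proof [Im K] is written [- Re (Ci K)]. *)
Lemma circle_Re_derive (U : R) (K K' K'' : C -> C) (u : R) :
  holo_left U K K' -> holo_left U K' K'' -> u < U ->
  is_derive (fun x => RInt (fun theta => Re (K (log_pt x theta))) (- PI) PI) u
    (Im (K (log_pt u PI) - K (log_pt u (- PI)))).
Proof.
  intros HK HK' Hu.
  assert (Dx : forall x theta, x < U ->
    is_derive (fun x => Re (K (log_pt x theta))) x (Re (K' (log_pt x theta)))).
  { intros x theta Hx; apply (CR_derive_Re (fun x => K (log_pt x theta))).
    apply CC_derive_hline, HK; fold (log_pt x theta); now rewrite Re_log_pt. }
  assert (Dt : forall x theta, x < U ->
    is_derive (fun theta => Re (K (log_pt x theta))) theta (Re (Ci * K' (log_pt x theta)))).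
  { intros x theta Hx; apply (CR_derive_Re (fun theta => K (log_pt x theta))).
    apply CC_derive_vline, HK; fold (log_pt x theta); now rewrite Re_log_pt. }
  assert (Dt2 : forall x theta, x < U ->
    is_derive (fun theta => - Re (Ci * K (log_pt x theta)))%R theta (Re (K' (log_pt x theta)))).
  { intros x theta Hx.
    replace (Re (K' (log_pt x theta))) with (- Re (Ci * (Ci * K' (log_pt x theta))))%R
      by (unfold Re; simpl; ring).
    apply (is_derive_opp (V := R_NormedModule) (fun theta => Re (Ci * K (log_pt x theta)))).
    apply (CR_derive_Re (fun theta => Ci * K (log_pt x theta))), CR_derive_Cscal.
    apply CC_derive_vline, HK; fold (log_pt x theta); now rewrite Re_log_pt. }
  assert (Ct : forall x theta, x < U -> continuous (fun theta => Re (K' (log_pt x theta))) theta).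
  { intros x theta Hx; apply (ex_derive_continuous (V := R_NormedModule)).
    exists (Re (Ci * K'' (log_pt x theta))); apply (CR_derive_Re (fun theta => K' (log_pt x theta))).
    apply CC_derive_vline, HK'; fold (log_pt x theta); now rewrite Re_log_pt. }
  replace (Im (K (log_pt u PI) - K (log_pt u (- PI))))
    with (RInt (fun theta => Derive (fun x => Re (K (log_pt x theta))) u) (- PI) PI).
  - assert (Hloc : locally u (fun x => x < U)).
    { exists (mkposreal (U - u) ltac:(lra)); intros y Hy; change (Rabs (y - u) < U - u) in Hy.
      apply Rabs_def2 in Hy; lra. }
    apply (is_derive_RInt_param (fun x theta => Re (K (log_pt x theta)))).
    + revert Hloc; apply filter_imp; intros x Hx theta _.
      exists (Re (K' (log_pt x theta))); now apply Dx.
    + intros theta _.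
      apply continuity_2d_pt_ext_loc with (fun x t => Re (K' (log_pt x t))).
      * exists (mkposreal (U - u) ltac:(lra)); intros x t Hx _; simpl in Hx.
        symmetry; apply is_derive_unique, Dx; apply Rabs_def2 in Hx; lra.
      * intros eps.
        destruct (CC_derive_continuous K' (log_pt u theta) _
          (HK' _ (eq_ind_r (fun r => r < U) Hu (Re_log_pt u theta))) eps (cond_pos eps)) as [d Hd].
        assert (Hd2 : 0 < d / 2) by (destruct d; simpl; lra).
        exists (mkposreal _ Hd2); simpl; intros x t Hx Ht.
        replace (log_pt x t) with (log_pt u theta + (RtoC (x - u) + Ci * RtoC (t - theta)))
          by (unfold log_pt; rewrite !RtoC_minus; ring).
        eapply Rle_lt_trans; [|apply (Hd (RtoC (x - u) + Ci * RtoC (t - theta)))].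
        -- match goal with |- _ <= Cmod ?z => exact (re_le_Cmod z) end.
        -- eapply Rle_lt_trans; [apply Cmod_triangle|].
           rewrite Cmod_mult, Cmod_Ci, !Cmod_R; lra.
    + revert Hloc; apply filter_imp; intros x Hx.
      apply (ex_RInt_continuous (V := R_CompleteNormedModule)); intros theta _.
      apply (ex_derive_continuous (V := R_NormedModule)).
      exists (Re (Ci * K' (log_pt x theta))); now apply Dt.
  - rewrite (RInt_ext _ (fun theta => Re (K' (log_pt u theta))))
      by (intros theta _; apply is_derive_unique, Dx, Hu).
    apply (is_RInt_unique (V := R_CompleteNormedModule)).
    replace (Im (K (log_pt u PI) - K (log_pt u (- PI))))
      with (minus (- Re (Ci * K (log_pt u PI)))%R (- Re (Ci * K (log_pt u (- PI))))%R)
      by (unfold minus, plus, opp, Re, Im; simpl; unfold plus, opp; simpl; ring).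
    apply (is_RInt_derive (V := R_CompleteNormedModule) (fun theta => - Re (Ci * K (log_pt u theta)))%R).
    + intros theta _; now apply Dt2.
    + intros theta _; now apply Ct.
Qed.

Lemma CR_int_Re (f : R -> C) (a b : R) (l : C) : CR_int f a b l -> is_RInt (fun x => Re (f x)) a b (Re l).
Proof. exact (is_RInt_fct_extend_fst (U := R_NormedModule) (V := R_NormedModule) f a b l). Qed.

Lemma CR_int_Im (f : R -> C) (a b : R) (l : C) : CR_int f a b l -> is_RInt (fun x => Im (f x)) a b (Im l).
Proof. exact (is_RInt_fct_extend_snd (U := R_NormedModule) (V := R_NormedModule) f a b l). Qed.

(** Integrates [circle_Re_derive] in [u]. This is one real equation out of Cauchy's complex one; the
    other comes from applying it to [- Ci K]. *)
Lemma rectangle_Im (U : R) (K K' K'' : C -> C) (u1 u2 : R) (J D1 D2 : C) :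
  holo_left U K K' -> holo_left U K' K'' -> u1 < U -> u2 < U ->
  CR_int (fun x => K (log_pt x PI) - K (log_pt x (- PI))) u1 u2 J ->
  CR_int (fun theta => K (log_pt u1 theta)) (- PI) PI D1 ->
  CR_int (fun theta => K (log_pt u2 theta)) (- PI) PI D2 ->
  Im J = (Re D2 - Re D1)%R.
Proof.
  intros HK HK' H1 H2 HJ HD1 HD2.
  apply CR_int_Im in HJ; apply CR_int_Re in HD1; apply CR_int_Re in HD2.
  apply (is_RInt_unique (V := R_CompleteNormedModule)) in HJ, HD1, HD2.
  rewrite <- HJ, <- HD1, <- HD2.
  apply (is_RInt_unique (V := R_CompleteNormedModule)).
  assert (HU : forall x, Rmin u1 u2 <= x <= Rmax u1 u2 -> x < U).
  { intros x Hx; assert (Rmax u1 u2 < U) by (now apply Rmax_lub_lt); lra. }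
  apply (is_RInt_derive (V := R_CompleteNormedModule)
    (fun u => RInt (fun theta => Re (K (log_pt u theta))) (- PI) PI)).
  - intros x Hx; apply (circle_Re_derive U K K' K''); auto.
  - intros x Hx; apply (ex_derive_continuous (V := R_NormedModule)).
    assert (Hh : forall th, CR_derive (fun x => K (log_pt x th)) x (K' (log_pt x th))).
    { intros th; apply CC_derive_hline, HK; fold (log_pt x th); rewrite Re_log_pt; auto. }
    exists (Re (- Ci * (K' (log_pt x PI) - K' (log_pt x (- PI))))).
    apply (is_derive_ext (V := R_NormedModule)
      (fun x => Re (- Ci * (K (log_pt x PI) - K (log_pt x (- PI)))))).
    { intros t; unfold Re, Im; simpl; ring. }
    apply (CR_derive_Re (fun x => - Ci * (K (log_pt x PI) - K (log_pt x (- PI))))), CR_derive_Cscal.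
    exact (is_derive_minus (V := C_R_NormedModule) _ _ _ _ _ (Hh PI) (Hh (- PI)%R)).
Qed.

Lemma holo_left_Cscal (U : R) (c : C) (K K' : C -> C) :
  holo_left U K K' -> holo_left U (fun w => c * K w) (fun w => c * K' w).
Proof.
  intros H w Hw.
  eapply CC_derive_val; [apply CC_derive_mult; [apply CC_derive_const|apply H, Hw]|simpl; ring].
Qed.

Lemma ex_CR_int (f : R -> C) (a b : R) :
  (forall x, Rmin a b <= x <= Rmax a b -> CR_cont f x) -> exists l, CR_int f a b l.
Proof. intros H; exact (ex_RInt_continuous (V := C_R_CompleteNormedModule) f a b H). Qed.

Lemma holo_left_cont_h (U : R) (K K' : C -> C) (x theta : R) :
  holo_left U K K' -> x < U -> CR_cont (fun x => K (log_pt x theta)) x.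
Proof.
  intros H Hx; apply (CR_derive_cont _ _ (K' (log_pt x theta))), CC_derive_hline, H.
  fold (log_pt x theta); now rewrite Re_log_pt.
Qed.

Lemma holo_left_cont_v (U : R) (K K' : C -> C) (x theta : R) :
  holo_left U K K' -> x < U -> CR_cont (fun theta => K (log_pt x theta)) theta.
Proof.
  intros H Hx; apply (CR_derive_cont _ _ (Ci * K' (log_pt x theta))), CC_derive_vline, H.
  fold (log_pt x theta); now rewrite Re_log_pt.
Qed.

Lemma contour_shift (U : R) (K K' K'' : C -> C) (u1 u2 : R) (l : C) :
  holo_left U K K' -> holo_left U K' K'' -> u1 < U -> u2 < U ->
  is_contour_int u1 K l -> is_contour_int u2 K l.
Proof.
  intros HK HK' H1 H2 [A [B [D [HA [HB [HD E]]]]]].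
  assert (HU : forall a b x, a < U -> b < U -> Rmin a b <= x <= Rmax a b -> x < U).
  { intros a b x Ha Hb Hx; assert (Rmax a b < U) by (now apply Rmax_lub_lt); lra. }
  destruct (ex_CR_int (fun x => K (log_pt x PI)) u1 u2) as [JA HJA].
  { intros x Hx; apply (holo_left_cont_h U K K'); eauto. }
  destruct (ex_CR_int (fun x => K (log_pt x (- PI))) u1 u2) as [JB HJB].
  { intros x Hx; apply (holo_left_cont_h U K K'); eauto. }
  destruct (ex_CR_int (fun theta => K (log_pt u2 theta)) (- PI) PI) as [D2 HD2].
  { intros x Hx; apply (holo_left_cont_v U K K'); eauto. }
  assert (HJ : CR_int (fun x => K (log_pt x PI) - K (log_pt x (- PI))) u1 u2 (JA - JB)).
  { now apply (is_RInt_minus (V := C_R_NormedModule)). }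
  assert (E1 := rectangle_Im U K K' K'' u1 u2 _ _ _ HK HK' H1 H2 HJ HD HD2).
  (* Multiplication by [- Ci] exchanges the roles of real and imaginary parts and yields the missing
     half of the identity. *)
  assert (E2 := rectangle_Im U (fun w => - Ci * K w) (fun w => - Ci * K' w) (fun w => - Ci * K'' w)
    u1 u2 (- Ci * (JA - JB)) (- Ci * D) (- Ci * D2) (holo_left_Cscal U _ _ _ HK)
    (holo_left_Cscal U _ _ _ HK') H1 H2).
  assert (E3 : JA - JB = Ci * (D2 - D)).
  { assert (E4 := E2 ltac:(
      apply (is_RInt_ext (V := C_R_NormedModule)
        (fun x => - Ci * (K (log_pt x PI) - K (log_pt x (- PI)))));
      [intros x _; change (- Ci * (K (log_pt x PI) - K (log_pt x (- PI))) =
          - Ci * K (log_pt x PI) - - Ci * K (log_pt x (- PI))); ring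
      |now apply CR_int_Cscal]) (CR_int_Cscal _ _ _ _ _ HD) (CR_int_Cscal _ _ _ _ _ HD2)).
    unfold Re, Im in E1, E4; simpl in E1, E4.
    apply injective_projections; simpl; lra. }
  (* Moving the start of a ray removes the piece between [u1] and [u2]; over both rays these pieces
     amount to the change of the circle integral, by [E3]. *)
  assert (Sw : forall th J X, CR_int (fun x => K (log_pt x th)) u1 u2 J ->
     CR_int_gen (fun x => K (log_pt x th)) (at_point u1) (Rbar_locally p_infty) X ->
     CR_int_gen (fun x => K (log_pt x th)) (at_point u2) (Rbar_locally p_infty) (- J + X)).
  { intros th J X HJ' HX.
    apply (is_RInt_gen_Chasles (V := C_R_NormedModule) _ u1); auto.
    apply (is_RInt_gen_at_point (V := C_R_NormedModule)).
    now apply (is_RInt_swap (V := C_R_NormedModule)). }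
  exists (- JA + A), (- JB + B), D2; repeat split; auto.
  rewrite E.
  transitivity (A - B + Ci * D2 - Ci * (D2 - D)); [ring|].
  rewrite <- E3; ring.
Qed.

Lemma filterlim_at_point {V : UniformSpace} (f : R -> V) (u : R) :
  filterlim f (at_point u) (locally (f u)).
Proof. intros P HP; exact (locally_singleton _ _ HP). Qed.

Lemma at_point_le_p_infty (u : R) :
  filter_prod (at_point u) (Rbar_locally p_infty) (fun ab : R * R => fst ab <= snd ab).
Proof.
  apply (Filter_prod _ _ _ (fun x => x = u) (fun x => u < x)).
  - reflexivity.
  - now exists u.
  - simpl; intros x y -> H; lra.
Qed.

Lemma exp_neg_ray_int (M u : R) :
  is_RInt_gen (fun x => M * exp (- x))%R (at_point u) (Rbar_locally p_infty) (M * exp (- u))%R.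
Proof.
  assert (H : is_RInt_gen (fun x => M * exp (- x))%R (at_point u) (Rbar_locally p_infty)
     (minus (- M * 0) (- M * exp (- u)))%R).
  { apply (is_RInt_gen_antiderivative (V := R_CompleteNormedModule) _ _ (fun x => - M * exp (- x))%R).
    - intros x; auto_derive; auto; ring.
    - intros x; cont_derive.
    - apply (filterlim_at_point (V := R_UniformSpace) (fun x => - M * exp (- x))%R).
    - apply (is_lim_scal_l (fun x => exp (- x)) (- M) p_infty 0%R), filterlim_exp_neg_p_infty. }
  replace (M * exp (- u))%R with (minus (- M * 0) (- M * exp (- u)))%R; auto.
  unfold minus, plus, opp; simpl; ring.
Qed.

Lemma convex_pred_ge (u : R) : convex_pred (fun x => u <= x).
Proof. intros x y z; lra. Qed.

Lemma ray_ge_p_infty (u : R) : Rbar_locally p_infty (fun x => u <= x).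
Proof. exists u; intros; lra. Qed.

Lemma ex_ray_int (f : R -> C) (u M : R) : (forall x, CR_cont f x) ->
  (forall x, u <= x -> Cmod (f x) <= M * exp (- x)) ->
  exists l, CR_int_gen f (at_point u) (Rbar_locally p_infty) l.
Proof.
  intros Hf HM.
  apply (@is_RInt_gen_dominated C_R_CompleteNormedModule (fun x => u <= x) (at_point u)
    (Rbar_locally p_infty) _ _ f (fun x => M * exp (- x))%R (M * exp (- u))%R).
  - apply convex_pred_ge.
  - exact Hf.
  - intros x; cont_derive.
  - intros x Hx; change (@norm R_AbsRing C_R_NormedModule (f x) <= M * exp (- x)).
    rewrite <- Cmod_norm; auto.
  - apply Rle_refl.
  - apply ray_ge_p_infty.
  - apply exp_neg_ray_int.
Qed.

Lemma Cmod_ray_int_le (f : R -> C) (u M : R) (l : C) :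
  (forall x, u <= x -> Cmod (f x) <= M * exp (- x)) ->
  CR_int_gen f (at_point u) (Rbar_locally p_infty) l -> Cmod l <= M * exp (- u).
Proof.
  intros HM Hl.
  apply (Cmod_int_gen_le (fun x => u <= x) (at_point u) (Rbar_locally p_infty) f
    (fun x => M * exp (- x))%R); auto.
  - apply convex_pred_ge.
  - apply Rle_refl.
  - apply ray_ge_p_infty.
  - apply at_point_le_p_infty.
  - apply exp_neg_ray_int.
Qed.

Lemma CR_int_unique (f : R -> C) (a b : R) (l m : C) : CR_int f a b l -> CR_int f a b m -> l = m.
Proof.
  intros H1 H2; apply (is_RInt_unique (V := C_R_CompleteNormedModule)) in H1, H2; congruence.
Qed.

Lemma contour_plus (u : R) (K L : C -> C) (l m : C) :
  is_contour_int u K l -> is_contour_int u L m -> is_contour_int u (fun w => K w + L w) (l + m).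
Proof.
  intros [A [B [D [HA [HB [HD ->]]]]]] [A' [B' [D' [HA' [HB' [HD' ->]]]]]].
  exists (A + A'), (B + B'), (D + D'); repeat split.
  - exact (CR_int_gen_plus _ _ _ _ _ _ HA HA').
  - exact (CR_int_gen_plus _ _ _ _ _ _ HB HB').
  - exact (is_RInt_plus (V := C_R_NormedModule) _ _ _ _ _ _ HD HD').
  - ring.
Qed.

Lemma contour_Cscal (u : R) (c : C) (K : C -> C) (l : C) :
  is_contour_int u K l -> is_contour_int u (fun w => c * K w) (c * l).
Proof.
  intros [A [B [D [HA [HB [HD ->]]]]]].
  exists (c * A), (c * B), (c * D); repeat split.
  - exact (CR_int_gen_Cscal _ _ c _ _ HA).
  - exact (CR_int_gen_Cscal _ _ c _ _ HB).
  - exact (CR_int_Cscal c _ _ _ _ HD).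
  - ring.
Qed.

Lemma contour_ext (u : R) (K L : C -> C) (l : C) :
  (forall w, K w = L w) -> is_contour_int u K l -> is_contour_int u L l.
Proof.
  intros H [A [B [D [HA [HB [HD E]]]]]]; exists A, B, D; repeat split; auto.
  - revert HA; apply CR_int_gen_ext; try apply _; auto.
  - revert HB; apply CR_int_gen_ext; try apply _; auto.
  - revert HD; apply (is_RInt_ext (V := C_R_NormedModule)); auto.
Qed.

(** The kernels decay doubly exponentially; the weaker rate [e^(- x)] is asked for because its
    integral over a ray is explicit. [M] may depend on [u]. *)
Definition ray_decay (u : R) (K : C -> C) : Prop := exists M : R, forall x : R, u <= x ->
  Cmod (K (log_pt x PI)) <= M * exp (- x) /\ Cmod (K (log_pt x (- PI))) <= M * exp (- x).

Lemma ex_contour_int (u : R) (K : C -> C) :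
  (forall x, CR_cont (fun x => K (log_pt x PI)) x) ->
  (forall x, CR_cont (fun x => K (log_pt x (- PI))) x) ->
  (forall theta, CR_cont (fun theta => K (log_pt u theta)) theta) ->
  ray_decay u K -> exists l, is_contour_int u K l.
Proof.
  intros H1 H2 H3 [M HM].
  destruct (ex_ray_int _ u M H1 (fun x Hx => proj1 (HM x Hx))) as [A HA].
  destruct (ex_ray_int _ u M H2 (fun x Hx => proj2 (HM x Hx))) as [B HB].
  destruct (ex_CR_int _ (- PI) PI (fun x _ => H3 x)) as [D HD].
  exists (A - B + Ci * D), A, B, D; auto.
Qed.

(** Entire functions whose contour may start at any [u]. The integrand with [1 - e^z] in the
    denominator is outside this class and is treated separately. *)
Definition tame (K : C -> C) : Prop :=
  (exists K' K'' : C -> C, (forall w, CC_derive K w (K' w)) /\ (forall w, CC_derive K' w (K'' w)))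
  /\ forall u, ray_decay u K.

Lemma tame_ex (K : C -> C) (u : R) : tame K -> exists l, is_contour_int u K l.
Proof.
  intros [[K' [K'' [H1 H2]]] H3]; apply ex_contour_int; auto.
  - intros x; apply (holo_left_cont_h (x + 1) K K'); [|lra]; intros w _; apply H1.
  - intros x; apply (holo_left_cont_h (x + 1) K K'); [|lra]; intros w _; apply H1.
  - intros x; apply (holo_left_cont_v (u + 1) K K'); [|lra]; intros w _; apply H1.
Qed.

Lemma tame_shift (K : C -> C) (u1 u2 : R) (l : C) :
  tame K -> is_contour_int u1 K l -> is_contour_int u2 K l.
Proof.
  intros [[K' [K'' [H1 H2]]] H3]; apply (contour_shift (Rmax u1 u2 + 1) K K' K'').
  - intros w _; apply H1.
  - intros w _; apply H2.
  - generalize (Rmax_l u1 u2); lra.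
  - generalize (Rmax_r u1 u2); lra.
Qed.

(** The start [u = 0], that is the circle [|z| = 1], is a normalisation; it also lies in the range
    [u < ln (2 PI)] where the Bose integrand is regular. *)
Definition contour_int (K : C -> C) : C :=
  @RInt_gen C_R_CompleteNormedModule (fun x => K (log_pt x PI)) (at_point 0) (Rbar_locally p_infty)
  - @RInt_gen C_R_CompleteNormedModule (fun x => K (log_pt x (- PI))) (at_point 0) (Rbar_locally p_infty)
  + Ci * @RInt C_R_CompleteNormedModule (fun theta => K (log_pt 0 theta)) (- PI) PI.

Lemma contour_int_correct (K : C -> C) (u : R) : tame K -> is_contour_int u K (contour_int K).
Proof.
  intros HK; apply (tame_shift K 0 u); auto.
  destruct (tame_ex K 0 HK) as [l [A [B [D [HA [HB [HD E]]]]]]].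
  unfold contour_int.
  rewrite (is_RInt_gen_unique (V := C_R_CompleteNormedModule) _ _ HA),
    (is_RInt_gen_unique (V := C_R_CompleteNormedModule) _ _ HB),
    (is_RInt_unique (V := C_R_CompleteNormedModule) _ _ _ _ HD).
  exists A, B, D; auto.
Qed.

(** Integration by parts on the contour: the two rays together give [G (u - i PI) - G (u + i PI)],
    and the circle gives the opposite. *)
Lemma contour_antiderivative (G G' G'' : C -> C) (u : R) (l : C) :
  (forall w, CC_derive G w (G' w)) -> (forall w, CC_derive G' w (G'' w)) -> ray_decay u G ->
  is_contour_int u G' l -> l = 0.
Proof.
  intros HG HG' [M HM] [A [B [D [HA [HB [HD ->]]]]]].
  assert (Hc : forall th x, CR_cont (fun x => G' (log_pt x th)) x).
  { intros th x; apply (holo_left_cont_h (x + 1) G' G''); [|lra]; intros w _; apply HG'. }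
  assert (Hray : forall th X, (forall x, u <= x -> Cmod (G (log_pt x th)) <= M * exp (- x)) ->
     CR_int_gen (fun x => G' (log_pt x th)) (at_point u) (Rbar_locally p_infty) X ->
     X = - G (log_pt u th)).
  { intros th X Hth HX; rewrite <- (Cplus_0_l (- _)).
    apply (CR_int_gen_unique _ _ _ _ _ HX).
    apply (CR_int_gen_antiderivative _ _ (fun x => G (log_pt x th))); auto.
    - intros x; apply CC_derive_hline, HG.
    - apply (filterlim_at_point (V := C_R_NormedModule) (fun x => G (log_pt x th))).
    - apply (filterlim_Cmod_sub _ _ 0 (fun x => M * exp (- x))%R).
      + exists u; intros x Hx; unfold Cminus; rewrite Copp_0, Cplus_0_r; apply Hth; lra.
      + replace 0%R with (M * 0)%R by ring.
        apply (is_lim_scal_l (fun x => exp (- x)) M p_infty 0%R), filterlim_exp_neg_p_infty. }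
  rewrite (Hray _ _ (fun x Hx => proj1 (HM x Hx)) HA), (Hray _ _ (fun x Hx => proj2 (HM x Hx)) HB).
  apply (CR_int_Cscal Ci) in HD.
  assert (HD' : CR_int (fun theta => Ci * G' (log_pt u theta)) (- PI) PI
     (G (log_pt u PI) - G (log_pt u (- PI)))).
  { apply (CR_int_derive (fun theta => G (log_pt u theta))).
    - intros x; apply CC_derive_vline, HG.
    - intros x; apply (CR_derive_cont _ _ (Ci * (Ci * G'' (log_pt u x)))).
      apply CR_derive_Cscal, CC_derive_vline, HG'. }
  rewrite (CR_int_unique _ _ _ _ _ HD HD'); ring.
Qed.

Lemma Cexp_log_pt_PI (x : R) : Cexp (log_pt x PI) = RtoC (- exp x).
Proof. apply Cexp_add_iPI. Qed.

Lemma Cexp_log_pt_neg_PI (x : R) : Cexp (log_pt x (- PI)) = RtoC (- exp x).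
Proof. apply Cexp_sub_iPI. Qed.

(** On both sides of the cut [z = - e^x], and [dz = e^w dw] is the extra factor in [K]. The lower
    side is traced towards the origin, against its ray, whence the minus sign of [B]. *)
Lemma hankel_of_contour (eps : R) (F : C -> C -> C) (K : C -> C) (l : C) : 0 < eps ->
  (forall w, K w = F (Cexp w) w * Cexp w) ->
  (forall x, CR_cont (fun x => K (log_pt x PI)) x) ->
  (forall x, CR_cont (fun x => K (log_pt x (- PI))) x) ->
  is_contour_int (ln eps) K l -> is_hankel_int eps F l.
Proof.
  intros He HK H1 H2 [A [B [D [HA [HB [HD E]]]]]].
  assert (Hlog : forall th y, y < 0 -> Log_arg th (RtoC y) = log_pt (ln (- y)) th).
  { intros th y Hy; unfold Log_arg, log_pt; now rewrite Cmod_R, Rabs_left. }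
  assert (Hpt : forall th y, y < 0 -> Cexp (log_pt (ln (- y)) th) = RtoC (- exp (ln (- y))) ->
     F (RtoC y) (Log_arg th (RtoC y)) =
     @scal R_AbsRing C_R_NormedModule (/ y)%R (K (log_pt (ln (- y)) th))).
  { intros th y Hy Hexp.
    rewrite exp_ln, Ropp_involutive in Hexp by lra.
    rewrite HK, Hlog, Hexp, scal_R_Cmult by auto.
    assert (RtoC y <> 0) by (apply RtoC_neq_0; lra).
    rewrite RtoC_inv by lra.
    match goal with |- ?a = ?b => change (@eq C a b) end.
    field; auto. }
  assert (Hd : forall y, y < 0 -> is_derive (fun y => ln (- y)) y (/ y)%R /\ continuous Rinv y).
  { intros y Hy; split; [auto_derive; [lra|field; lra]|apply continuous_Rinv; lra]. }
  assert (Hinf : filterlim (fun y => ln (- y)) (Rbar_locally m_infty) (Rbar_locally p_infty)).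
  { apply (filterlim_comp _ _ _ Ropp ln _ (Rbar_locally p_infty)); [|apply is_lim_ln_p].
    exact (is_lim_opp (fun x => x) m_infty m_infty (is_lim_id _)). }
  assert (Hpoint : filterlim (fun y => ln (- y)) (at_point (- eps)%R) (at_point (ln eps))).
  { intros P HP; unfold filtermap, at_point in *; now rewrite Ropp_involutive. }
  assert (Hconv : convex_pred (fun y => y < 0)) by (intros x y z; lra).
  assert (Hm : Rbar_locally m_infty (fun y => y < 0)) by now exists 0%R.
  assert (Hp : @at_point R_UniformSpace (- eps)%R (fun y => y < 0)) by (unfold at_point; lra).
  exists (- B), (Ci * D), A; repeat split.
  - apply (@is_RInt_gen_subst C_R_CompleteNormedModule (fun y => y < 0)
      (Rbar_locally m_infty) (at_point (- eps)%R) (Rbar_locally p_infty) (at_point (ln eps)) _ _ _ _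
      (fun x => K (log_pt x (- PI))) _ (fun y => ln (- y)) Rinv); auto.
    + intros y Hy; apply Hpt; auto; apply Cexp_log_pt_neg_PI.
    + exact (is_RInt_gen_swap (V := C_R_NormedModule) _ _ HB).
  - apply (CR_int_Cscal Ci) in HD.
    revert HD; apply (is_RInt_ext (V := C_R_NormedModule)); intros theta _.
    assert (Ec : circle_pt eps theta = Cexp (log_pt (ln eps) theta)).
    { unfold circle_pt, log_pt; now rewrite Cexp_plus, Cexp_RtoC, exp_ln. }
    assert (El : Log_arg theta (circle_pt eps theta) = log_pt (ln eps) theta).
    { unfold Log_arg; rewrite Ec, Cmod_Cexp, Re_log_pt, ln_exp; reflexivity. }
    rewrite El, Ec, HK.
    match goal with |- ?a = ?b => change (@eq C a b) end; ring.
  - apply (@is_RInt_gen_subst C_R_CompleteNormedModule (fun y => y < 0)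
      (at_point (- eps)%R) (Rbar_locally m_infty) (at_point (ln eps)) (Rbar_locally p_infty) _ _ _ _
      (fun x => K (log_pt x PI)) _ (fun y => ln (- y)) Rinv); auto.
    intros y Hy; apply Hpt; auto; apply Cexp_log_pt_PI.
  - rewrite E; ring.
Qed.

(** * The Hankel integral of a power *)

(** The form [z^(-s) e^z dz] at [z = e^w]; the middle summand [w] comes from [dz]. *)
Definition hankel_kernel (s w : C) : C := Cexp (- s * w + w + Cexp w).

Lemma CC_derive_scal_id (a w : C) : CC_derive (fun w => a * w) w a.
Proof.
  eapply CC_derive_val; [apply CC_derive_mult; [apply CC_derive_const|apply CC_derive_id]|simpl; ring].
Qed.

Lemma CC_derive_hankel_kernel (s w : C) :
  CC_derive (hankel_kernel s) w ((- s + 1 + Cexp w) * hankel_kernel s w).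
Proof.
  apply (CC_derive_exp_comp (fun w => - s * w + w + Cexp w)), CC_derive_plus; [|apply CC_derive_exp].
  apply CC_derive_plus; [apply CC_derive_scal_id|apply CC_derive_id].
Qed.

Lemma hankel_kernel_succ (s w : C) : hankel_kernel s w = Cexp w * hankel_kernel (s + 1) w.
Proof. unfold hankel_kernel; rewrite <- Cexp_plus; f_equal; ring. Qed.

Lemma Cmod_log_pt_le (x theta : R) : Cmod (log_pt x theta) <= Rabs x + Rabs theta.
Proof.
  unfold log_pt; eapply Rle_trans; [apply Cmod_triangle|].
  rewrite Cmod_mult, Cmod_Ci, !Cmod_R; lra.
Qed.

Lemma Cmod_exp_mul_le (c w : C) : Cmod (Cexp (c * w)) <= exp (Cmod c * Cmod w).
Proof.
  rewrite Cmod_Cexp, <- Cmod_mult; apply exp_le.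
  eapply Rle_trans; [apply Rle_abs|apply re_le_Cmod].
Qed.

(** On the rays [|w| <= |x| + PI] and [e^w = - e^x], so this is what beats every exponential in
    [|w|]. For [x >= u], [|x| <= x + 2 |u|] turns the bound into an exponential in [x]. *)
Lemma exp_ray_bound (c u : R) : 0 <= c -> exists M : R, forall x : R, u <= x ->
  exp (c * (Rabs x + PI) - exp x) <= M * exp (- x).
Proof.
  intros Hc.
  exists (exp (c * PI + 2 * (c * Rabs u)) * exp ((c + 1) * ln (c + 1) - (c + 1)))%R; intros x Hx.
  assert (H := exp_mul_sub_exp_le (c + 1) x ltac:(lra)).
  apply Rle_trans with (exp (c * PI + 2 * (c * Rabs u)) * exp ((c + 1) * x - exp x) * exp (- x))%R.
  - rewrite <- !exp_plus; apply exp_le.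
    assert (Rabs x <= x + 2 * Rabs u).
    { unfold Rabs; destruct (Rcase_abs x), (Rcase_abs u); lra. }
    nra.
  - apply Rmult_le_compat_r; [left; apply exp_pos|].
    apply Rmult_le_compat_l; [left; apply exp_pos|auto].
Qed.

Lemma ray_decay_weight (G : C -> C) (s : C) (M c u : R) : 0 <= c -> 0 <= M ->
  (forall w, Cmod (G w) <= M * exp (c * Cmod w)) -> ray_decay u (fun w => G w * hankel_kernel s w).
Proof.
  intros Hc HM HG.
  assert (Hs := Cmod_ge_0 (1 - s)).
  destruct (exp_ray_bound (c + Cmod (1 - s)) u ltac:(lra)) as [M' HM'].
  assert (H : forall th x, u <= x -> Rabs th = PI -> Cexp (log_pt x th) = RtoC (- exp x) ->
     Cmod (G (log_pt x th) * hankel_kernel s (log_pt x th)) <= M * M' * exp (- x)).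
  { intros th x Hx Hth Hexp; unfold hankel_kernel; rewrite Hexp.
    replace (- s * log_pt x th + log_pt x th) with ((1 - s) * log_pt x th) by ring.
    rewrite Cmod_mult, Cexp_plus, Cmod_mult, Cexp_RtoC, Cmod_R, Rabs_pos_eq by (left; apply exp_pos).
    assert (B1 := HG (log_pt x th)); assert (B2 := Cmod_exp_mul_le (1 - s) (log_pt x th)).
    assert (B3 := Cmod_log_pt_le x th); rewrite Hth in B3.
    apply Rle_trans with (M * exp (c * Cmod (log_pt x th)) *
       (exp (Cmod (1 - s) * Cmod (log_pt x th)) * exp (- exp x)))%R.
    - apply Rmult_le_compat; auto; [apply Cmod_ge_0| |].
      + apply Rmult_le_pos; [apply Cmod_ge_0|left; apply exp_pos].
      + apply Rmult_le_compat_r; auto; left; apply exp_pos.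
    - rewrite !Rmult_assoc; apply Rmult_le_compat_l; auto.
      eapply Rle_trans; [|apply (HM' x Hx)].
      rewrite <- !exp_plus; apply exp_le; nra. }
  exists (M * M')%R; intros x Hx; split; apply H; auto.
  - apply Rabs_pos_eq; generalize PI_RGT_0; lra.
  - apply Cexp_log_pt_PI.
  - rewrite Rabs_Ropp; apply Rabs_pos_eq; generalize PI_RGT_0; lra.
  - apply Cexp_log_pt_neg_PI.
Qed.

Lemma ray_decay_ext (u : R) (K L : C -> C) :
  (forall w, K w = L w) -> ray_decay u K -> ray_decay u L.
Proof. intros H [M HM]; exists M; intros x Hx; rewrite <- !H; auto. Qed.

Lemma tame_hankel_kernel (s : C) : tame (hankel_kernel s).
Proof.
  split.
  - eexists; eexists; split; [apply CC_derive_hankel_kernel|].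
    intros w; apply CC_derive_mult; [|apply CC_derive_hankel_kernel].
    apply CC_derive_plus; [apply CC_derive_const|apply CC_derive_exp].
  - intros u; apply (ray_decay_ext u (fun w => 1 * hankel_kernel s w)); [intros; ring|].
    apply (ray_decay_weight (fun _ => 1) s 1 0); try lra.
    intros w; rewrite Cmod_1, Rmult_0_l, exp_0; lra.
Qed.

Lemma CC_derive_id_mul (G : C -> C) (w l : C) :
  CC_derive G w l -> CC_derive (fun w => w * G w) w (G w + w * l).
Proof.
  intros H; eapply CC_derive_val; [apply CC_derive_mult; [apply CC_derive_id|exact H]|simpl; ring].
Qed.

Lemma tame_id_hankel_kernel (s : C) : tame (fun w => w * hankel_kernel s w).
Proof.
  split.
  - eexists; eexists; split; intros w; [apply CC_derive_id_mul, CC_derive_hankel_kernel|].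
    apply CC_derive_plus; [apply CC_derive_hankel_kernel|].
    apply CC_derive_id_mul, CC_derive_mult; [|apply CC_derive_hankel_kernel].
    apply CC_derive_plus; [apply CC_derive_const|apply CC_derive_exp].
  - intros u; apply (ray_decay_weight (fun w => w) s 1 1); try lra.
    intros w; rewrite !Rmult_1_l; generalize (exp_ineq1_le (Cmod w)); lra.
Qed.

Definition hankel_int (s : C) : C := contour_int (hankel_kernel s).
Definition hankel_log_int (s : C) : C := contour_int (fun w => w * hankel_kernel s w).

Lemma hankel_int_correct (s : C) (u : R) : is_contour_int u (hankel_kernel s) (hankel_int s).
Proof. apply contour_int_correct, tame_hankel_kernel. Qed.

Lemma hankel_log_int_correct (s : C) (u : R) :
  is_contour_int u (fun w => w * hankel_kernel s w) (hankel_log_int s).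
Proof. apply contour_int_correct, tame_id_hankel_kernel. Qed.

(** The derivative of [hankel_kernel (s + 1)] is [hankel_kernel s - s hankel_kernel (s + 1)]. *)
Lemma hankel_int_succ (s : C) : hankel_int s = s * hankel_int (s + 1).
Proof.
  assert (H := contour_plus 0 _ _ _ _ (hankel_int_correct s 0)
    (contour_Cscal 0 (- s) _ _ (hankel_int_correct (s + 1) 0))).
  apply (contour_ext 0 _ (fun w => (- (s + 1) + 1 + Cexp w) * hankel_kernel (s + 1) w)) in H.
  2: { intros w; rewrite (hankel_kernel_succ s w); ring. }
  eapply contour_antiderivative in H; [|apply CC_derive_hankel_kernel| |apply tame_hankel_kernel].
  - replace (hankel_int s) with
      (hankel_int s + - s * hankel_int (s + 1) + s * hankel_int (s + 1)) by ring.
    rewrite H; ring.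
  - intros w; apply CC_derive_mult; [|apply CC_derive_hankel_kernel].
    apply CC_derive_plus; [apply CC_derive_const|apply CC_derive_exp].
Qed.

(** The same with [w hankel_kernel (s + 1)], whose derivative has the extra term
    [hankel_kernel (s + 1)]. *)
Lemma hankel_log_int_succ (s : C) :
  hankel_log_int s = s * hankel_log_int (s + 1) - hankel_int (s + 1).
Proof.
  assert (H := contour_plus 0 _ _ _ _ (contour_plus 0 _ _ _ _ (hankel_log_int_correct s 0)
    (contour_Cscal 0 (- s) _ _ (hankel_log_int_correct (s + 1) 0))) (hankel_int_correct (s + 1) 0)).
  apply (contour_ext 0 _ (fun w => hankel_kernel (s + 1) w
     + w * ((- (s + 1) + 1 + Cexp w) * hankel_kernel (s + 1) w))) in H.
  2: { intros w; rewrite (hankel_kernel_succ s w); ring. }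
  eapply (contour_antiderivative (fun w => w * hankel_kernel (s + 1) w)) in H;
    [| | |apply tame_id_hankel_kernel].
  - replace (hankel_log_int s) with
      (hankel_log_int s + - s * hankel_log_int (s + 1) + hankel_int (s + 1)
       + (s * hankel_log_int (s + 1) - hankel_int (s + 1))) by ring.
    rewrite H; ring.
  - intros w; apply CC_derive_id_mul, CC_derive_hankel_kernel.
  - intros w; apply CC_derive_plus; [apply CC_derive_hankel_kernel|].
    apply CC_derive_id_mul, CC_derive_mult; [|apply CC_derive_hankel_kernel].
    apply CC_derive_plus; [apply CC_derive_const|apply CC_derive_exp].
Qed.

Definition two_pi_i : C := 2 * PI * Ci.

Lemma two_pi_i_neq_0 : two_pi_i <> 0.
Proof.
  unfold two_pi_i; repeat apply Cmult_neq_0; try apply Ci_nz; apply RtoC_neq_0;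
  generalize PI_RGT_0; lra.
Qed.

Lemma CR_int_const (c : C) (a b : R) : CR_int (fun _ => c) a b (RtoC (b - a) * c).
Proof.
  rewrite <- scal_R_Cmult; apply (is_RInt_const (V := C_R_NormedModule)).
Qed.

Lemma Cmod_int_const_le (f : R -> C) (a b M : R) (l : C) : a <= b ->
  (forall x, a <= x <= b -> Cmod (f x) <= M) -> CR_int f a b l -> Cmod l <= (b - a) * M.
Proof.
  intros Hab H Hf; apply (Cmod_int_le f (fun _ => M) a b l _ Hab H Hf).
  apply (is_RInt_const (V := R_NormedModule)).
Qed.

(* The two rays cancel and the circle shrinks to a point. *)
Lemma hankel_int_1 : hankel_int 1 = two_pi_i.
Proof.
  apply Ceq_minus, Cmod_eq_0, Rle_antisym; [|apply Cmod_ge_0].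
  assert (HPI := PI_RGT_0).
  apply le_epsilon; intros eps He; rewrite Rplus_0_l.
  (* The circle of radius [r <= 1] contributes an error of at most [2 PI r e]. *)
  assert (Hd : 0 < Rmin 1 (eps / (2 * PI * exp 1))).
  { apply Rmin_glb_lt; [lra|]; apply Rdiv_lt_0_compat; auto.
    generalize (exp_pos 1); nra. }
  set (r := Rmin 1 (eps / (2 * PI * exp 1))) in *.
  assert (K1 : forall w, hankel_kernel 1 w = Cexp (Cexp w)).
  { intros w; unfold hankel_kernel; f_equal; ring. }
  destruct (hankel_int_correct 1 (ln r)) as [A [B [D [HA [HB [HD E]]]]]].
  assert (EAB : A = B).
  { apply (CR_int_gen_unique _ _ _ _ _ HA).
    revert HB; apply CR_int_gen_ext; try apply _; intros x.
    now rewrite !K1, Cexp_log_pt_PI, Cexp_log_pt_neg_PI. }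
  assert (HD' : CR_int (fun theta => hankel_kernel 1 (log_pt (ln r) theta) - 1) (- PI) PI
     (D - RtoC (PI - - PI) * 1)).
  { exact (is_RInt_minus (V := C_R_NormedModule) _ _ _ _ _ _ HD (CR_int_const 1 (- PI) PI)). }
  apply (Cmod_int_const_le _ _ _ (r * exp 1)) in HD'.
  - replace (hankel_int 1 - two_pi_i) with (Ci * (D - RtoC (PI - - PI) * 1)).
    + rewrite Cmod_mult, Cmod_Ci, Rmult_1_l.
      eapply Rle_trans; [exact HD'|].
      apply Rle_trans with ((PI - - PI) * (eps / (2 * PI * exp 1) * exp 1))%R.
      * apply Rmult_le_compat_l; [lra|]; apply Rmult_le_compat_r; [left; apply exp_pos|apply Rmin_r].
      * right; field; generalize (exp_pos 1); lra.
    + rewrite E, EAB; unfold two_pi_i.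
      replace (PI - - PI)%R with (2 * PI)%R by ring; rewrite RtoC_mult; ring.
  - lra.
  - intros theta _; rewrite K1.
    eapply Rle_trans; [apply Cmod_exp_sub_1_small|].
    rewrite Cmod_Cexp, Re_log_pt, exp_ln by auto.
    apply Rmult_le_compat_l; [lra|]; apply exp_le, Rmin_l.
Qed.

Lemma hankel_int_INR (p : nat) : hankel_int (RtoC (INR (S p))) * RtoC (INR (fact p)) = two_pi_i.
Proof.
  induction p as [|p IH]; [change (INR 1) with 1%R; rewrite hankel_int_1; simpl; ring|].
  rewrite <- IH, (hankel_int_succ (RtoC (INR (S p)))), <- RtoC_plus, <- (S_INR (S p)).
  rewrite fact_simpl, mult_INR, RtoC_mult; ring.
Qed.

(** * Concentration of the Hankel integral on the circle [|z| = n] *)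

(** [cos theta = 1 - 2 sin^2 (theta / 2)]. For [0 <= a <= 2] the bound [sin a >= a - a^3 / 6] gives
    [sin a >= a / 3], whence the constant 18. *)
Lemma cos_le_quadratic (theta : R) : Rabs theta <= PI -> cos theta <= 1 - theta * theta / 18.
Proof.
  intros Ht.
  set (a := (Rabs theta / 2)%R).
  assert (Ha : 0 <= a <= 2).
  { unfold a; generalize (Rabs_pos theta) PI_4; lra. }
  assert (HaPI : a <= PI) by (unfold a; generalize (Rabs_pos theta); lra).
  destruct (sin_bound a 0 (proj1 Ha) HaPI) as [Hs _].
  unfold sin_approx, sin_term in Hs; simpl in Hs.
  assert (Hs' : a / 3 <= sin a).
  { eapply Rle_trans; [|exact Hs].
    field_simplify; nra. }
  assert (E : cos theta = (1 - 2 * (sin a * sin a))%R).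
  { replace (cos theta) with (cos (2 * a)).
    - rewrite cos_2a_sin; ring.
    - unfold a; replace (2 * (Rabs theta / 2))%R with (Rabs theta) by field.
      unfold Rabs; destruct Rcase_abs; [apply cos_neg|reflexivity]. }
  rewrite E.
  assert (E2 : (theta * theta = 4 * (a * a))%R).
  { unfold a; replace (theta * theta)%R with (Rabs theta * Rabs theta)%R; [field|].
    rewrite <- Rabs_mult, Rabs_pos_eq; [reflexivity|nra]. }
  rewrite E2; nra.
Qed.

(** The factor [|x|] makes the Gaussian integral elementary, with one antiderivative for each sign
    of [x]. *)
Lemma is_RInt_abs_gauss (a b : R) : 0 < a -> 0 <= b ->
  is_RInt (fun x => Rabs x * exp (- a * (x * x)))%R (- b) b ((1 - exp (- a * (b * b))) / a)%R.
Proof.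
  intros Ha Hb.
  assert (I1 : is_RInt (fun x => Rabs x * exp (- a * (x * x)))%R (- b) 0 ((1 - exp (- a * (b * b))) / (2 * a))%R).
  { apply is_RInt_ext with (fun x => - x * exp (- a * (x * x)))%R.
    - intros x; rewrite Rmin_left, Rmax_right by lra; intros Hx.
      rewrite Rabs_left by lra; reflexivity.
    - replace ((1 - exp (- a * (b * b))) / (2 * a))%R
        with (minus (exp (- a * (0 * 0)) / (2 * a)) (exp (- a * (- b * - b)) / (2 * a)))%R.
      + apply (is_RInt_derive (V := R_CompleteNormedModule) (fun x => exp (- a * (x * x)) / (2 * a))%R).
        * intros x _; auto_derive; auto; field; lra.
        * intros x _; cont_derive.
      + replace (- a * (0 * 0))%R with 0%R by ring; rewrite exp_0.
        replace (- b * - b)%R with (b * b)%R by ring.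
        unfold minus, plus, opp; simpl; field; lra. }
  assert (I2 : is_RInt (fun x => Rabs x * exp (- a * (x * x)))%R 0 b ((1 - exp (- a * (b * b))) / (2 * a))%R).
  { apply is_RInt_ext with (fun x => x * exp (- a * (x * x)))%R.
    - intros x; rewrite Rmin_left, Rmax_right by lra; intros Hx.
      rewrite Rabs_pos_eq by lra; reflexivity.
    - replace ((1 - exp (- a * (b * b))) / (2 * a))%R
        with (minus (- (exp (- a * (b * b)) / (2 * a))) (- (exp (- a * (0 * 0)) / (2 * a))))%R.
      + apply (is_RInt_derive (V := R_CompleteNormedModule) (fun x => - (exp (- a * (x * x)) / (2 * a)))%R).
        * intros x _; auto_derive; auto; field; lra.
        * intros x _; cont_derive.
      + replace (- a * (0 * 0))%R with 0%R by ring; rewrite exp_0.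
        unfold minus, plus, opp; simpl; field; lra. }
  replace ((1 - exp (- a * (b * b))) / a)%R
    with (plus ((1 - exp (- a * (b * b))) / (2 * a)) ((1 - exp (- a * (b * b))) / (2 * a)))%R
    by (unfold plus; simpl; field; lra).
  exact (is_RInt_Chasles _ _ _ _ _ _ I1 I2).
Qed.

(** On [|z| = n], with [L = ln n], the kernel has modulus [e^(L - n L + n cos theta)], at most a
    Gaussian in [theta]; the factor [n = e^L] is cancelled by the [18 / n] of the Gaussian integral.
    On the rays [cos theta = -1], and their share obeys the same bound with room to spare. *)
Lemma contour_weight_bound (M c : R) : 0 <= M -> 0 <= c -> exists Cst : R, 0 <= Cst /\
  forall n : nat, (1 <= n)%nat -> c + 3 <= 2 * INR n -> forall (F : C -> C) (l : C),
  (forall v, Cmod (F v) <= M * (Cmod v * exp (c * Cmod v))) ->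
  is_contour_int (ln (INR n))
    (fun w => F (w - RtoC (ln (INR n))) * hankel_kernel (RtoC (INR n)) w) l ->
  Cmod l <= Cst * exp (INR n - INR n * ln (INR n)).
Proof.
  intros HM Hc; assert (HPI := PI_RGT_0).
  exists (2 * (M * exp ((c + 1) * PI)) + 18 * (M * exp (c * PI)))%R; split.
  { generalize (exp_pos ((c + 1) * PI)) (exp_pos (c * PI)); intros; nra. }
  intros n Hn Hcn F l HF [A [B [D [HA [HB [HD ->]]]]]].
  set (L := ln (INR n)) in *; set (r := INR n) in *.
  assert (Hr : 1 <= r) by (unfold r; apply (le_INR 1); auto).
  assert (EL : exp L = r) by (unfold L; apply exp_ln; fold r; lra).
  assert (HLr : L <= r) by (generalize (exp_ineq1_le L); lra).
  assert (Hsub : forall x th, log_pt x th - RtoC L = log_pt (x - L) th).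
  { intros; unfold log_pt; rewrite RtoC_minus; ring. }
  assert (Hker : forall x th, Cmod (hankel_kernel (RtoC r) (log_pt x th)) =
     exp (- r * x + x + exp x * cos th)).
  { intros x th; unfold hankel_kernel; rewrite Cmod_Cexp; f_equal.
    unfold log_pt, Cexp, Re, Im; simpl.
    replace (x + (0 * th - 1 * 0))%R with x by ring.
    replace (0 + (0 * 0 + 1 * th))%R with th by ring. ring. }
  assert (Hray : forall th X, Rabs th = PI -> cos th = (-1)%R ->
     CR_int_gen (fun x => F (log_pt x th - RtoC L) * hankel_kernel (RtoC r) (log_pt x th))
        (at_point L) (Rbar_locally p_infty) X ->
     Cmod X <= M * exp ((c + 1) * PI) * exp (r - r * L)).
  { intros th X Hth Hcos HX.
    apply (Cmod_ray_int_le _ L (M * exp ((c + 1) * PI + (1 - r) * L - r + L))) in HX.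
    - eapply Rle_trans; [exact HX|].
      rewrite !Rmult_assoc, <- !exp_plus; apply Rmult_le_compat_l; auto; apply exp_le; lra.
    - intros x Hx; rewrite Cmod_mult, Hker, Hcos, Hsub.
      set (y := (x - L)%R); assert (Hy : 0 <= y) by (unfold y; lra).
      assert (B1 := HF (log_pt y th)).
      assert (B2 := Cmod_log_pt_le y th); rewrite Hth, (Rabs_pos_eq y Hy) in B2.
      assert (B3 : Cmod (F (log_pt y th)) <= M * exp ((c + 1) * (y + PI))).
      { eapply Rle_trans; [exact B1|]; apply Rmult_le_compat_l; auto.
        assert (Hp := Cmod_ge_0 (log_pt y th)).
        apply Rle_trans with (exp (Cmod (log_pt y th)) * exp (c * Cmod (log_pt y th)))%R.
        - apply Rmult_le_compat_r; [left; apply exp_pos|].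
          generalize (exp_ineq1_le (Cmod (log_pt y th))); lra.
        - rewrite <- exp_plus; apply exp_le; nra. }
      eapply Rle_trans; [apply Rmult_le_compat_r; [left; apply exp_pos|exact B3]|].
      rewrite !Rmult_assoc, <- !exp_plus; apply Rmult_le_compat_l; auto; apply exp_le.
      (* With [x = L + y] and [e^y >= 1 + y], the growth of [F] and the wanted decay [e^(- x)]
         together reduce to [(c + 3 - 2 n) y <= 0]. *)
      assert (Ex : exp x = (r * exp y)%R).
      { rewrite <- EL, <- exp_plus; f_equal; unfold y; ring. }
      rewrite Ex; assert (Ey := exp_ineq1_le y).
      replace x with (L + y)%R by (unfold y; ring).
      nra. }
  assert (BA := Hray PI A (Rabs_pos_eq _ (Rlt_le _ _ HPI)) cos_PI HA).
  assert (BB := Hray (- PI)%R B ltac:(rewrite Rabs_Ropp; apply Rabs_pos_eq; lra)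
     ltac:(rewrite cos_neg; apply cos_PI) HB).
  assert (BD : Cmod D <= 18 * (M * exp (c * PI)) * exp (r - r * L)).
  { assert (IG := is_RInt_abs_gauss (r / 18) PI ltac:(lra) ltac:(lra)).
    apply (is_RInt_scal (V := R_NormedModule) _ _ _ (M * exp (c * PI) * exp (L - r * L + r))%R) in IG.
    assert (HPI2 : - PI <= PI) by lra.
    eapply Rle_trans; [apply (fun H => Cmod_int_le _ _ _ _ _ _ HPI2 H HD IG)|].
    - intros th Hth; rewrite Cmod_mult, Hker, Hsub, EL.
      replace (L - L)%R with 0%R by ring.
      assert (Ht : Rabs th <= PI) by (apply Rabs_le; lra).
      assert (B1 := HF (log_pt 0 th)); assert (B2 := cos_le_quadratic th Ht).
      assert (E0 : Cmod (log_pt 0 th) = Rabs th).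
      { unfold log_pt; rewrite Cplus_0_l, Cmod_mult, Cmod_Ci, Cmod_R; ring. }
      rewrite E0 in B1.
      change (Cmod (F (log_pt 0 th)) * exp (- r * L + L + r * cos th) <=
        M * exp (c * PI) * exp (L - r * L + r) * (Rabs th * exp (- (r / 18) * (th * th)))).
      apply Rle_trans with ((M * (Rabs th * exp (c * PI))) *
         exp (L - r * L + r + - (r / 18) * (th * th)))%R.
      + apply Rmult_le_compat; [apply Cmod_ge_0|left; apply exp_pos| |].
        * eapply Rle_trans; [exact B1|]; apply Rmult_le_compat_l; auto.
          apply Rmult_le_compat_l; [apply Rabs_pos|]; apply exp_le; nra.
        * apply exp_le; nra.
      + right; rewrite exp_plus; ring.
    - change (M * exp (c * PI) * exp (L - r * L + r) * ((1 - exp (- (r / 18) * (PI * PI))) / (r / 18))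
        <= 18 * (M * exp (c * PI)) * exp (r - r * L)).
      replace (L - r * L + r)%R with (L + (r - r * L))%R by ring.
      rewrite exp_plus, EL.
      replace (M * exp (c * PI) * (r * exp (r - r * L)) * ((1 - exp (- (r / 18) * (PI * PI))) / (r / 18)))%R
        with (18 * (M * exp (c * PI)) * exp (r - r * L) * (1 - exp (- (r / 18) * (PI * PI))))%R
        by (field; lra).
      rewrite <- (Rmult_1_r (18 * (M * exp (c * PI)) * exp (r - r * L))) at 2.
      apply Rmult_le_compat_l.
      + repeat apply Rmult_le_pos; try lra; left; apply exp_pos.
      + generalize (exp_pos (- (r / 18) * (PI * PI))); lra. }
  eapply Rle_trans; [apply Cmod_triangle|].
  rewrite Cmod_mult, Cmod_Ci, Rmult_1_l.
  assert (T : Cmod (A - B) <= Cmod A + Cmod B).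
  { rewrite <- (Cmod_opp B); apply Cmod_triangle. }
  lra.
Qed.

(** * A one-sided Stirling bound *)

(** [(2 + t) / (2 - t)] is the first diagonal Pade approximant of the exponential. The difference of
    the two sides has derivative [(1 - t) e^t - 1], nonpositive because [1 - t <= e^(- t)]. *)
Lemma exp_le_pade (t : R) : 0 <= t <= 1 -> (2 - t) * exp t <= 2 + t.
Proof.
  intros Ht.
  destruct (MVT_gen (fun t => (2 - t) * exp t - (2 + t))%R 0 t (fun t => (1 - t) * exp t - 1)%R)
    as [c [Hc E]].
  - intros x _; auto_derive; auto; ring.
  - intros x _; apply continuity_pt_filterlim.
    apply (ex_derive_continuous (V := R_NormedModule) (fun t => (2 - t) * exp t - (2 + t))%R);
    auto_derive; auto.
  - rewrite Rmin_left, Rmax_right in Hc by lra.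
    assert (H := exp_ineq1_le (- c)); rewrite exp_Ropp in H.
    assert (Hp := exp_pos c).
    assert ((1 - c) * exp c <= 1).
    { apply (Rmult_le_compat_r (exp c)) in H; [|lra].
      rewrite Rinv_l in H by lra; lra. }
    rewrite exp_0 in E; nra.
Qed.

(** The point [t = 2 / (2 x + 1)] turns the Pade quotient into [(x + 1) / x]. The factor [2 x + 1]
    is the one required by the monotonicity in [stirling_ratio_sqr_le]. *)
Lemma ln_succ_sub_ge (x : R) : 1 <= x -> 2 <= (2 * x + 1) * (ln (x + 1) - ln x).
Proof.
  intros Hx.
  set (t := (2 / (2 * x + 1))%R).
  assert (Ht : 0 <= t <= 1).
  { unfold t; split; [left; apply Rdiv_lt_0_compat; lra|].
    apply Rle_div_l; lra. }
  assert (H := exp_le_pade t Ht).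
  assert (H2 : exp t <= (x + 1) / x).
  { replace ((x + 1) / x)%R with ((2 + t) / (2 - t))%R by (unfold t; field; lra).
    apply Rle_div_r; lra. }
  assert (H3 : t <= ln (x + 1) - ln x).
  { rewrite <- ln_div by lra; rewrite <- (ln_exp t); apply ln_le; auto; apply exp_pos. }
  apply Rle_trans with ((2 * x + 1) * t)%R.
  - right; unfold t; field; lra.
  - apply Rmult_le_compat_l; lra.
Qed.

(** [(n-1)! e^n / n^n]: the normalisation [(n-1)!] times the bound of [contour_weight_bound]. By
    Stirling its true order is [n^(-1/2)]. *)
Definition stirling_ratio (n : nat) : R :=
  (INR (fact (n - 1)) * exp (INR n - INR n * ln (INR n)))%R.

(** The left side is nonincreasing in [n] and equals [e^2] at [n = 1]; in logarithms the step from
    [n] to [n + 1] is [ln_succ_sub_ge]. *)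
Lemma stirling_ratio_sqr_le (n : nat) : (1 <= n)%nat ->
  stirling_ratio n * stirling_ratio n * INR n <= exp 2.
Proof.
  unfold stirling_ratio; induction 1 as [|n Hn IH].
  - simpl; rewrite ln_1; right.
    replace (1 - 1 * 0)%R with 1%R by ring; rewrite Rmult_1_l, Rmult_1_r, <- exp_plus; f_equal; ring.
  - eapply Rle_trans; [|exact IH].
    replace (S n - 1)%nat with (S (n - 1)) by lia.
    rewrite fact_simpl, mult_INR; replace (S (n - 1)) with n by lia.
    rewrite S_INR.
    assert (Hr : 1 <= INR n) by (apply (le_INR 1); auto).
    set (r := INR n) in *; set (f := INR (fact (n - 1))).
    assert (H := ln_succ_sub_ge r Hr).
    set (a := ln r) in *; set (b := ln (r + 1)) in *.
    assert (Ea : exp a = r) by (apply exp_ln; lra).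
    assert (Eb : exp b = (r + 1)%R) by (apply exp_ln; lra).
    replace (r * f * exp (r + 1 - (r + 1) * b) * (r * f * exp (r + 1 - (r + 1) * b)) * (r + 1))%R
      with (f * f * r * (r * (r + 1) * (exp (r + 1 - (r + 1) * b) * exp (r + 1 - (r + 1) * b))))%R by ring.
    replace (f * exp (r - r * a) * (f * exp (r - r * a)) * r)%R
      with (f * f * r * (exp (r - r * a) * exp (r - r * a)))%R by ring.
    apply Rmult_le_compat_l; [nra|].
    rewrite <- Ea at 1; rewrite <- Eb, <- !exp_plus.
    apply exp_le; nra.
Qed.

Lemma stirling_ratio_small (eps : R) : 0 < eps -> exists N : nat, forall n : nat, (N <= n)%nat ->
  stirling_ratio n <= eps.
Proof.
  intros He.
  destruct (INR_unbounded (exp 2 / (eps * eps))) as [N HN].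
  exists (N + 1)%nat; intros n Hn.
  assert (H := stirling_ratio_sqr_le n ltac:(lia)).
  apply Rnot_lt_le; intros Hlt.
  assert (HNn : INR N <= INR n) by (apply le_INR; lia).
  assert (H1 : exp 2 < INR n * (eps * eps)).
  { apply Rlt_div_l; [nra|lra]. }
  assert (eps * eps <= stirling_ratio n * stirling_ratio n) by nra.
  assert (0 < INR n) by (apply lt_0_INR; lia).
  nra.
Qed.

Lemma contour_weight_small (M c eps : R) : 0 <= M -> 0 <= c -> 0 < eps ->
  exists N : nat, forall n : nat, (N <= n)%nat -> forall (F : C -> C) (l : C),
  (forall v, Cmod (F v) <= M * (Cmod v * exp (c * Cmod v))) ->
  is_contour_int (ln (INR n))
    (fun w => F (w - RtoC (ln (INR n))) * hankel_kernel (RtoC (INR n)) w) l ->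
  Cmod (RtoC (INR (fact (n - 1))) * l) <= eps.
Proof.
  intros HM Hc He.
  destruct (contour_weight_bound M c HM Hc) as [K [HK HB]].
  destruct (stirling_ratio_small (eps / (K + 1))) as [N HN]; [apply Rdiv_lt_0_compat; lra|].
  destruct (INR_unbounded (c + 3)) as [N2 HN2].
  exists (N + N2 + 1)%nat; intros n Hn F l HF HI.
  assert (H2 : INR N2 <= INR n) by (apply le_INR; lia).
  specialize (HB n ltac:(lia) ltac:(generalize (pos_INR N2); lra) F l HF HI).
  specialize (HN n ltac:(lia)); unfold stirling_ratio in HN.
  rewrite Cmod_mult, Cmod_R, Rabs_pos_eq by apply pos_INR.
  apply Rle_trans with (INR (fact (n - 1)) * (K * exp (INR n - INR n * ln (INR n))))%R.
  - apply Rmult_le_compat_l; [apply pos_INR|auto].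
  - apply Rle_trans with (K * (eps / (K + 1)))%R; [nra|].
    apply Rle_trans with ((K + 1) * (eps / (K + 1)))%R; [|right; field; lra].
    apply Rmult_le_compat_r; [left; apply Rdiv_lt_0_compat; lra|lra].
Qed.

Lemma hankel_kernel_shift (s : C) (n : nat) (w : C) :
  npow n s * hankel_kernel (s + RtoC (INR n)) w =
  Cexp (- s * (w - RtoC (ln (INR n)))) * hankel_kernel (RtoC (INR n)) w.
Proof. unfold npow, hankel_kernel; rewrite <- !Cexp_plus; f_equal; ring. Qed.

Lemma Cmod_le_eq (a b : C) (r : R) : a = b -> Cmod a <= r -> Cmod b <= r.
Proof. now intros <-. Qed.

(** [two_pi_i] is replaced by its exact expression through [hankel_int n], so the difference carries
    the factor [e^(- s v) - 1] with [v = w - ln n]. *)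
Lemma hankel_int_shift_asymp (s : C) :
  Ctends (fun n => npow n s * RtoC (INR (fact (n - 1))) * hankel_int (s + RtoC (INR n))) two_pi_i.
Proof.
  intros eps He.
  destruct (contour_weight_small (Cmod (- s)) (Cmod (- s)) eps (Cmod_ge_0 _) (Cmod_ge_0 _) He) as [N HN].
  exists (N + 1)%nat; intros n Hn.
  assert (H := contour_plus _ _ _ _ _
    (contour_Cscal (ln (INR n)) (npow n s) _ _ (hankel_int_correct (s + RtoC (INR n)) _))
    (contour_Cscal _ (- (1)) _ _ (hankel_int_correct (RtoC (INR n)) _))).
  apply (contour_ext _ _ (fun w => (fun v => Cexp (- s * v) - 1) (w - RtoC (ln (INR n)))
     * hankel_kernel (RtoC (INR n)) w)) in H.
  2: { intros w; rewrite hankel_kernel_shift; ring. }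
  apply (HN n ltac:(lia) (fun v => Cexp (- s * v) - 1)) in H.
  - assert (E := hankel_int_INR (n - 1)).
    replace (S (n - 1)) with n in E by lia.
    rewrite <- E.
    revert H; apply Cmod_le_eq; ring.
  - intros v; eapply Rle_trans; [apply Cmod_exp_sub_1_small|].
    rewrite Cmod_mult; lra.
Qed.

Lemma hankel_log_int_shift_asymp (s : C) :
  Ctends (fun n => npow n s * RtoC (INR (fact (n - 1))) *
    (hankel_log_int (s + RtoC (INR n)) - RtoC (ln (INR n)) * hankel_int (s + RtoC (INR n)))) 0.
Proof.
  intros eps He.
  destruct (contour_weight_small 1 (Cmod (- s)) eps Rle_0_1 (Cmod_ge_0 _) He) as [N HN].
  exists N; intros n Hn.
  assert (H := contour_Cscal _ (npow n s) _ _ (contour_plus (ln (INR n)) _ _ _ _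
    (hankel_log_int_correct (s + RtoC (INR n)) _)
    (contour_Cscal _ (- RtoC (ln (INR n))) _ _ (hankel_int_correct (s + RtoC (INR n)) _)))).
  apply (contour_ext _ _ (fun w => (fun v => v * Cexp (- s * v)) (w - RtoC (ln (INR n)))
     * hankel_kernel (RtoC (INR n)) w)) in H.
  2: { intros w; rewrite <- Cmult_assoc, <- hankel_kernel_shift; ring. }
  apply (HN n Hn (fun v => v * Cexp (- s * v))) in H.
  - revert H; apply Cmod_le_eq; ring.
  - intros v; rewrite Cmod_mult, Rmult_1_l.
    apply Rmult_le_compat_l; [apply Cmod_ge_0|apply Cmod_exp_mul_le].
Qed.

Lemma Re_pos_neq_0 (s : C) : 0 < Re s -> s <> 0.
Proof. intros Hs E; rewrite E in Hs; simpl in Hs; lra. Qed.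

Lemma plus_INR_S (s : C) (n : nat) : s + RtoC (INR (S n)) = s + RtoC (INR n) + 1.
Proof. rewrite S_INR, RtoC_plus; ring. Qed.

Lemma Ctends_const (c : C) : Ctends (fun _ => c) c.
Proof.
  intros eps He; exists 0%nat; intros n _.
  replace (c - c) with (RtoC 0) by ring; rewrite Cmod_0; lra.
Qed.

(* The left side has period 1, and tends to [two_pi_i] along [s + n]. *)
Lemma CGamma_mul_hankel_int (s : C) : 0 < Re s -> CGamma s * hankel_int s = two_pi_i.
Proof.
  intros Hs.
  assert (Hn : forall n : nat,
    CGamma (s + RtoC (INR n)) * hankel_int (s + RtoC (INR n)) = CGamma s * hankel_int s).
  { induction n as [|n IH]; [simpl; now rewrite Cplus_0_r|].
    rewrite <- IH, plus_INR_S, (hankel_int_succ (s + RtoC (INR n))), CGamma_succ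
      by now apply Re_plus_INR.
    ring. }
  apply (Ctends_unique (fun _ => CGamma s * hankel_int s)); [apply Ctends_const|].
  rewrite <- (Cmult_1_l two_pi_i).
  generalize (Ctends_mult _ _ _ _ (CGamma_shift_asymp s Hs) (hankel_int_shift_asymp s)).
  apply (Ctends_ext 0); intros n _; rewrite <- (Hn n).
  field; split; [apply fact_C_neq_0|apply npow_neq_0].
Qed.

(** A zero of Gamma would make the constant product [two_pi_i] vanish. *)
Lemma CGamma_neq_0 (s : C) : 0 < Re s -> CGamma s <> 0.
Proof.
  intros Hs E; apply two_pi_i_neq_0.
  rewrite <- (CGamma_mul_hankel_int s Hs), E; ring.
Qed.

Lemma digamma_succ (s : C) : 0 < Re s -> digamma (s + 1) = digamma s + / s.
Proof.
  intros Hs.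
  rewrite !digamma_eq, CGamma_succ, dGamma_succ by (rewrite ?Re_succ; lra).
  field; split; [now apply Re_pos_neq_0|now apply CGamma_neq_0].
Qed.

(** Multiplying by the Hankel integral, which is [two_pi_i / Gamma], replaces the division by Gamma,
    so only products of limits occur. *)
Lemma digamma_shift_asymp (s : C) : 0 < Re s ->
  Ctends (fun n => digamma (s + RtoC (INR n)) - RtoC (ln (INR n))) 0.
Proof.
  intros Hs.
  assert (H := Ctends_mult _ _ _ _ (Ctends_const (/ two_pi_i))
    (Ctends_mult _ _ _ _ (dGamma_shift_asymp s Hs) (hankel_int_shift_asymp s))).
  replace (/ two_pi_i * (0 * two_pi_i)) with (RtoC 0) in H by ring.
  revert H; apply (Ctends_ext 0); intros n _.
  assert (Hsn := Re_plus_INR s n Hs).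
  rewrite digamma_eq by auto.
  assert (E := CGamma_mul_hankel_int _ Hsn).
  assert (HG := CGamma_neq_0 _ Hsn); assert (HT := two_pi_i_neq_0).
  replace (hankel_int (s + RtoC (INR n))) with (two_pi_i / CGamma (s + RtoC (INR n)))
    by (rewrite <- E; field; auto).
  field; repeat split; auto; [apply fact_C_neq_0|apply npow_neq_0].
Qed.

(** In the recurrence [Gamma t * H (t + 1)] equals [two_pi_i / t], which matches the step of
    digamma. In the limit both parts are corrected by [ln n], and the corrections cancel because
    [Gamma * H = two_pi_i]. *)
Lemma CGamma_mul_hankel_log_int (s : C) : 0 < Re s ->
  CGamma s * hankel_log_int s = two_pi_i * digamma s.
Proof.
  intros Hs.
  set (d := fun s => CGamma s * hankel_log_int s - two_pi_i * digamma s).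
  assert (Hn : forall n : nat, d (s + RtoC (INR n)) = d s).
  { induction n as [|n IH]; [simpl; now rewrite Cplus_0_r|].
    rewrite <- IH, plus_INR_S; unfold d.
    assert (Hsn := Re_plus_INR s n Hs); set (t := s + RtoC (INR n)) in *.
    assert (Ht := Re_pos_neq_0 t Hsn).
    assert (E := CGamma_mul_hankel_int (t + 1) ltac:(rewrite Re_succ; lra)).
    rewrite CGamma_succ in E by auto.
    rewrite (hankel_log_int_succ t), digamma_succ, CGamma_succ, <- E by auto.
    field; auto. }
  apply Ceq_minus; change (d s = 0).
  apply (Ctends_unique (fun _ => d s)); [apply Ctends_const|].
  assert (H := Ctends_minus _ _ _ _
    (Ctends_mult _ _ _ _ (CGamma_shift_asymp s Hs) (hankel_log_int_shift_asymp s))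
    (Ctends_mult _ _ _ _ (Ctends_const two_pi_i) (digamma_shift_asymp s Hs))).
  replace (1 * 0 - two_pi_i * 0) with (RtoC 0) in H by ring.
  revert H; apply (Ctends_ext 0); intros n _; rewrite <- (Hn n); unfold d.
  rewrite <- (CGamma_mul_hankel_int _ (Re_plus_INR s n Hs)).
  field; split; [apply fact_C_neq_0|apply npow_neq_0].
Qed.

(** * Euler's constant from the growth of digamma *)

Lemma digamma_1_shift (n : nat) :
  digamma (1 + RtoC (INR n)) = digamma 1 + RtoC (sum_n_m (fun k => / INR k)%R 1 n).
Proof.
  induction n as [|n IH].
  - rewrite sum_n_m_zero by lia; simpl; f_equal; change (@zero R_AbelianGroup) with 0%R; ring_simplify.
    now rewrite !Cplus_0_r.
  - rewrite sum_n_Sm by lia.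
    rewrite plus_INR_S, digamma_succ, IH by (apply Re_plus_INR; simpl; lra).
    change (@plus R_AbelianGroup (sum_n_m (fun k => / INR k)%R 1 n) (/ INR (S n))%R)
      with (sum_n_m (fun k => / INR k)%R 1 n + / INR (S n))%R.
    assert (Hn : INR (S n) <> 0%R) by (apply not_0_INR; lia).
    rewrite RtoC_plus, RtoC_inv, S_INR, RtoC_plus by auto.
    rewrite (Cplus_comm (RtoC (INR n)) 1); ring.
Qed.

(** [digamma (1 + n)] is [digamma 1] plus a harmonic sum and differs from [ln n] by a null sequence.
    As a limit of real numbers [digamma 1] is real, which the equality in [C] also demands. *)
Lemma euler_gamma_eq : RtoC euler_gamma = - digamma 1.
Proof.
  set (u := fun n : nat => (sum_n_m (fun k : nat => / INR k)%R 1 n - ln (INR n))%R).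
  assert (H : Ctends (fun n => RtoC (u n)) (- digamma 1)).
  { assert (H := Ctends_minus _ _ _ _ (digamma_shift_asymp 1 ltac:(simpl; lra)) (Ctends_const (digamma 1))).
    replace (0 - digamma 1) with (- digamma 1) in H by ring.
    revert H; apply (Ctends_ext 0); intros n _; unfold u.
    rewrite digamma_1_shift, RtoC_minus; ring. }
  assert (Hre : is_lim_seq u (Re (- digamma 1))).
  { apply is_lim_seq_spec; intros eps.
    assert (He : 0 < eps / 2) by (destruct eps; simpl; lra).
    destruct (H _ He) as [N HN]; exists N; intros n Hn.
    apply Rle_lt_trans with (eps / 2)%R; [|lra].
    eapply Rle_trans; [|apply (HN n Hn)].
    apply (re_le_Cmod (RtoC (u n) - - digamma 1)). }
  assert (Him : Im (- digamma 1) = 0%R).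
  { apply cond_eq; intros eps He; rewrite Rminus_0_r.
    destruct (H (eps / 2)%R ltac:(lra)) as [N HN]; specialize (HN N (Nat.le_refl N)).
    apply Rle_lt_trans with (eps / 2)%R; [|lra].
    eapply Rle_trans; [|exact HN].
    eapply Rle_trans; [|apply Rmax_Cmod].
    eapply Rle_trans; [|apply Rmax_r].
    rewrite <- Rabs_Ropp; right; f_equal; unfold Im; simpl; ring. }
  change euler_gamma with (real (Lim_seq u)); rewrite (is_lim_seq_unique _ _ Hre).
  apply injective_projections; simpl; [reflexivity|symmetry; exact Him].
Qed.

(** * The second and third formulas *)

Lemma hankel_of_tame (eps : R) (F : C -> C -> C) (K : C -> C) : 0 < eps ->
  (forall w, K w = F (Cexp w) w * Cexp w) -> tame K -> is_hankel_int eps F (contour_int K).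
Proof.
  intros He HK HT; apply (hankel_of_contour eps F K); auto.
  - intros x; destruct HT as [[K' [K'' [H1 H2]]] _].
    apply (holo_left_cont_h (x + 1) K K'); [|lra]; intros w _; apply H1.
  - intros x; destruct HT as [[K' [K'' [H1 H2]]] _].
    apply (holo_left_cont_h (x + 1) K K'); [|lra]; intros w _; apply H1.
  - now apply contour_int_correct.
Qed.

Lemma digamma_hankel_power (eps : R) (s : C) : 0 < eps -> 0 < Re s -> exists I : C,
  is_hankel_int eps (fun z Log_z => Cexp (- s * Log_z) * Cexp z * Log_z) I
  /\ digamma s = CGamma s / (2 * PI * Ci) * I.
Proof.
  intros He Hs; exists (hankel_log_int s); split.
  - apply (hankel_of_tame eps _ (fun w => w * hankel_kernel s w)); auto.
    + intros w; unfold hankel_kernel; rewrite !Cexp_plus; ring.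
    + apply tame_id_hankel_kernel.
  - fold two_pi_i.
    transitivity (/ two_pi_i * (CGamma s * hankel_log_int s)).
    + rewrite CGamma_mul_hankel_log_int by auto; field; apply two_pi_i_neq_0.
    + field; apply two_pi_i_neq_0.
Qed.

Lemma euler_gamma_hankel (eps : R) : 0 < eps -> exists I : C,
  is_hankel_int eps (fun z Log_z => Cexp z * Log_z / z) I
  /\ RtoC euler_gamma = (- 1) / (2 * PI * Ci) * I.
Proof.
  intros He; exists (hankel_log_int 1); split.
  - apply (hankel_of_tame eps _ (fun w => w * hankel_kernel 1 w)); auto.
    + intros w; unfold hankel_kernel; rewrite !Cexp_plus.
      replace (- (1) * w) with (- w) by ring; rewrite Cexp_opp; field; apply Cexp_neq_0.
    + apply tame_id_hankel_kernel.
  - fold two_pi_i; rewrite euler_gamma_eq.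
    assert (E := CGamma_mul_hankel_log_int 1 ltac:(simpl; lra)).
    rewrite CGamma_1, Cmult_1_l in E; rewrite E.
    field; apply two_pi_i_neq_0.
Qed.

(** * The Hankel integral of the Bose kernel *)

Definition bose_kernel (s w : C) : C :=
  Cexp w * (Cexp (s * Cexp w) * / (1 - Cexp (Cexp w))).

(** The zeros of [1 - e^z] are the multiples of [2 PI i]: modulus 1 forces [Re z = 0], and
    [cos (Im z) = 1] forces [sin (Im z / 2) = 0] with [|Im z / 2| < PI]. *)
Lemma one_sub_exp_neq_0 (z : C) : z <> 0 -> Cmod z < 2 * PI -> 1 - Cexp z <> 0.
Proof.
  intros Hz Hlt E; apply Hz.
  assert (E1 : Cexp z = 1) by (replace (Cexp z) with (1 - (1 - Cexp z)) by ring; rewrite E; ring).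
  assert (Hre : Re z = 0%R).
  { apply exp_inv; rewrite exp_0, <- Cmod_Cexp, E1; apply Cmod_1. }
  assert (Hcos : cos (Im z) = 1%R).
  { apply (f_equal fst) in E1; unfold Cexp in E1; rewrite Hre, exp_0 in E1; simpl in E1.
    unfold Im in *; lra. }
  assert (Him : Rabs (Im z) < 2 * PI).
  { eapply Rle_lt_trans; [|exact Hlt].
    eapply Rle_trans; [apply Rmax_r|apply Rmax_Cmod]. }
  apply Rabs_def2 in Him.
  assert (Hs : sin (Im z / 2) = 0%R).
  { assert (H := cos_2a_sin (Im z / 2)).
    replace (2 * (Im z / 2))%R with (Im z) in H by field.
    rewrite Hcos in H.
    assert (sin (Im z / 2) * sin (Im z / 2) = 0)%R by lra.
    nra. }
  assert (Him0 : Im z = 0%R).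
  { destruct (Rtotal_order (Im z) 0) as [H|[H|H]]; auto; exfalso.
    - assert (0 < sin (- (Im z / 2))) by (apply sin_gt_0; lra).
      rewrite sin_neg in *; lra.
    - assert (0 < sin (Im z / 2)) by (apply sin_gt_0; lra); lra. }
  apply injective_projections; simpl; assumption.
Qed.

Lemma one_sub_exp_neq_0_left (w : C) : Re w < ln (2 * PI) -> 1 - Cexp (Cexp w) <> 0.
Proof.
  intros Hw; apply one_sub_exp_neq_0; [apply Cexp_neq_0|].
  assert (H := PI_RGT_0); rewrite Cmod_Cexp, <- (exp_ln (2 * PI)) by lra.
  now apply exp_increasing.
Qed.

Lemma one_sub_exp_neg_exp_pos (x : R) : 0 < 1 - exp (- exp x).
Proof.
  assert (exp (- exp x) < exp 0) by (apply exp_increasing; generalize (exp_pos x); lra).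
  rewrite exp_0 in *; lra.
Qed.

Lemma one_sub_exp_neq_0_ray (th x : R) :
  Cexp (log_pt x th) = RtoC (- exp x) -> 1 - Cexp (Cexp (log_pt x th)) <> 0.
Proof.
  intros ->; rewrite Cexp_RtoC, <- RtoC_minus; apply RtoC_neq_0.
  generalize (one_sub_exp_neg_exp_pos x); lra.
Qed.

(** Differentiating [1 / (1 - e^z)] in [w], at [z = e^w], multiplies it by [bose_kernel 1]. Hence
    all derivatives are polynomials in such kernels and [e^w]. *)
Definition bose_deriv (s w : C) : C :=
  bose_kernel s w * (1 + s * Cexp w) + bose_kernel s w * bose_kernel 1 w.

Lemma CC_derive_bose_kernel (s w : C) : 1 - Cexp (Cexp w) <> 0 ->
  CC_derive (bose_kernel s) w (bose_deriv s w).
Proof.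
  intros Hw; unfold bose_deriv, bose_kernel.
  eapply CC_derive_val.
  - apply CC_derive_mult; [apply CC_derive_exp|].
    apply CC_derive_mult.
    + apply CC_derive_exp_comp, CC_derive_mult; [apply CC_derive_const|apply CC_derive_exp].
    + apply (CC_derive_inv (fun w => 1 - Cexp (Cexp w))); auto.
      apply CC_derive_minus; [apply CC_derive_const|apply CC_derive_exp_comp, CC_derive_exp].
  - simpl; rewrite Cmult_1_l; field; auto.
Qed.

Lemma CC_derive_bose_deriv (s w : C) : 1 - Cexp (Cexp w) <> 0 ->
  CC_derive (bose_deriv s) w
    (bose_deriv s w * (1 + s * Cexp w) + bose_kernel s w * (s * Cexp w)
     + (bose_deriv s w * bose_kernel 1 w + bose_kernel s w * bose_deriv 1 w)).
Proof.
  intros Hw.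
  apply (CC_derive_plus (fun w => bose_kernel s w * (1 + s * Cexp w))
    (fun w => bose_kernel s w * bose_kernel 1 w));
    [apply (CC_derive_mult (bose_kernel s) (fun w => 1 + s * Cexp w))
    |apply (CC_derive_mult (bose_kernel s) (bose_kernel 1))]; try (now apply CC_derive_bose_kernel).
  eapply CC_derive_val.
  - apply CC_derive_plus; [apply CC_derive_const|].
    apply CC_derive_mult; [apply CC_derive_const|apply CC_derive_exp].
  - simpl; ring.
Qed.

Definition bose_log_deriv (s w : C) : C := bose_kernel s w + w * bose_deriv s w.

Lemma CC_derive_bose_log (s w : C) : 1 - Cexp (Cexp w) <> 0 ->
  CC_derive (fun w => w * bose_kernel s w) w (bose_log_deriv s w).
Proof. intros Hw; apply CC_derive_id_mul, CC_derive_bose_kernel, Hw. Qed.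

Lemma bose_log_deriv_holo (s : C) : exists K'' : C -> C,
  holo_left (ln (2 * PI)) (bose_log_deriv s) K''.
Proof.
  eexists; intros w Hw; apply one_sub_exp_neq_0_left in Hw.
  apply (CC_derive_plus (bose_kernel s) (fun w => w * bose_deriv s w));
    [now apply CC_derive_bose_kernel|].
  apply (CC_derive_id_mul (bose_deriv s)); now apply CC_derive_bose_deriv.
Qed.

Lemma exp_mul_sub_scal_exp_le (c a : R) : 0 < c -> 0 < a ->
  exists M : R, forall x, exp (c * x - a * exp x) <= M.
Proof.
  intros Hc Ha; exists (exp (c * ln c - c) * exp (- (c * ln a)))%R; intros x.
  assert (H := exp_mul_sub_exp_le c (x + ln a) Hc).
  rewrite exp_plus, exp_ln in H by auto.
  replace (exp (c * x - a * exp x))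
    with (exp (c * (x + ln a) - exp x * a) * exp (- (c * ln a)))%R
    by (rewrite <- exp_plus; f_equal; ring).
  apply Rmult_le_compat_r; auto; left; apply exp_pos.
Qed.

Lemma bose_kernel_ray (s : C) (th x : R) : Cexp (log_pt x th) = RtoC (- exp x) ->
  bose_kernel s (log_pt x th) =
  RtoC (- exp x) * (Cexp (s * RtoC (- exp x)) * / RtoC (1 - exp (- exp x))).
Proof.
  intros E; unfold bose_kernel; rewrite E, Cexp_RtoC, <- RtoC_minus; reflexivity.
Qed.

Lemma ray_decay_bose_log (s : C) (u : R) : 0 < Re s -> ray_decay u (fun w => w * bose_kernel s w).
Proof.
  intros Hs; assert (HPI := PI_RGT_0).
  (* Three powers of [e^x]: one from [dz], one bounding [|w|], one for the required decay
     [e^(- x)]. *)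
  destruct (exp_mul_sub_scal_exp_le 3 (Re s) ltac:(lra) Hs) as [M0 HM0].
  set (k := (1 - exp (- exp u))%R).
  assert (Hk : 0 < k) by apply one_sub_exp_neg_exp_pos.
  assert (H : forall th x, u <= x -> Rabs th = PI -> Cexp (log_pt x th) = RtoC (- exp x) ->
    Cmod (log_pt x th * bose_kernel s (log_pt x th)) <= (exp (2 * Rabs u + PI) * M0 * / k) * exp (- x)).
  { intros th x Hx Hth E; rewrite bose_kernel_ray by auto.
    assert (Hkx := one_sub_exp_neg_exp_pos x).
    assert (Hle : k <= 1 - exp (- exp x)).
    { unfold k; assert (exp (- exp x) <= exp (- exp u)) by (apply exp_le; generalize (exp_le u x Hx); lra).
      lra. }
    rewrite !Cmod_mult, Cmod_inv, !Cmod_R, Cmod_Cexp, re_scal_r, Rabs_Ropp, !Rabs_pos_eq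
      by (try (apply RtoC_neq_0); try (left; apply exp_pos); lra).
    assert (B1 := Cmod_log_pt_le x th); rewrite Hth in B1.
    assert (B2 : Cmod (log_pt x th) <= exp (2 * Rabs u + PI) * exp x).
    { rewrite <- exp_plus.
      assert (Rabs x <= x + 2 * Rabs u).
      { unfold Rabs; destruct (Rcase_abs x), (Rcase_abs u); lra. }
      generalize (exp_ineq1_le (2 * Rabs u + PI + x)); lra. }
    apply Rle_trans with ((exp (2 * Rabs u + PI) * exp x) * (exp x * (exp (Re s * - exp x) * / k)))%R.
    - apply Rmult_le_compat; auto; [apply Cmod_ge_0| |].
      + repeat apply Rmult_le_pos; try (left; apply exp_pos); left; now apply Rinv_0_lt_compat.
      + apply Rmult_le_compat_l; [left; apply exp_pos|].
        apply Rmult_le_compat_l; [left; apply exp_pos|].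
        now apply Rinv_le_contravar.
    - specialize (HM0 x).
      replace (3 * x - Re s * exp x)%R with (x + x + (Re s * - exp x) + x)%R in HM0 by ring.
      rewrite !exp_plus in HM0.
      assert (Hi : 0 < / k) by now apply Rinv_0_lt_compat.
      assert (Hq := exp_pos (2 * Rabs u + PI)).
      apply Rmult_le_reg_r with (exp x); [apply exp_pos|].
      replace (exp (2 * Rabs u + PI) * M0 * / k * exp (- x) * exp x)%R
        with (exp (2 * Rabs u + PI) * / k * M0 * (exp (- x) * exp x))%R by ring.
      replace (exp (- x) * exp x)%R with 1%R by (rewrite <- exp_plus, Rplus_opp_l, exp_0; auto).
      rewrite Rmult_1_r.
      apply Rle_trans with (exp (2 * Rabs u + PI) * / k * (exp x * exp x * exp (Re s * - exp x) * exp x))%R.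
      + right; ring.
      + apply Rmult_le_compat_l; auto; apply Rmult_le_pos; lra. }
  exists (exp (2 * Rabs u + PI) * M0 * / k)%R; intros x Hx; split; apply H; auto.
  - apply Rabs_pos_eq; lra.
  - apply Cexp_log_pt_PI.
  - rewrite Rabs_Ropp; apply Rabs_pos_eq; lra.
  - apply Cexp_log_pt_neg_PI.
Qed.

Lemma bose_log_cont_ray (s : C) (th x : R) : (forall x, Cexp (log_pt x th) = RtoC (- exp x)) ->
  CR_cont (fun x => log_pt x th * bose_kernel s (log_pt x th)) x.
Proof.
  intros E; apply (CR_derive_cont _ _ (bose_log_deriv s (log_pt x th))).
  apply (CC_derive_hline (fun w => w * bose_kernel s w)), CC_derive_bose_log.
  now apply one_sub_exp_neq_0_ray.
Qed.

Lemma ln_2PI_pos : 0 < ln (2 * PI).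
Proof.
  rewrite <- ln_1; apply ln_increasing; [lra|].
  generalize PI2_1; lra.
Qed.

Definition bose_log_int (s : C) : C := contour_int (fun w => w * bose_kernel s w).

(** The start [u = 0] of [contour_int] is admissible since [2 PI > 1]; from there the contour moves
    freely short of the first poles, on [|z| = 2 PI]. *)
Lemma bose_log_int_correct (s : C) (u : R) : 0 < Re s -> u < ln (2 * PI) ->
  is_contour_int u (fun w => w * bose_kernel s w) (bose_log_int s).
Proof.
  intros Hs Hu.
  destruct (bose_log_deriv_holo s) as [K'' HK''].
  assert (HK : holo_left (ln (2 * PI)) (fun w => w * bose_kernel s w) (bose_log_deriv s)).
  { intros w Hw; now apply CC_derive_bose_log, one_sub_exp_neq_0_left. }
  assert (H0 := ln_2PI_pos).
  apply (contour_shift _ _ _ _ 0 u _ HK HK''); auto.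
  destruct (ex_contour_int 0 (fun w => w * bose_kernel s w)) as [l Hl].
  - intros x; apply bose_log_cont_ray, Cexp_log_pt_PI.
  - intros x; apply bose_log_cont_ray, Cexp_log_pt_neg_PI.
  - intros th; apply (holo_left_cont_v _ _ _ _ _ HK H0).
  - now apply ray_decay_bose_log.
  - destruct Hl as [A [B [D [HA [HB [HD E]]]]]].
    unfold bose_log_int, contour_int.
    rewrite (is_RInt_gen_unique (V := C_R_CompleteNormedModule) _ _ HA),
      (is_RInt_gen_unique (V := C_R_CompleteNormedModule) _ _ HB),
      (is_RInt_unique (V := C_R_CompleteNormedModule) _ _ _ _ HD).
    exists A, B, D; auto.
Qed.

Lemma Cmod_two_pi_i : Cmod two_pi_i = (2 * PI)%R.
Proof.
  unfold two_pi_i; rewrite !Cmod_mult, Cmod_Ci, !Cmod_R, !Rabs_pos_eq;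
  generalize PI_RGT_0; lra.
Qed.

Lemma Ceq_of_eps (a b : C) : (forall eps, 0 < eps -> Cmod (a - b) <= eps) -> a = b.
Proof.
  intros H; apply Ceq_minus, Cmod_eq_0, Rle_antisym; [|apply Cmod_ge_0].
  apply le_epsilon; intros eps He; rewrite Rplus_0_l; auto.
Qed.

Lemma ex_exp_half_small (K eps u0 : R) : 0 <= K -> 0 < eps ->
  exists u, u <= u0 /\ K * exp (u / 2) <= eps.
Proof.
  intros HK He; exists (Rmin u0 (2 * ln (eps / (K + 1)))); split; [apply Rmin_l|].
  assert (Hq : 0 < eps / (K + 1)) by (apply Rdiv_lt_0_compat; lra).
  apply Rle_trans with ((K + 1) * (eps / (K + 1)))%R; [|right; field; lra].
  apply Rmult_le_compat; try lra; [left; apply exp_pos|].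
  rewrite <- (exp_ln (eps / (K + 1))) at 2 by auto.
  apply exp_le; generalize (Rmin_r u0 (2 * ln (eps / (K + 1)))); lra.
Qed.

(** Half of the exponent absorbs the factor [|u|], since [|u| / 2 <= e^(|u| / 2)]. *)
Lemma log_exp_small (u : R) : u <= 0 -> (Rabs u + PI) * exp u <= (2 + PI) * exp (u / 2).
Proof.
  intros Hu; rewrite Rabs_left1 by auto.
  assert (H := exp_ineq1_le (- u / 2)); assert (Hp := exp_pos (u / 2)).
  assert (H1 : (exp (- u / 2) * exp (u / 2) = 1)%R).
  { rewrite <- exp_plus; replace (- u / 2 + u / 2)%R with 0%R by field; apply exp_0. }
  assert (H2 : exp (u / 2) <= 1) by (rewrite <- exp_0; apply exp_le; lra).
  replace (exp u) with (exp (u / 2) * exp (u / 2))%R by (rewrite <- exp_plus; f_equal; field).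
  rewrite <- Rmult_assoc; apply Rmult_le_compat_r; [lra|].
  assert (HPI := PI_RGT_0).
  assert (- u / 2 * exp (u / 2) <= 1).
  { rewrite <- H1; apply Rmult_le_compat_r; lra. }
  nra.
Qed.

(* The values of [w] on the two rays differ by [two_pi_i], so for a periodic [k] the rays
   contribute [two_pi_i * J]; as [u] tends to minus infinity only the part [- a * w] of
   the integrand matters on the circle. *)
Lemma log_collapse (k : C -> C) (a C0 u : R) (l : C) : u <= 0 -> 0 <= C0 ->
  (forall x, k (log_pt x (- PI)) = k (log_pt x PI)) ->
  (forall theta, Cmod (k (log_pt u theta) + RtoC a) <= C0 * exp u) ->
  is_contour_int u (fun w => w * k w) l ->
  exists J, CR_int_gen (fun x => k (log_pt x PI)) (at_point u) (Rbar_locally p_infty) J /\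
    Cmod (l - two_pi_i * (J - RtoC (a * u))) <= 2 * PI * ((2 + PI) * C0) * exp (u / 2).
Proof.
  intros Hu HC0 Hper Hk [A [B [D [HA [HB [HD E]]]]]].
  assert (HPI := PI_RGT_0).
  exists (/ two_pi_i * (A - B)); split.
  - assert (H := CR_int_gen_Cscal _ _ (/ two_pi_i) _ _ (CR_int_gen_minus _ _ _ _ _ _ HA HB)).
    revert H; apply CR_int_gen_ext; try apply _; intros x; rewrite Hper.
    unfold log_pt; rewrite RtoC_opp.
    transitivity (/ two_pi_i * two_pi_i * k (RtoC x + Ci * RtoC PI)).
    + generalize (/ two_pi_i); intros t; unfold two_pi_i; ring.
    + rewrite Cinv_l by apply two_pi_i_neq_0; ring.
  (* The mean of [w] over the circle is [u], its imaginary part being odd in [theta]; hence the term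
     [a u] set against [J]. *)
  - assert (HW : CR_int (fun theta => log_pt u theta) (- PI) PI (RtoC (2 * PI * u))).
    { assert (Hd : forall w, CC_derive (fun w => w * w * / (2 * Ci)) w (w * / Ci)).
      { intros w; eapply CC_derive_val.
        - apply CC_derive_mult; [apply CC_derive_mult; apply CC_derive_id|apply CC_derive_const].
        - simpl; field; apply Ci_nz. }
      assert (H := CR_int_derive (fun theta => (fun w => w * w * / (2 * Ci)) (log_pt u theta))
        (fun theta => log_pt u theta) (- PI) PI).
      replace (RtoC (2 * PI * u)) with
        (log_pt u PI * log_pt u PI * / (2 * Ci) - log_pt u (- PI) * log_pt u (- PI) * / (2 * Ci)).
      - apply H.
        + intros x; replace (log_pt u x) with (Ci * (log_pt u x * / Ci)) by (field; apply Ci_nz).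
          apply (CC_derive_vline (fun w => w * w * / (2 * Ci))), Hd.
        + intros x; apply (CR_derive_cont _ _ (Ci * 1)).
          apply (CC_derive_vline (fun w => w)), CC_derive_id.
      - unfold log_pt; rewrite RtoC_opp, !RtoC_mult; field; apply Ci_nz. }
    assert (HB2 := is_RInt_plus (V := C_R_NormedModule) _ _ _ _ _ _ HD (CR_int_Cscal (RtoC a) _ _ _ _ HW)).
    apply (Cmod_int_const_le _ _ _ ((Rabs u + PI) * (C0 * exp u))) in HB2.
    + replace (l - two_pi_i * (/ two_pi_i * (A - B) - RtoC (a * u)))
        with (Ci * (D + RtoC a * RtoC (2 * PI * u))).
      * rewrite Cmod_mult, Cmod_Ci, Rmult_1_l.
        eapply Rle_trans; [exact HB2|].
        assert (H := log_exp_small u Hu).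
        apply Rle_trans with (2 * PI * C0 * ((Rabs u + PI) * exp u))%R; [right; ring|].
        apply Rle_trans with (2 * PI * C0 * ((2 + PI) * exp (u / 2)))%R; [|right; ring].
        apply Rmult_le_compat_l; [nra|auto].
      * rewrite E; transitivity (A - B + Ci * D - (two_pi_i * / two_pi_i) * (A - B) + two_pi_i * RtoC (a * u)).
        -- rewrite Cinv_r by apply two_pi_i_neq_0.
           unfold two_pi_i; rewrite !RtoC_mult; ring.
        -- ring.
    + lra.
    + intros th Hth.
      change (Cmod (log_pt u th * k (log_pt u th) + RtoC a * log_pt u th) <= (Rabs u + PI) * (C0 * exp u)).
      replace (log_pt u th * k (log_pt u th) + RtoC a * log_pt u th)
        with (log_pt u th * (k (log_pt u th) + RtoC a)) by ring.
      rewrite Cmod_mult; apply Rmult_le_compat; auto using Cmod_ge_0.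
      eapply Rle_trans; [apply Cmod_log_pt_le|].
      apply Rplus_le_compat_l, Rabs_le; lra.
Qed.

(** Algebra with [1 / (1 - e^z)] is valid only away from its poles, which the contour avoids when
    [u < ln (2 PI)]. *)
Lemma contour_ext_bose (u : R) (K L : C -> C) (l : C) : u < ln (2 * PI) ->
  (forall w, 1 - Cexp (Cexp w) <> 0 -> K w = L w) -> is_contour_int u K l -> is_contour_int u L l.
Proof.
  intros Hu H [A [B [D [HA [HB [HD E]]]]]]; exists A, B, D; repeat split; auto.
  - revert HA; apply CR_int_gen_ext; try apply _; intros x.
    apply H, one_sub_exp_neq_0_ray, Cexp_log_pt_PI.
  - revert HB; apply CR_int_gen_ext; try apply _; intros x.
    apply H, one_sub_exp_neq_0_ray, Cexp_log_pt_neg_PI.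
  - revert HD; apply (is_RInt_ext (V := C_R_NormedModule)); intros theta _.
    apply H, one_sub_exp_neq_0_left; now rewrite Re_log_pt.
Qed.

Lemma filterlim_exp_neg_scal_exp (a : R) : 0 < a ->
  filterlim (fun x => exp (- (a * exp x))) (Rbar_locally p_infty) (locally 0).
Proof.
  intros Ha; destruct (exp_mul_sub_scal_exp_le 1 a Rlt_0_1 Ha) as [M HM].
  apply (is_lim_le_le_loc (fun _ => 0%R) (fun x => M * exp (- x))%R _ p_infty 0%R).
  - exists 0%R; intros x _; split; [left; apply exp_pos|].
    specialize (HM x).
    replace (- (a * exp x))%R with (1 * x - a * exp x + - x)%R by ring.
    rewrite exp_plus; apply Rmult_le_compat_r; auto; left; apply exp_pos.
  - apply is_lim_const.
  - replace 0%R with (M * 0)%R by ring.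
    apply (is_lim_scal_l (fun x => exp (- x)) M p_infty 0%R), filterlim_exp_neg_p_infty.
Qed.

(** The two integrands differ by [e^(s z)], regular at 0, so [log_collapse] applies with [a = 0];
    [J] tends to the integral of [- e^(- s r)] over [r > 0], which is [- 1 / s]. *)
Lemma bose_log_int_succ (s : C) : 0 < Re s ->
  bose_log_int s = bose_log_int (s + 1) - two_pi_i * / s.
Proof.
  intros Hs; assert (Hs0 := Re_pos_neq_0 s Hs); assert (HPI := PI_RGT_0).
  assert (Hm := Cmod_ge_0 s); assert (H2PI := ln_2PI_pos).
  set (C0 := exp (Cmod s)).
  assert (HC0 : 0 < C0) by apply exp_pos.
  apply Ceq_of_eps; intros eps He.
  destruct (ex_exp_half_small (2 * PI * ((2 + PI) * C0) + 2 * PI) eps 0) as [u [Hu Hue]]; auto.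
  { nra. }
  assert (HI := contour_plus _ _ _ _ _ (bose_log_int_correct s u Hs ltac:(lra))
     (contour_Cscal _ (- (1)) _ _ (bose_log_int_correct (s + 1) u ltac:(rewrite Re_succ; lra) ltac:(lra)))).
  set (k := fun w => Cexp w * Cexp (s * Cexp w)).
  apply (contour_ext_bose _ _ (fun w => w * k w)) in HI; [|lra|].
  2: { intros w Hw; unfold k, bose_kernel.
       replace ((s + 1) * Cexp w) with (s * Cexp w + Cexp w) by ring.
       rewrite (Cexp_plus (s * Cexp w)); field; auto. }
  assert (Hray : forall th x, Cexp (log_pt x th) = RtoC (- exp x) ->
     k (log_pt x th) = RtoC (- exp x) * Cexp (s * RtoC (- exp x))).
  { intros th x E; unfold k; now rewrite E. }
  apply (log_collapse k 0 C0) in HI; auto; [|lra| |].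
  - destruct HI as [J [HJ HB]].
    set (G := fun w => Cexp (- s * Cexp w) * / s).
    assert (HG : forall w, CC_derive G w (- Cexp w * Cexp (- s * Cexp w))).
    { intros w; eapply CC_derive_val.
      - apply CC_derive_mult; [|apply CC_derive_const].
        apply CC_derive_exp_comp, CC_derive_mult; [apply CC_derive_const|apply CC_derive_exp].
      - simpl; field; auto. }
    assert (EJ : J = 0 - G (RtoC u)).
    { apply (CR_int_gen_unique _ _ _ _ _ HJ).
      apply (CR_int_gen_antiderivative _ _ (fun x => G (RtoC x))).
      - intros x; rewrite Hray by apply Cexp_log_pt_PI.
        replace (RtoC (- exp x) * Cexp (s * RtoC (- exp x)))
          with (- Cexp (RtoC x) * Cexp (- s * Cexp (RtoC x))).
        + apply CC_derive_real_line, HG.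
        + rewrite Cexp_RtoC, RtoC_opp; do 2 f_equal; ring.
      - intros x; apply (CR_derive_cont _ _ ((fun w => Cexp w * Cexp (s * Cexp w)
            + Cexp w * (s * Cexp w * Cexp (s * Cexp w))) (log_pt x PI))).
        apply (CC_derive_hline k).
        apply (CC_derive_mult Cexp (fun w => Cexp (s * Cexp w)) _ _
          (s * Cexp (log_pt x PI) * Cexp (s * Cexp (log_pt x PI)))); [apply CC_derive_exp|].
        apply (CC_derive_exp_comp (fun w => s * Cexp w)).
        eapply CC_derive_val; [apply CC_derive_mult;
          [apply CC_derive_const|apply CC_derive_exp]|simpl; ring].
      - apply (filterlim_at_point (V := C_R_NormedModule) (fun x => G (RtoC x))).
      - apply (filterlim_Cmod_sub _ _ 0 (fun x => / Cmod s * exp (- (Re s * exp x)))%R).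
        + apply filter_forall; intros x; unfold Cminus; rewrite Copp_0, Cplus_0_r.
          unfold G; rewrite Cmod_mult, Cmod_inv, Cmod_Cexp, Cexp_RtoC, re_scal_r by auto.
          right; rewrite Rmult_comm; do 2 f_equal; unfold Re; simpl; ring.
        + replace 0%R with (/ Cmod s * 0)%R by ring.
          apply (is_lim_scal_l (fun x => exp (- (Re s * exp x))) (/ Cmod s) p_infty 0%R).
          now apply filterlim_exp_neg_scal_exp. }
    assert (HJ1 : Cmod (J + / s) <= exp u).
    { rewrite EJ; unfold G; rewrite Cexp_RtoC.
      replace (0 - Cexp (- s * RtoC (exp u)) * / s + / s)
        with ((Cexp 0 - Cexp (- s * RtoC (exp u))) / s) by (rewrite Cexp_0; field; auto).
      rewrite Cmod_div by auto.
      assert (Hsp := proj1 (Cmod_gt_0 s) Hs0).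
      apply Rle_div_l; auto.
      eapply Rle_trans; [apply Cmod_exp_sub_exp|].
      - simpl; lra.
      - rewrite re_scal_r; generalize (exp_pos u); unfold Re in *; simpl; nra.
      - replace (0 - - s * RtoC (exp u)) with (s * RtoC (exp u)) by ring.
        rewrite Cmod_mult, Cmod_R, Rabs_pos_eq by (left; apply exp_pos); lra. }
    replace (bose_log_int s - (bose_log_int (s + 1) - two_pi_i * / s))
      with (bose_log_int s + - (1) * bose_log_int (s + 1) - two_pi_i * (J - RtoC (0 * u))
            + two_pi_i * (J + / s)) by (rewrite Rmult_0_l; ring).
    eapply Rle_trans; [apply Cmod_triangle|]; rewrite (Cmod_mult two_pi_i (J + / s)), Cmod_two_pi_i.
    assert (exp u <= exp (u / 2)) by (apply exp_le; lra).
    nra.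
  - intros x; rewrite !Hray; auto using Cexp_log_pt_PI, Cexp_log_pt_neg_PI.
  - intros th; unfold k; rewrite Cplus_0_r, Cmod_mult, Cmod_Cexp, Re_log_pt, Rmult_comm.
    apply Rmult_le_compat_r; [left; apply exp_pos|].
    eapply Rle_trans; [apply Cmod_exp_mul_le|]; rewrite Cmod_Cexp, Re_log_pt.
    assert (exp u <= 1) by (rewrite <- exp_0; now apply exp_le).
    apply exp_le; nra.
Qed.

(** The second-order remainder is at most [|z|^2 e^(|z|)], hence at most [|z| / 2] once
    [|z| <= 1 / (2 e)]. *)
Lemma Cmod_one_sub_exp_ge (z : C) : Cmod z <= / (2 * exp 1) -> Cmod z / 2 <= Cmod (1 - Cexp z).
Proof.
  intros Hz.
  assert (H := Cmod_exp_sub_1_sub z); assert (Hm := Cmod_ge_0 z).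
  assert (He := exp_ineq1_le 1).
  assert (H1 : / (2 * exp 1) <= 1).
  { apply Rle_trans with (/ 1)%R; [apply Rinv_le_contravar; lra|lra]. }
  assert (H2 : exp (Cmod z) <= exp 1) by (apply exp_le; lra).
  assert (H3 : Cmod z * exp (Cmod z) <= / 2).
  { apply Rle_trans with (/ (2 * exp 1) * exp 1)%R.
    - apply Rmult_le_compat; auto; left; apply exp_pos.
    - right; field; lra. }
  assert (H4 : Cmod (Cexp z - 1 - z) <= Cmod z * / 2).
  { eapply Rle_trans; [exact H|]; rewrite Rmult_assoc; now apply Rmult_le_compat_l. }
  assert (H5 := Cmod_triangle (1 - Cexp z) (Cexp z - 1 - z)).
  replace (1 - Cexp z + (Cexp z - 1 - z)) with (- z) in H5 by ring.
  rewrite Cmod_opp in H5; lra.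
Qed.

Lemma exp_small_of_le_ln (u : R) : u <= ln (/ (2 * exp 1)) ->
  exp u <= / (2 * exp 1) /\ exp u <= 1 /\ u <= 0 /\ u < ln (2 * PI).
Proof.
  intros Hu.
  assert (He := exp_ineq1_le 1); assert (HL := ln_2PI_pos).
  assert (Hp : 0 < / (2 * exp 1)) by (apply Rinv_0_lt_compat; lra).
  assert (H1 : / (2 * exp 1) <= 1).
  { apply Rle_trans with (/ 1)%R; [apply Rinv_le_contravar; lra|lra]. }
  assert (Hexp : exp u <= / (2 * exp 1)).
  { rewrite <- (exp_ln (/ (2 * exp 1))) by auto; now apply exp_le. }
  assert (u <= 0).
  { apply Rle_trans with (1 := Hu); rewrite <- ln_1; now apply ln_le. }
  repeat split; lra.
Qed.

(** This is [1 + r <= e^r] times [e^(- r)]. For [r > 0] it bounds the Bose factor [r / (e^r - 1)] by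
    1. *)
Lemma exp_neg_mul_le (r : R) : r * exp (- r) <= 1 - exp (- r).
Proof.
  assert (H := exp_ineq1_le r).
  assert (E : (exp r * exp (- r) = 1)%R) by (rewrite <- exp_plus, Rplus_opp_r; apply exp_0).
  generalize (exp_pos (- r)); nra.
Qed.

(** The poles at 0 cancel in the difference, so [a = 0] in [log_collapse]. On the ray, with
    [r = e^x], the two exponentials differ by at most [|s - 1| r] and the Bose factor is at most 1,
    which leaves [|s - 1|] times the integral of [e^(- (n - 1) r)]. *)
Lemma Cmod_bose_log_int_sub_le (s : C) (n : nat) : 0 < Re s -> (2 <= n)%nat ->
  Cmod (bose_log_int (s + RtoC (INR n)) - bose_log_int (1 + RtoC (INR n)))
  <= 2 * PI * (Cmod (s - 1) / (INR n - 1)).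
Proof.
  intros Hs Hn; assert (HPI := PI_RGT_0).
  assert (Hn2 : 2 <= INR n) by (apply (le_INR 2); auto).
  (* One factor [e^(- r)] out of [e^(- n r)] is spent on the Bose factor. *)
  set (m := (INR n - 1)%R); assert (Hm : 0 < m) by (unfold m; lra).
  set (d := Cmod (s - 1)); assert (Hd : 0 <= d) by apply Cmod_ge_0.
  (* On the small circle 2 bounds [|z / (1 - e^z)|], the next factor bounds [e^((1 + n) z)], and
     [d e^d] bounds [e^((s - 1) z) - 1] divided by [|z|]. *)
  set (C0 := (2 * (exp (1 + INR n) * (d * exp d)))%R).
  assert (HC0 : 0 <= C0).
  { unfold C0; generalize (exp_pos (1 + INR n)) (exp_pos d); intros.
    repeat apply Rmult_le_pos; lra. }
  apply le_epsilon; intros eps He.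
  destruct (ex_exp_half_small (2 * PI * ((2 + PI) * C0)) eps (ln (/ (2 * exp 1)))) as [u [Hu Hue]]; auto.
  { apply Rmult_le_pos; [lra|apply Rmult_le_pos; lra]. }
  destruct (exp_small_of_le_ln u Hu) as [Hu1 [Hu2 [Hu3 Hu4]]].
  assert (H1 : 0 < Re 1) by (simpl; lra).
  assert (HI := contour_plus _ _ _ _ _ (bose_log_int_correct _ u (Re_plus_INR s n Hs) Hu4)
     (contour_Cscal _ (- (1)) _ _ (bose_log_int_correct _ u (Re_plus_INR 1 n H1) Hu4))).
  set (k := fun w => bose_kernel (s + RtoC (INR n)) w - bose_kernel (1 + RtoC (INR n)) w).
  apply (contour_ext _ _ (fun w => w * k w)) in HI; [|intros w; unfold k; ring].
  apply (log_collapse k 0 C0) in HI; auto.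
  - destruct HI as [J [HJ HB]].
    assert (HBJ : Cmod J <= d / m).
    { assert (Hg : is_RInt_gen (fun x => d * (exp x * exp (- (m * exp x))))%R (at_point u)
          (Rbar_locally p_infty) (minus (- (d / m) * 0) (- (d / m) * exp (- (m * exp u))))%R).
      { apply (is_RInt_gen_antiderivative (V := R_CompleteNormedModule) _ _
          (fun x => - (d / m) * exp (- (m * exp x)))%R).
        - intros x; auto_derive; auto; field; lra.
        - intros x; cont_derive.
        - apply (filterlim_at_point (V := R_UniformSpace) (fun x => - (d / m) * exp (- (m * exp x)))%R).
        - apply (is_lim_scal_l (fun x => exp (- (m * exp x))) (- (d / m)) p_infty 0%R).
          now apply filterlim_exp_neg_scal_exp. }
      assert (Hpt : forall x, u <= x ->
        Cmod (k (log_pt x PI)) <= d * (exp x * exp (- (m * exp x)))).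
      { intros x _; unfold k; rewrite !bose_kernel_ray by apply Cexp_log_pt_PI.
        set (r := exp x); assert (Hr : 0 < r) by apply exp_pos.
        assert (Hq : 0 < 1 - exp (- r)) by apply one_sub_exp_neg_exp_pos.
        replace (RtoC (- r) * (Cexp ((s + RtoC (INR n)) * RtoC (- r)) * / RtoC (1 - exp (- r)))
            - RtoC (- r) * (Cexp ((1 + RtoC (INR n)) * RtoC (- r)) * / RtoC (1 - exp (- r))))
          with (RtoC (- r) * / RtoC (1 - exp (- r)) * (Cexp (RtoC (- (INR n * r))) *
             (Cexp (s * RtoC (- r)) - Cexp (RtoC (- r))))).
        2: { replace ((s + RtoC (INR n)) * RtoC (- r)) with (RtoC (- (INR n * r)) + s * RtoC (- r))
               by (rewrite !RtoC_opp, RtoC_mult; ring).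
             replace ((1 + RtoC (INR n)) * RtoC (- r)) with (RtoC (- (INR n * r)) + RtoC (- r))
               by (rewrite !RtoC_opp, RtoC_mult; ring).
             rewrite !Cexp_plus; ring. }
        rewrite !Cmod_mult, Cmod_inv, !Cmod_R, Cmod_Cexp, re_RtoC, Rabs_Ropp, !Rabs_pos_eq
          by (try (apply RtoC_neq_0); lra).
        assert (HD : Cmod (Cexp (s * RtoC (- r)) - Cexp (RtoC (- r))) <= d * r).
        { eapply Rle_trans; [apply Cmod_exp_sub_exp|].
          - rewrite re_scal_r; nra.
          - simpl; lra.
          - replace (s * RtoC (- r) - RtoC (- r)) with ((s - 1) * RtoC (- r)) by ring.
            rewrite Cmod_mult, Cmod_R, Rabs_Ropp, Rabs_pos_eq by lra; unfold d; lra. }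
        replace (- (INR n * r))%R with (- (m * r) + - r)%R by (unfold m; ring).
        rewrite exp_plus.
        assert (Hl := exp_neg_mul_le r); assert (Hem := exp_pos (- (m * r))); assert (Her := exp_pos (- r)).
        apply Rle_trans with (r * / (1 - exp (- r)) * (exp (- (m * r)) * exp (- r) * (d * r)))%R.
        - apply Rmult_le_compat_l; [apply Rmult_le_pos; [lra|left; now apply Rinv_0_lt_compat]|].
          apply Rmult_le_compat_l; [nra|auto].
        - replace (r * / (1 - exp (- r)) * (exp (- (m * r)) * exp (- r) * (d * r)))%R
            with ((d * (r * exp (- (m * r)))) * ((r * exp (- r)) * / (1 - exp (- r))))%R by ring.
          rewrite <- (Rmult_1_r (d * (r * exp (- (m * r))))) at 2.
          apply Rmult_le_compat_l; [repeat apply Rmult_le_pos; lra|].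
          apply Rle_div_l; lra. }
      eapply Rle_trans; [apply (Cmod_int_gen_le (fun x => u <= x) (at_point u) (Rbar_locally p_infty)
        (fun x => k (log_pt x PI)) _ J _ (convex_pred_ge u) (Rle_refl u) (ray_ge_p_infty u)
        (at_point_le_p_infty u) Hpt HJ Hg)|].
      unfold minus, plus, opp; simpl.
      assert (Hdm : 0 <= d / m) by (apply Rmult_le_pos; [lra|left; now apply Rinv_0_lt_compat]).
      assert (exp (- (m * exp u)) <= 1).
      { rewrite <- exp_0; apply exp_le; generalize (exp_pos u); nra. }
      nra. }
    replace (bose_log_int (s + RtoC (INR n)) - bose_log_int (1 + RtoC (INR n)))
      with ((bose_log_int (s + RtoC (INR n)) + - (1) * bose_log_int (1 + RtoC (INR n))
        - two_pi_i * (J - RtoC (0 * u))) + two_pi_i * J) by (rewrite Rmult_0_l; ring).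
    eapply Rle_trans; [apply Cmod_triangle|]; rewrite (Cmod_mult two_pi_i J), Cmod_two_pi_i.
    assert (2 * PI * Cmod J <= 2 * PI * (d / m)) by (apply Rmult_le_compat_l; lra).
    lra.
  - intros x; unfold k; rewrite !bose_kernel_ray; auto using Cexp_log_pt_PI, Cexp_log_pt_neg_PI.
  - intros th; unfold k, bose_kernel; rewrite Cplus_0_r.
    assert (Ez : Cmod (Cexp (log_pt u th)) = exp u) by (now rewrite Cmod_Cexp, Re_log_pt).
    assert (Hz0 := Cexp_neq_0 (log_pt u th)).
    set (z := Cexp (log_pt u th)) in *.
    assert (Hq := Cmod_one_sub_exp_ge z ltac:(rewrite Ez; auto)); rewrite Ez in Hq.
    assert (Hp := exp_pos u).
    assert (Hq0 : 1 - Cexp z <> 0) by (apply Cmod_gt_0; lra).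
    replace (z * (Cexp ((s + RtoC (INR n)) * z) * / (1 - Cexp z))
        - z * (Cexp ((1 + RtoC (INR n)) * z) * / (1 - Cexp z)))
      with (z * / (1 - Cexp z) * (Cexp ((1 + RtoC (INR n)) * z) * (Cexp ((s - 1) * z) - 1))).
    2: { replace ((s + RtoC (INR n)) * z) with ((1 + RtoC (INR n)) * z + (s - 1) * z) by ring.
         rewrite (Cexp_plus _ ((s - 1) * z)); ring. }
    rewrite !Cmod_mult, Cmod_inv, Ez by auto.
    assert (B1 : Cmod (Cexp ((1 + RtoC (INR n)) * z)) <= exp (1 + INR n)).
    { eapply Rle_trans; [apply Cmod_exp_mul_le|]; rewrite Ez, <- RtoC_plus, Cmod_R, Rabs_pos_eq by lra.
      apply exp_le; nra. }
    assert (B2 : Cmod (Cexp ((s - 1) * z) - 1) <= exp u * (d * exp d)).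
    { eapply Rle_trans; [apply Cmod_exp_sub_1_small|]; rewrite Cmod_mult, Ez; fold d.
      assert (exp (d * exp u) <= exp d) by (apply exp_le; nra).
      apply Rle_trans with (d * exp u * exp d)%R; [apply Rmult_le_compat_l; nra|right; ring]. }
    assert (B3 : exp u * / Cmod (1 - Cexp z) <= 2).
    { apply Rle_div_l; lra. }
    assert (Hge := Cmod_ge_0 (Cexp ((1 + RtoC (INR n)) * z))); assert (Hge2 := Cmod_ge_0 (Cexp ((s - 1) * z) - 1)).
    unfold C0.
    replace (2 * (exp (1 + INR n) * (d * exp d)) * exp u)%R
      with (2 * (exp (1 + INR n) * (exp u * (d * exp d))))%R by ring.
    apply Rmult_le_compat; auto.
    + apply Rmult_le_pos; [lra|left; apply Rinv_0_lt_compat; lra].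
    + apply Rmult_le_pos; auto.
    + apply Rmult_le_compat; auto.
Qed.

Lemma CR_derive_RtoC (f : R -> R) (x l : R) :
  is_derive f x l -> CR_derive (fun t => RtoC (f t)) x (RtoC l).
Proof.
  intros [_ H]; apply CR_derive_intro; intros eps.
  destruct (H x (fun P HP => HP) eps) as [d Hd]; exists d; intros h Hh.
  specialize (Hd (x + h)%R).
  change ((Rabs (x + h - x) < d) ->
    Rabs (f (x + h)%R - f x - (x + h - x) * l) <= eps * Rabs (x + h - x)) in Hd.
  replace (x + h - x)%R with h in Hd by ring.
  rewrite <- RtoC_mult, <- !RtoC_minus, Cmod_R; auto.
Qed.

(** Near [z = 0] the kernel tends to -1, hence [a = 1]. At [s = 1] the ray integral is explicit,
    [J = ln (1 - e^(- e^u))], and [J - u] tends to 0. *)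
Lemma bose_log_int_1 : bose_log_int 1 = 0.
Proof.
  assert (HPI := PI_RGT_0); assert (H1 : 0 < Re 1) by (simpl; lra).
  (* Over the denominator [1 - e^z], of modulus at least [|z| / 2], the kernel plus 1 has a
     numerator of modulus at most [2 e |z|^2]. *)
  set (C0 := (4 * exp 1)%R).
  assert (HC0 : 0 <= C0) by (unfold C0; generalize (exp_pos 1); lra).
  apply Ceq_of_eps; intros eps He.
  destruct (ex_exp_half_small (2 * PI * ((2 + PI) * C0) + 2 * PI) eps (ln (/ (2 * exp 1)))) as [u [Hu Hue]]; auto.
  { apply Rplus_le_le_0_compat; [|lra]; apply Rmult_le_pos; [lra|apply Rmult_le_pos; lra]. }
  destruct (exp_small_of_le_ln u Hu) as [Hu1 [Hu2 [Hu3 Hu4]]].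
  assert (HI := bose_log_int_correct 1 u H1 Hu4).
  apply (log_collapse (bose_kernel 1) 1 C0) in HI; auto.
  - destruct HI as [J [HJ HB]].
    set (F := fun x => (- ln (1 - exp (- exp x)))%R).
    assert (Hq := one_sub_exp_neg_exp_pos).
    assert (EJ : J = 0 - RtoC (F u)).
    { apply (CR_int_gen_unique _ _ _ _ _ HJ).
      apply (CR_int_gen_antiderivative _ _ (fun x => RtoC (F x))).
      - intros x; rewrite bose_kernel_ray by apply Cexp_log_pt_PI.
        rewrite Cmult_1_l, Cexp_RtoC, <- RtoC_inv, <- !RtoC_mult by (generalize (Hq x); lra).
        apply CR_derive_RtoC; unfold F; auto_derive; [apply Hq|].
        field; generalize (Hq x); lra.
      - intros x; apply (CR_derive_cont _ _ (bose_deriv 1 (log_pt x PI))).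
        apply (CC_derive_hline (bose_kernel 1)), CC_derive_bose_kernel.
        apply one_sub_exp_neq_0_ray, Cexp_log_pt_PI.
      - apply (filterlim_at_point (V := C_R_NormedModule) (fun x => RtoC (F x))).
      - apply (filterlim_Cmod_sub _ _ 0 F).
        + apply filter_forall; intros x; unfold Cminus; rewrite Copp_0, Cplus_0_r, Cmod_R.
          rewrite Rabs_pos_eq; [lra|]; unfold F.
          assert (ln (1 - exp (- exp x)) <= ln 1).
          { apply ln_le; [apply Hq|]; generalize (exp_pos (- exp x)); lra. }
          rewrite ln_1 in *; lra.
        + assert (HL : filterlim (fun x => 1 - exp (- exp x))%R (Rbar_locally p_infty) (locally (1 - 0)%R)).
          { apply (is_lim_minus' (fun _ => 1%R) (fun x => exp (- exp x)) p_infty 1 0).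
            - apply is_lim_const.
            - apply (filterlim_ext (fun x => exp (- (1 * exp x)))); [intros x; f_equal; ring|].
              apply filterlim_exp_neg_scal_exp; lra. }
          replace (1 - 0)%R with 1%R in HL by ring.
          replace 0%R with (- ln 1)%R at 1 by (rewrite ln_1; ring).
          apply (filterlim_comp _ _ _ (fun x => 1 - exp (- exp x))%R (fun y => - ln y)%R _ (locally 1%R)); auto.
          apply (ex_derive_continuous (V := R_NormedModule) (fun y => - ln y)%R).
          auto_derive; lra. }
    assert (HJ1 : Cmod (J - RtoC (1 * u)) <= exp u).
    { rewrite EJ; unfold F; rewrite Rmult_1_l.
      replace (0 - RtoC (- ln (1 - exp (- exp u))) - RtoC u)
        with (RtoC (ln (1 - exp (- exp u)) - u)) by (rewrite RtoC_minus, RtoC_opp; ring).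
      rewrite Cmod_R.
      (* [e^(u - e^u) <= 1 - e^(- e^u) <= e^u], so the logarithm lies between [u - e^u] and [u]. *)
      assert (L1 := exp_neg_mul_le (exp u)); rewrite <- exp_plus in L1.
      assert (L2 := exp_ineq1_le (- exp u)).
      apply ln_le in L1; [|apply exp_pos]; rewrite ln_exp in L1.
      assert (L3 : ln (1 - exp (- exp u)) <= ln (exp u)) by (apply ln_le; [apply Hq|lra]).
      rewrite ln_exp in L3.
      apply Rabs_le; generalize (exp_pos u); lra. }
    replace (bose_log_int 1 - 0) with (bose_log_int 1 - two_pi_i * (J - RtoC (1 * u))
       + two_pi_i * (J - RtoC (1 * u))) by ring.
    eapply Rle_trans; [apply Cmod_triangle|]; rewrite (Cmod_mult two_pi_i), Cmod_two_pi_i.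
    assert (exp u <= exp (u / 2)) by (apply exp_le; lra).
    nra.
  - intros x; rewrite !bose_kernel_ray; auto using Cexp_log_pt_PI, Cexp_log_pt_neg_PI.
  - intros th; unfold bose_kernel; rewrite Cmult_1_l.
    assert (Ez : Cmod (Cexp (log_pt u th)) = exp u) by (now rewrite Cmod_Cexp, Re_log_pt).
    set (z := Cexp (log_pt u th)) in *.
    assert (Hq := Cmod_one_sub_exp_ge z ltac:(rewrite Ez; auto)); rewrite Ez in Hq.
    assert (Hp := exp_pos u).
    assert (Hq0 : 1 - Cexp z <> 0) by (apply Cmod_gt_0; lra).
    replace (z * (Cexp z * / (1 - Cexp z)) + 1)
      with ((z * (Cexp z - 1) - (Cexp z - 1 - z)) / (1 - Cexp z)) by (field; auto).
    rewrite Cmod_div by auto.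
    assert (B1 := Cmod_exp_sub_1_small z); assert (B2 := Cmod_exp_sub_1_sub z); rewrite Ez in B1, B2.
    assert (B3 : exp (exp u) <= exp 1) by (now apply exp_le).
    assert (B4 : Cmod (z * (Cexp z - 1) - (Cexp z - 1 - z)) <= 2 * exp 1 * (exp u * exp u)).
    { eapply Rle_trans; [apply Cmod_triangle|]; rewrite Cmod_opp, Cmod_mult, Ez.
      assert (exp u * Cmod (Cexp z - 1) <= exp u * (exp u * exp (exp u))) by (apply Rmult_le_compat_l; lra).
      assert (exp u * exp u * exp (exp u) <= exp u * exp u * exp 1) by (apply Rmult_le_compat_l; nra).
      lra. }
    apply Rle_div_l; [lra|].
    eapply Rle_trans; [exact B4|]; unfold C0.
    apply Rle_trans with (4 * exp 1 * exp u * (exp u / 2))%R; [right; field|].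
    apply Rmult_le_compat_l; auto; generalize (exp_pos 1); nra.
Qed.

(** Both sides have the same increment [two_pi_i / s], so the discrepancy between the arguments [s]
    and 1 is unchanged when both move by [n]. There each difference tends to 0, and [bose_log_int_1]
    fixes the constant. *)
Lemma bose_log_int_eq (s : C) : 0 < Re s ->
  bose_log_int s = two_pi_i * (digamma s - digamma 1).
Proof.
  intros Hs; assert (H1 : 0 < Re 1) by (simpl; lra).
  set (d := fun a b => bose_log_int a - bose_log_int b - two_pi_i * (digamma a - digamma b)).
  assert (Hn : forall n : nat, d (s + RtoC (INR n)) (1 + RtoC (INR n)) = d s 1).
  { induction n as [|n IH]; [simpl; now rewrite !Cplus_0_r|].
    rewrite <- IH, !plus_INR_S; unfold d.
    rewrite (bose_log_int_succ (s + RtoC (INR n))), (bose_log_int_succ (1 + RtoC (INR n))),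
      !digamma_succ by now apply Re_plus_INR.
    ring. }
  assert (Hd : d s 1 = 0).
  { apply (Ctends_unique (fun _ => d s 1)); [apply Ctends_const|].
    assert (HB : Ctends (fun n => bose_log_int (s + RtoC (INR n)) - bose_log_int (1 + RtoC (INR n))) 0).
    { intros eps He.
      set (K := (2 * PI * Cmod (s - 1))%R).
      destruct (INR_unbounded (K / eps + 1)) as [N HN]; exists (N + 2)%nat; intros n Hn'.
      unfold Cminus at 1; rewrite Copp_0, Cplus_0_r.
      assert (HNn : INR N <= INR n) by (apply le_INR; lia).
      eapply Rle_trans; [apply Cmod_bose_log_int_sub_le; auto; lia|].
      assert (Hn2 : 2 <= INR n) by (apply (le_INR 2); lia).
      replace (2 * PI * (Cmod (s - 1) / (INR n - 1)))%R with (K / (INR n - 1))%R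
        by (unfold K; field; lra).
      apply Rle_div_l; [lra|].
      assert (HK : K / eps <= INR n - 1) by lra.
      apply Rle_div_l in HK; lra. }
    assert (H := Ctends_minus _ _ _ _ HB (Ctends_mult _ _ _ _ (Ctends_const two_pi_i)
      (Ctends_minus _ _ _ _ (digamma_shift_asymp s Hs) (digamma_shift_asymp 1 H1)))).
    replace (0 - two_pi_i * (0 - 0)) with (RtoC 0) in H by ring.
    revert H; apply (Ctends_ext 0); intros n _; rewrite <- (Hn n); unfold d; ring. }
  unfold d in Hd; rewrite bose_log_int_1 in Hd.
  replace (bose_log_int s) with
    (bose_log_int s - 0 - two_pi_i * (digamma s - digamma 1) + two_pi_i * (digamma s - digamma 1)) by ring.
  rewrite Hd; ring.
Qed.

Lemma is_hankel_int_plus (eps : R) (F G H : C -> C -> C) (l m : C) :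
  (forall z w, H z w = F z w + G z w) ->
  is_hankel_int eps F l -> is_hankel_int eps G m -> is_hankel_int eps H (l + m).
Proof.
  intros E [a [b [c [Ha [Hb [Hc ->]]]]]] [a' [b' [c' [Ha' [Hb' [Hc' ->]]]]]].
  exists (a + a'), (b + b'), (c + c'); repeat split.
  - exact (CR_int_gen_ext (Rbar_locally m_infty) (at_point (- eps)%R) _ (fun x => H (RtoC x) (Log_arg (- PI) (RtoC x))) _
      (fun x => eq_sym (E (RtoC x) (Log_arg (- PI) (RtoC x))))
      (CR_int_gen_plus (Rbar_locally m_infty) (at_point (- eps)%R) (fun x => F (RtoC x) (Log_arg (- PI) (RtoC x)))
        (fun x => G (RtoC x) (Log_arg (- PI) (RtoC x))) _ _ Ha Ha')).
  - generalize (is_RInt_plus (V := C_R_NormedModule) _ _ _ _ _ _ Hb Hb').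
    apply (is_RInt_ext (V := C_R_NormedModule)); intros x _; rewrite E.
    match goal with |- ?u = ?v => change (@eq C u v) end.
    symmetry; apply Cmult_plus_distr_r.
  - exact (CR_int_gen_ext (at_point (- eps)%R) (Rbar_locally m_infty) _ (fun x => H (RtoC x) (Log_arg PI (RtoC x))) _
      (fun x => eq_sym (E (RtoC x) (Log_arg PI (RtoC x))))
      (CR_int_gen_plus (at_point (- eps)%R) (Rbar_locally m_infty) (fun x => F (RtoC x) (Log_arg PI (RtoC x)))
        (fun x => G (RtoC x) (Log_arg PI (RtoC x))) _ _ Hc Hc')).
  - ring.
Qed.

Lemma digamma_hankel_bose (eps : R) (s : C) : 0 < eps < 2 * PI -> 0 < Re s -> exists I : C,
  is_hankel_int eps (fun z Log_z => Cexp (s * z) / (1 - Cexp z) * Log_z) I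
  /\ digamma s + euler_gamma = 1 / (2 * PI * Ci) * I.
Proof.
  intros [He1 He2] Hs; exists (bose_log_int s); split.
  - apply (hankel_of_contour eps _ (fun w => w * bose_kernel s w)); auto.
    + intros w; unfold bose_kernel, Cdiv; ring.
    + intros x; apply bose_log_cont_ray, Cexp_log_pt_PI.
    + intros x; apply bose_log_cont_ray, Cexp_log_pt_neg_PI.
    + apply bose_log_int_correct; auto; now apply ln_increasing.
  - fold two_pi_i; rewrite bose_log_int_eq, euler_gamma_eq by auto.
    field; apply two_pi_i_neq_0.
Qed.

Theorem lemma2 (eps : R) (heps : (0 < eps < 2 * PI)%R)
    (s : C) (hs : (0 < Re s)%R) :
  (exists I : C,
     is_hankel_int eps
       (fun z Log_z => (Cexp z / z + Cexp (s * z) / (1 - Cexp z)) * Log_z) I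
     /\ digamma s = 1 / (2 * PI * Ci) * I)
  /\
  (exists I : C,
     is_hankel_int eps
       (fun z Log_z => Cexp (- s * Log_z) * Cexp z * Log_z) I
     /\ digamma s = CGamma s / (2 * PI * Ci) * I)
  /\
  (RtoC euler_gamma = - digamma 1
   /\ exists I : C,
     is_hankel_int eps (fun z Log_z => Cexp z * Log_z / z) I
     /\ RtoC euler_gamma = (- 1) / (2 * PI * Ci) * I)
  /\
  (exists I : C,
     is_hankel_int eps
       (fun z Log_z => Cexp (s * z) / (1 - Cexp z) * Log_z) I
     /\ digamma s + euler_gamma = 1 / (2 * PI * Ci) * I).
Proof.
  destruct (euler_gamma_hankel eps (proj1 heps)) as [I3 [HI3 E3]].
  destruct (digamma_hankel_bose eps s heps hs) as [I4 [HI4 E4]].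
  split; [|split; [|split; [split|]]].
  (* [digamma s] is [(digamma s + gamma) - gamma], and the formula for [gamma] carries the sign -1,
     so the two integrals add. *)
  - exists (I3 + I4); split.
    + revert HI3 HI4; apply is_hankel_int_plus; intros z w; unfold Cdiv; ring.
    + replace (digamma s) with (digamma s + RtoC euler_gamma - RtoC euler_gamma) by ring.
      rewrite E4, E3 at 1.
      fold two_pi_i; field; apply two_pi_i_neq_0.
  - apply digamma_hankel_power; auto; apply heps.
  - apply euler_gamma_eq.
  - exists I3; auto.
  - exists I4; auto.
Qed.
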